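(* For every $\varepsilon$-wavefront solution $(w_\varepsilon,v_\varepsilon)$ as described in the context, with collision times $0=t_0<t_1<\dots<t_J$, sets of waves $\mathcal W(t)$ and wave speeds $\sigma(t,s)$, $$\sum_{j=1}^{J}\sum_{s\in\mathcal W(t_j)}|\sigma(t_j,s)-\sigma(t_{j-1},s)|\,|s|\le\Big[3\|D^2_{ww}f\|_{L^\infty}+12\log(2)\,\|D^3_{wwv}f\|_{L^\infty}\,\mathrm{Tot.Var.}(v(0,\cdot))\Big]\mathrm{Tot.Var.}(w(0,\cdot))^2+\|D^2_{wv}f\|_{L^\infty}\,\mathrm{Tot.Var.}(w(0,\cdot))\,\mathrm{Tot.Var.}(v(0,\cdot)),$$ where $|s|:=\varepsilon$ is the strength of the wave $s$.
   Context: FLUX AND DATA. $f:\mathbb R^2\to\mathbb R$, $(w,v)\mapsto f(w,v)$, is of class $C^3$, with $\|D^\alpha f\|_{L^\infty}<\infty$ for every multi-index $|\alpha|\le 3$, and $\partial_w f>-1$ in a neighbourhood of $(0,0)$. $\|D^2_{ww}f\|_{L^\infty},\|D^2_{wv}f\|_{L^\infty},\|D^3_{wwv}f\|_{L^\infty}$ are the sup norms of $\partial^2 f/\partial w^2$, $\partial^2f/\partial w\partial v$, $\partial^3f/\partial w^2\partial v$. The equation considered is $w_t+\partial_wf(w,v)\,w_x=0$, $v_t-v_x=0$. Fix $\varepsilon>0$. For a function $g$ of one variable, $g_\varepsilon$ is the continuous function equal to $g$ on $\varepsilon\mathbb Z$ and affine on each $[m\varepsilon,(m+1)\varepsilon]$,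 $m\in\mathbb Z$; $f_\varepsilon(\cdot,v)$ is this interpolation in the variable $w$. $\mathrm{conv}_{[a,b]}g$ (resp. $\mathrm{conc}_{[a,b]}g$) is the largest convex function below (resp. smallest concave function above) $g$ on $[a,b]$. $\bar w=w(0,\cdot)$, $\bar v=v(0,\cdot)\in BV(\mathbb R)$ are the initial data; $\bar w_\varepsilon,\bar v_\varepsilon$ are right-continuous, piecewise constant, compactly supported functions with values in $\varepsilon\mathbb Z$, with $\mathrm{Tot.Var.}(\bar w_\varepsilon)\le\mathrm{Tot.Var.}(\bar w)$, $\mathrm{Tot.Var.}(\bar v_\varepsilon)\le\mathrm{Tot.Var.}(\bar v)$, taking values in intervals $I_w,I_v$ containing $0$ with $\partial_wf>-1$ on $I_w\times I_v$. WAVEFRONT SOLUTION. Riemann solver: for states $(w^-,v^-),(w^+,v^+)\in(\varepsilon\mathbb Z)^2$, $v(t,x)=v^-$ for $x<-t$ and $v^+$ for $x\ge -t$, while $w$ is the right-continuous piecewise constant self-similar entropy solution of the scalar Riemann problem $(w^-,w^+)$ with flux $f_\varepsilon(\cdot,v^+)$ (each elementary jump across an interval $(m\varepsilon,(m+1)\varepsilon)$ between $w^-$ and $w^+$ travels with the slope there of $\mathrm{conv}_{[w^-,w^+]}f_\varepsilon(\cdot,v^+)$ if $w^-<w^+$, of $\mathrm{conc}_{[w^+,w^-]}f_\varepsilon(\cdot,v^+)$ if $w^->w^+$). $(w_\varepsilon,v_\varepsilon)$ is the piecewise constant function, right-continuous in $x$, with initial datum $(\bar w_\varepsilon,\bar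 v_\varepsilon)$, obtained by wavefront tracking: solve the Riemann problems at $t=0$, let the straight discontinuity lines (wavefronts) travel until two meet, solve the new Riemann problem there, and so on. Discontinuities of $v_\varepsilon$ are wavefronts of the first family (speed $-1$), those of $w_\varepsilon$ wavefronts of the second family; a wavefront is positive or negative according to the sign of its jump. Collisions occur at points $(t_j,x_j)$, $j=1,\dots,J$, $0=:t_0<t_1<\dots<t_J$; it is assumed that exactly two wavefronts meet at each $t_j$, at the single point $x_j$. WAVES. $\mathcal W:=\{1,\dots,\frac1\varepsilon\mathrm{Tot.Var.}(\bar w_\varepsilon)\}$. Let $W(x):=\mathrm{Tot.Var.}(\bar w_\varepsilon;(-\infty,x])$, $\mathtt x(0,s):=\inf\{x:\varepsilon s\le W(x)\}$, $\mathcal S(s):=\mathrm{sign}[\bar w_\varepsilon(\mathtt x(0,s))-\bar w_\varepsilon(\mathtt x(0,s)-)]$ (the sign of $s$), $\hat w(s):=\bar w_\varepsilon(\mathtt x(0,s)-)+\mathcal S(s)[\varepsilon s-W(\mathtt x(0,s)-)]$. The position $\mathtt x(t,s)\in(-\infty,+\infty]$ and the speed $\sigma(t,s)$ are defined as follows. If $\mathtt x(t,s)=+\infty$ then $\sigma(t,s)=+\infty$. If $x=\mathtt x(t,s)<+\infty$, then $\sigma(t,s)$ is the slope of $\mathrm{conv}_{[w_\varepsilon(t,x-),w_\varepsilon(t,x)]}f_\varepsilon(\cdot,v_\varepsilon(t,x))$ on $(\hat w(s)-\varepsilon,\hat w(s))$ if $\mathcal S(s)=+1$, and the slope of $\mathrm{conc}_{[w_\varepsilon(t,x),w_\varepsilon(t,x-)]}f_\varepsilon(\cdot,v_\varepsilon(t,x))$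 on $(\hat w(s),\hat w(s)+\varepsilon)$ if $\mathcal S(s)=-1$. For $t\in(t_j,t_{j+1}]$ (or $t>t_J$), $\mathtt x(t,s):=\mathtt x(t_j,s)+\sigma(t_j,s)(t-t_j)$, except that a wave which would reach $x_{j+1}$ at $t_{j+1}$ is removed, i.e. $\mathtt x(t,s):=+\infty$ for $t\ge t_{j+1}$, unless $\mathcal S(s)w_\varepsilon(t_{j+1},x_{j+1}-)\le\mathcal S(s)\hat w(s)-\varepsilon\le\mathcal S(s)\hat w(s)\le\mathcal S(s)w_\varepsilon(t_{j+1},x_{j+1})$. Set $\mathcal W(t):=\{s\in\mathcal W:\mathtt x(t,s)<+\infty\}$. *)

(* Defs.v *)
From HB Require Import structures.
From mathcomp Require Import all_boot all_order all_algebra.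
From mathcomp Require Import all_classical all_reals all_analysis.

Set Implicit Arguments.
Unset Strict Implicit.
Unset Printing Implicit Defensive.

Import Order.TTheory GRing.Theory Num.Theory.
Import numFieldNormedType.Exports.

Local Open Scope classical_set_scope.
Local Open Scope ring_scope.

(* Functions of (w, v) are curried. *)
Definition pdw {R : realType} (g : R -> R -> R) : R -> R -> R :=
  fun w v => derive1 (g ^~ v) w.

Definition pdv {R : realType} (g : R -> R -> R) : R -> R -> R :=
  fun w v => derive1 (g w) v.

(* Iterated partial derivative along a word in the two directions
   (true for w, false for v), the last letter being applied first. *)
Definition partial {R : realType} (l : seq bool) (g : R -> R -> R)
    : R -> R -> R :=
  foldr (fun d h => if d then pdw h else pdv h) g l.

Definition class_C {R : realType} (k : nat) (g : R -> R -> R) : Prop :=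
  (forall l, (size l < k)%N -> forall w v,
     derivable (partial l g ^~ v) w 1 /\ derivable (partial l g w) v 1) /\
  (forall l, (size l <= k)%N ->
     continuous (fun p : R * R => partial l g p.1 p.2)).

Definition abs_range {R : realType} (g : R -> R -> R) : set R :=
  range (fun p : R * R => `|g p.1 p.2|).

(* Junk value when abs_range g is unbounded. *)
Definition supnorm {R : realType} (g : R -> R -> R) : R := sup (abs_range g).

Definition tot_var {R : realType} (A : set R) (g : R -> R) : \bar R :=
  ereal_sup [set total_variation p.1 p.2 g |
             p in [set p : R * R | p.1 <= p.2 /\ `[p.1, p.2] `<=` A]].

(* Tot.Var. over the whole line, as a real; 0 when infinite. *)
Definition TV {R : realType} (g : R -> R) : R := fine (tot_var setT g).

Definition left_lim {R : realType} (g : R -> R) (x : R) : R :=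
  lim (g @ x^'-).

Definition in_lattice {R : realType} (eps u : R) : Prop :=
  exists m : int, u = m%:~R * eps.

Definition piecewise_constant {R : realType} (g : R -> R) : Prop :=
  exists2 A : set R, finite_set A &
    forall x y, x <= y -> `[x, y] `&` A = set0 -> g x = g y.

Record admissible_datum {R : realType} (eps : R) (g : R -> R) : Prop := {
  datum_right_continuous : forall x, g @ x^'+ --> g x ;
  datum_piecewise_constant : piecewise_constant g ;
  datum_compact_support : compact (closure [set x | g x != 0]) ;
  datum_lattice : forall x, in_lattice eps (g x) }.

(* The function g_eps. *)
Definition interp {R : realType} (eps : R) (g : R -> R) (u : R) : R :=
  let m := Num.floor (u / eps) in
  let a := g (m%:~R * eps) in
  let b := g ((m + 1)%:~R * eps) in
  a + (u / eps - m%:~R) * (b - a).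

Definition conv_env {R : realType} (a b : R) (g : R -> R) (u : R) : R :=
  sup [set h u | h in [set h : R -> R |
    convex_function (`[a, b]%classic : set R) h /\
    forall z, a <= z <= b -> h z <= g z]].

Definition conc_env {R : realType} (a b : R) (g : R -> R) (u : R) : R :=
  inf [set h u | h in [set h : R -> R |
    convex_function (`[a, b]%classic : set R) (fun z => - h z) /\
    forall z, a <= z <= b -> g z <= h z]].

(* Used only on intervals on which g is affine. *)
Definition slope {R : realType} (g : R -> R) (a b : R) : R :=
  (g b - g a) / (b - a).

(* Indices m of the elementary intervals (m eps, (m + 1) eps) between the
   states wl and wr. *)
Definition cells {R : realType} (eps wl wr : R) : set int :=
  [set m : int | Num.min wl wr <= m%:~R * eps /\
                 (m + 1)%:~R * eps <= Num.max wl wr].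

Definition cell_speed {R : realType} (eps : R) (g : R -> R) (wl wr : R)
    (m : int) : R :=
  let env := if wl < wr then conv_env wl wr (interp eps g)
             else conc_env wr wl (interp eps g) in
  slope env (m%:~R * eps) ((m + 1)%:~R * eps).

(* Solution at (t, x), t >= 0, of the Riemann problem centred at the origin:
   every elementary jump of size eps between wl and wr sits at the position
   (its speed) * t.  The flux is g_eps, with g = f(., vr). *)
Definition riemann_w {R : realType} (eps : R) (g : R -> R) (wl wr t x : R)
    : R :=
  wl + \sum_(m \in cells eps wl wr)
         (if cell_speed eps g wl wr m * t <= x
          then Num.sg (wr - wl) * eps else 0).

Definition riemann_v {R : realType} (vl vr t x : R) : R :=
  if x < - t then vl else vr.

Definition jumps {R : realType} (w0 v0 : R -> R) : set R :=
  [set y | left_lim w0 y != w0 y \/ left_lim v0 y != v0 y].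

(* The profiles at time t when the Riemann problems of the profile (w0, v0)
   are solved at time 0 and the resulting fronts travel on straight lines:
   w0 and v0 vanish near -oo, and as long as no front overtakes another one
   the juxtaposition of the Riemann solutions is the sum over the jump points
   of the variations accumulated across them. *)
Definition evolve_w {R : realType} (eps : R) (f : R -> R -> R)
    (w0 v0 : R -> R) (t x : R) : R :=
  \sum_(y \in jumps w0 v0)
    (riemann_w eps (f ^~ (v0 y)) (left_lim w0 y) (w0 y) t (x - y)
     - left_lim w0 y).

Definition evolve_v {R : realType} (w0 v0 : R -> R) (t x : R) : R :=
  \sum_(y \in jumps w0 v0)
    (riemann_v (left_lim v0 y) (v0 y) t (x - y) - left_lim v0 y).

(* The wavefronts issued by the profile (w0, v0), a wavefront being given by
   its starting point and its speed.  The first disjunct is the first family;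
   speeds in the second family are > -1 when pdw f > -1, so the pair
   determines the family. *)
Definition fronts {R : realType} (eps : R) (f : R -> R -> R) (w0 v0 : R -> R)
    : set (R * R) :=
  [set p | (left_lim v0 p.1 != v0 p.1 /\ p.2 = -1) \/
           exists2 m, cells eps (left_lim w0 p.1) (w0 p.1) m &
             p.2 = cell_speed eps (f ^~ (v0 p.1)) (left_lim w0 p.1) (w0 p.1) m].

Definition fronts_at {R : realType} (F : set (R * R)) (t x : R)
    : set (R * R) :=
  F `&` [set p | p.1 + p.2 * t = x].

(* (w, v) is the eps-wavefront solution with datum (wb, vb), and its
   collisions are exactly the points (tc j, xc j), 1 <= j <= J.
   Only tc 0, ..., tc J and xc 1, ..., xc J are meaningful.  Solving the
   Riemann problems at all jump points of the profile at time tc j changes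
   nothing at jumps carrying a single front, which just keeps travelling. *)
Record wavefront_solution {R : realType} (eps : R) (f : R -> R -> R)
    (wb vb : R -> R) (J : nat) (tc xc : nat -> R) (w v : R -> R -> R)
    : Prop := {
  wfs_w0 : forall x, w 0 x = wb x ;
  wfs_v0 : forall x, v 0 x = vb x ;
  wfs_t0 : tc 0%N = 0 ;
  wfs_incr : forall j, (j < J)%N -> tc j < tc j.+1 ;
  wfs_evolve : forall j t x, (j <= J)%N ->
    tc j <= t -> ((j < J)%N -> t <= tc j.+1) ->
    w t x = evolve_w eps f (w (tc j)) (v (tc j)) (t - tc j) x /\
    v t x = evolve_v (w (tc j)) (v (tc j)) (t - tc j) x ;
  wfs_no_collision : forall j t x, (j <= J)%N ->
    tc j < t -> ((j < J)%N -> t < tc j.+1) ->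
    is_subset1 (fronts_at (fronts eps f (w (tc j)) (v (tc j))) (t - tc j) x) ;
  wfs_collision : forall j, (j < J)%N ->
    exists p q, p <> q /\
      fronts_at (fronts eps f (w (tc j)) (v (tc j)))
        (tc j.+1 - tc j) (xc j.+1) = [set p; q] ;
  wfs_single_collision : forall j x, (j < J)%N -> x <> xc j.+1 ->
    is_subset1 (fronts_at (fronts eps f (w (tc j)) (v (tc j)))
      (tc j.+1 - tc j) x) }.

Definition waves {R : realType} (eps : R) (wb : R -> R) : set nat :=
  [set s : nat | (1 <= s)%N /\ s%:R <= eps^-1 * TV wb].

(* W(x), the variation of wb up to x *)
Definition cum_var {R : realType} (wb : R -> R) (x : R) : R :=
  fine (tot_var `]-oo, x]%classic wb).

(* x(0, s) *)
Definition wave_start {R : realType} (eps : R) (wb : R -> R) (s : nat) : R :=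
  inf [set x | eps * s%:R <= cum_var wb x].

Definition wave_sign {R : realType} (eps : R) (wb : R -> R) (s : nat) : R :=
  let x := wave_start eps wb s in Num.sg (wb x - left_lim wb x).

(* \hat w(s) *)
Definition wave_state {R : realType} (eps : R) (wb : R -> R) (s : nat) : R :=
  let x := wave_start eps wb s in
  left_lim wb x
  + wave_sign eps wb s * (eps * s%:R - left_lim (cum_var wb) x).

(* Speed of the wave s when it sits at x and the profile is (w0, v0). *)
Definition speed_at {R : realType} (eps : R) (f : R -> R -> R) (wb : R -> R)
    (w0 v0 : R -> R) (s : nat) (x : \bar R) : \bar R :=
  if x is r%:E then
    let g := interp eps (f ^~ (v0 r)) in
    let ws := wave_state eps wb s in
    (if wave_sign eps wb s == 1
     then slope (conv_env (left_lim w0 r) (w0 r) g) (ws - eps) ws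
     else slope (conc_env (w0 r) (left_lim w0 r) g) ws (ws + eps))%:E
  else +oo%E.

(* Whether the wave s is not removed by a collision at x after which the
   profile is w0. *)
Definition survives {R : realType} (eps : R) (wb : R -> R) (w0 : R -> R)
    (s : nat) (x : R) : bool :=
  let S := wave_sign eps wb s in
  let ws := wave_state eps wb s in
  [&& S * left_lim w0 x <= S * ws - eps, S * ws - eps <= S * ws
    & S * ws <= S * w0 x].

(* x(t_j, s) *)
Fixpoint node_position {R : realType} (eps : R) (f : R -> R -> R)
    (wb : R -> R) (tc xc : nat -> R) (w v : R -> R -> R) (j : nat) (s : nat)
    : \bar R :=
  if j is i.+1 then
    let x := node_position eps f wb tc xc w v i s in
    let y := (x + speed_at eps f wb (w (tc i)) (v (tc i)) s x
                  * (tc i.+1 - tc i)%:E)%E in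
    if (y == (xc i.+1)%:E) && ~~ survives eps wb (w (tc i.+1)) s (xc i.+1)
    then +oo%E else y
  else (wave_start eps wb s)%:E.

(* Index of the last time tc j, j <= J, not after t. *)
Definition last_node {R : realType} (J : nat) (tc : nat -> R) (t : R) : nat :=
  \max_(j < J.+1 | tc j <= t) j.

(* x(t, s) *)
Definition position {R : realType} (eps : R) (f : R -> R -> R)
    (wb : R -> R) (J : nat) (tc xc : nat -> R) (w v : R -> R -> R)
    (t : R) (s : nat) : \bar R :=
  let j := last_node J tc t in
  let x := node_position eps f wb tc xc w v j s in
  (x + speed_at eps f wb (w (tc j)) (v (tc j)) s x * (t - tc j)%:E)%E.

(* sigma(t, s) *)
Definition speed {R : realType} (eps : R) (f : R -> R -> R)
    (wb : R -> R) (J : nat) (tc xc : nat -> R) (w v : R -> R -> R)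
    (t : R) (s : nat) : \bar R :=
  speed_at eps f wb (w t) (v t) s (position eps f wb J tc xc w v t s).

(* The set of waves W(t), not to be confused with cum_var. *)
Definition waves_at {R : realType} (eps : R) (f : R -> R -> R)
    (wb : R -> R) (J : nat) (tc xc : nat -> R) (w v : R -> R -> R)
    (t : R) : set nat :=
  [set s | waves eps wb s /\ (position eps f wb J tc xc w v t s < +oo)%E].

(* Main.v *)
Require Import Defs.
From HB Require Import structures.
From mathcomp Require Import all_boot all_order all_algebra.
From mathcomp Require Import all_classical all_reals all_analysis.
From mathcomp Require Import ring lra zify.
Set Implicit Arguments.
Unset Strict Implicit.
Unset Printing Implicit Defensive.
Import Order.TTheory GRing.Theory Num.Theory.
Import numFieldNormedType.Exports.
Local Open Scope ring_scope.

(** The speeds of the waves only change at the collisions, and the total change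
    is bounded by the decrease of a potential.

    Let y = x + t.  In this coordinate the datum of v stands still, v being
    vbe(x + t) at every time ([traced_v]), and every wave of w moves to the
    right since its speed exceeds -1.  At a node, the waves sitting at one point
    form a front.  Listed in the order of the waves, the slopes of the flux on
    their cells are the increments of a sequence, and their speeds are the
    increments of its convex hull ([fr_hull]).  The only facts used about the
    envelopes are those of [is_hull]: the speeds increase along the front, their
    partial sums stay below those of the slopes, and they agree with them
    wherever the speed jumps.  A group is a set of waves of a front having the
    same speed.  At a collision either a group crosses a jump of v, or two groups
    meet at a point where v does not jump ([arr_two]).  This leaves three cases;
    K1, K2, K3 denote the norms of f_ww, f_wwv, f_wv, and n the number of waves.

    Crossing.  The hull depends on the slopes in a 1-Lipschitz way, so the speeds
    change by at most K3 times the jump of v ([single_change]).  A wave crosses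
    every jump at most once, hence a total of K3 eps n TV(vbe).

    Cancellation of two groups of opposite signs.  The survivors are the first
    waves of the left group or the last waves of the right one, and all their
    speeds move in the same direction.  The change is thus the difference between
    the mean of the slopes over the survivors and over their old group, that is
    at most K1 eps times the number of survivors times the number of removed
    waves ([cancel_change]).  As no more than n waves are removed, the total is at
    most K1 (eps n)^2.

    Merging of two groups L and G of the same sign.  The common new speed is the
    barycentre of the speeds sL > sG, so the change is
    2 |L| |G| (sL - sG) / (|L| + |G|) ([merge_speed]), and |L| |G| (sL - sG) is the
    sum, over the pairs (a, b) of L x G, of slope(a) - slope(b).  For a pair which
    never sat at the same point this difference is at most
    K1 |hgt a - hgt b|.  If instead the pair was split at some earlier point y0,
    the hull contained a contact point between a and b, so that on average
    slope(a) <= slope(b) then, and the difference is at most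
    K2 |hgt a - hgt b| times the variation of vbe between y0 and the present
    point.  The function [memo] stores K2 times the variation of vbe up to y0 (and
    -K1 for a pair that never met), and |hgt a - hgt b| <= eps (|L| + |G|) in the
    merged front.  The change is therefore at most 2 eps times the sum over L x G
    of the increase of [memo] ([merge_change]), which telescopes: [memo] is
    nondecreasing and takes its values between -K1 and K2 TV(vbe).

    The words on average hide the main difficulty, because the pairs of L x G may
    have been split at different times.  The invariant [cut_bound] deals with
    it: across a cut which does not lie inside a group, the sum over a rectangle of
    pairs of the differences of slopes is at most the sum of the weights allowed
    by [memo].  When a front splits, the part of the rectangle inside the front is
    controlled by the hull, and the remaining blocks are attached to it by
    [rect_chain], using that the weights are superadditive: the heights add up,
    and an outer pair has met no later than an inner one.

    Altogether the potential is at most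
    (3 K1 + 2 K2 TV(vbe)) (eps n)^2 + K3 eps n TV(vbe), where eps n = TV(wbe); this
    is below the stated bound since 12 ln 2 >= 2.

    It remains to see that the waves have this structure, which is [traced],
    proved by induction on the nodes: they are ordered, those at one point have
    the same sign, and w is eps times the sum of the signs of the waves on the
    left.  This holds initially because the waves parametrize the variation of the
    datum ([wave_chain], [datum_waves]), and it is preserved by cancellations because
    equally many waves are removed on both sides ([stays_before]). *)

(** * Waves, fronts and groups *)

(** The history of n waves along J nodes, in the coordinate y = x + t: at node j
    the wave s sits at Y j s and has the speed sig j s in the coordinate x.  When
    the second unknown has the value u, the flux has the slope slp u s on the cell
    of s, whose endpoint is hgt s.  The second unknown is dat y, and cum is its
    variation up to y.  The survival hypotheses say that a meeting of equal signs
    removes nothing, and that one of opposite signs spares waves of one sign at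
    most and removes those closest to the opposite sign first. *)
Section WaveHistory.
Variables (R : realFieldType) (n J : nat) (eps : R).
Variables (alive : nat -> pred 'I_n) (Y sig : nat -> 'I_n -> R).
Variables (sgn hgt : 'I_n -> R) (slp : R -> 'I_n -> R).
Variables (dt : nat -> R) (dat cum : R -> R) (tv Kww Kwwv Kwv : R).

Implicit Types s r a b q p : 'I_n.

Definition arrival j s := Y j s + (1 + sig j s) * dt j.
Definition together j s r := (Y j s == Y j r) && (sig j s == sig j r).
Definition front j s := [set r | alive j r && (Y j r == Y j s)].
Definition group j s := [set r | alive j r && together j s r].

Hypothesis eps_gt0 : 0 < eps.
Hypothesis Kww_ge0 : 0 <= Kww.
Hypothesis Kwwv_ge0 : 0 <= Kwwv.
Hypothesis Kwv_ge0 : 0 <= Kwv.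
Hypothesis cum_ge0 : forall y, 0 <= cum y.
Hypothesis cum_le : forall y, cum y <= tv.
Hypothesis dat_cum : forall y z, y <= z -> `|dat y - dat z| <= cum z - cum y.
Hypothesis slp_ww : forall u s r, sgn s = sgn r ->
  `|slp u s - slp u r| <= Kww * `|hgt s - hgt r|.
Hypothesis slp_wwv : forall u z s r, sgn s = sgn r ->
  `|(slp u s - slp z s) - (slp u r - slp z r)| <= Kwwv * `|u - z| * `|hgt s - hgt r|.
Hypothesis slp_wv : forall u z s, `|slp u s - slp z s| <= Kwv * `|u - z|.
Hypothesis dt_gt0 : forall j, (j < J)%N -> 0 < dt j.
Hypothesis alive_decr : forall j s, (j < J)%N -> alive j.+1 s -> alive j s.
Hypothesis Y_next : forall j s, (j < J)%N -> alive j.+1 s -> Y j.+1 s = arrival j s.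
Hypothesis sig_gtN1 : forall j s, (j < J)%N -> alive j s -> -1 < sig j s.
Hypothesis Y_mono : forall j s r, (j <= J)%N -> alive j s -> alive j r ->
  (s <= r)%N -> Y j s <= Y j r.
Hypothesis arrival_mono : forall j s r, (j < J)%N -> alive j s -> alive j r ->
  (s <= r)%N -> arrival j s <= arrival j r.
Hypothesis sgn_front : forall j s r, (j <= J)%N -> alive j s -> alive j r ->
  Y j s = Y j r -> sgn s = sgn r.
Hypothesis hgt_front : forall j s r, (j <= J)%N -> alive j s -> alive j r ->
  Y j s = Y j r -> (s <= r)%N ->
  sgn s * (hgt r - hgt s) = eps * #|[set q | alive j q & (s < q <= r)%N]|%:R.
Hypothesis sgn_norm : forall s, `|sgn s| = 1.
Hypothesis sig_front_mono : forall j s r, (j <= J)%N -> alive j s -> alive j r ->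
  Y j s = Y j r -> (s <= r)%N -> sig j s <= sig j r.
Hypothesis hull_prefix : forall j s k, (j <= J)%N -> alive j s ->
  \sum_(r in front j s | (r < k)%N) sig j r
  <= \sum_(r in front j s | (r < k)%N) slp (dat (Y j s)) r.
Hypothesis hull_contact : forall j s k, (j <= J)%N -> alive j s ->
  (forall a b : 'I_n, a \in front j s -> b \in front j s -> (a < k <= b)%N ->
     sig j a < sig j b) ->
  \sum_(r in front j s | (r < k)%N) sig j r
  = \sum_(r in front j s | (r < k)%N) slp (dat (Y j s)) r.
Hypothesis two_groups : forall j s r, (j < J)%N -> alive j s -> alive j r ->
  arrival j s = arrival j r -> ~~ together j s r ->
  [/\ forall q, alive j q -> arrival j q = arrival j s ->
        together j s q || together j r q,
      dat (Y j s) = dat (arrival j s) & dat (Y j r) = dat (arrival j s)].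
Hypothesis one_collision : forall j s r a b, (j < J)%N -> alive j s -> alive j r ->
  alive j a -> alive j b ->
  arrival j s = arrival j r -> ~~ together j s r ->
  arrival j a = arrival j b -> ~~ together j a b -> arrival j s = arrival j a.
Hypothesis survival_same : forall j s, (j < J)%N -> alive j s ->
  (forall r, alive j r -> arrival j r = arrival j s -> sgn r = sgn s) ->
  alive j.+1 s.
Hypothesis survival_opp : forall j s r, (j < J)%N -> alive j s -> alive j r ->
  arrival j s = arrival j r -> sgn s != sgn r -> ~~ (alive j.+1 s && alive j.+1 r).
Hypothesis survival_left : forall j s s' r, (j < J)%N ->
  alive j s -> alive j s' -> alive j r -> (s < s' < r)%N ->
  arrival j s = arrival j r -> arrival j s' = arrival j r ->
  sgn s = sgn s' -> sgn s != sgn r -> alive j.+1 s' -> alive j.+1 s.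
Hypothesis survival_right : forall j s r r', (j < J)%N ->
  alive j s -> alive j r -> alive j r' -> (s < r < r')%N ->
  arrival j s = arrival j r -> arrival j s = arrival j r' ->
  sgn r = sgn r' -> sgn s != sgn r -> alive j.+1 r -> alive j.+1 r'.

Lemma set_min (D : {set 'I_n}) s : s \in D ->
  exists2 m, m \in D & forall r, r \in D -> (m <= r)%N.
Proof. by move=> sD; case: (arg_minnP (fun r : 'I_n => r : nat) sD) => m mD mm; exists m. Qed.

Lemma set_max (D : {set 'I_n}) s : s \in D ->
  exists2 m, m \in D & forall r, r \in D -> (r <= m)%N.
Proof. by move=> sD; case: (arg_maxnP (fun r : 'I_n => r : nat) sD) => m mD mm; exists m. Qed.

Lemma front_alive j s r : r \in front j s -> alive j r.
Proof. by rewrite inE => /andP[]. Qed.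

Lemma frontY j s r : r \in front j s -> Y j r = Y j s.
Proof. by rewrite inE => /andP[_ /eqP]. Qed.

Lemma front_refl j s : alive j s -> s \in front j s.
Proof. by move=> h; rewrite inE h eqxx. Qed.

Lemma front_speed_mono j s a b : (j <= J)%N -> a \in front j s -> b \in front j s ->
  (a <= b)%N -> sig j a <= sig j b.
Proof.
move=> jJ aF bF; apply: sig_front_mono;
  by rewrite ?(front_alive aF) ?(front_alive bF) ?(frontY aF) ?(frontY bF).
Qed.

Lemma sum_split_cut (P : pred 'I_n) (F : 'I_n -> R) k :
  \sum_(r | P r) F r = \sum_(r | P r && (r < k)%N) F r + \sum_(r | P r && (k <= r)%N) F r.
Proof.
by rewrite (bigID (fun r : 'I_n => (r < k)%N)) /=; congr (_ + _); apply: eq_bigl => r; rewrite -leqNgt.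
Qed.

Lemma sum_interval (D : {set 'I_n}) (F : 'I_n -> R) (k1 k2 : nat) : (k1 <= k2)%N ->
  \sum_(r in D | (k1 <= r < k2)%N) F r
  = \sum_(r in D | (r < k2)%N) F r - \sum_(r in D | (r < k1)%N) F r.
Proof.
move=> k12; rewrite [X in _ = X - _](sum_split_cut _ _ k1).
rewrite [X in X + _ - _](_ : _ = \sum_(r in D | (r < k1)%N) F r); last first.
  apply: eq_bigl => r; rewrite -andbA; congr (_ && _).
  by apply/andP/idP => [[]//|rk]; split=> //; exact: leq_trans k12.
rewrite [X in _ = X - _]addrC addrK; apply: eq_bigl => r.
by rewrite -andbA [(k1 <= r)%N && _]andbC.
Qed.

Lemma group_sub j s : group j s \subset front j s.
Proof.
by apply/fintype.subsetP => r; rewrite !inE => /andP[-> /andP[/eqP -> _]]; rewrite eqxx.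
Qed.

Lemma group_refl j s : alive j s -> s \in group j s.
Proof. by move=> h; rewrite inE h /together !eqxx. Qed.

Lemma groupP j s r : r \in group j s -> [/\ alive j r, Y j r = Y j s & sig j r = sig j s].
Proof. by rewrite inE => /andP[-> /andP[/eqP -> /eqP ->]]. Qed.

(** The speed jumps at both ends of a group, so the hull touches the graph there. *)
Lemma group_interval j s : (j <= J)%N -> alive j s ->
  exists k1 k2 : nat, [/\ (k1 < k2)%N,
   forall r, (r \in group j s) = (r \in front j s) && (k1 <= r < k2)%N,
   \sum_(r in front j s | (r < k1)%N) sig j r
     = \sum_(r in front j s | (r < k1)%N) slp (dat (Y j s)) r &
   \sum_(r in front j s | (r < k2)%N) sig j r
     = \sum_(r in front j s | (r < k2)%N) slp (dat (Y j s)) r].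
Proof.
move=> jJ sa; have sG := group_refl sa.
have [k1 k1G k1min] := set_min sG.
have [k2 k2G k2max] := set_max sG.
have gF r : r \in group j s -> r \in front j s by move/(fintype.subsetP (group_sub j s)).
have gs r : r \in group j s -> sig j r = sig j s by move=> /groupP[].
have fg r : r \in front j s -> sig j r = sig j s -> r \in group j s.
  by move=> rF e; rewrite inE (front_alive rF) /together (frontY rF) e !eqxx.
have mono a b : a \in front j s -> b \in front j s -> (a <= b)%N -> sig j a <= sig j b.
  exact: front_speed_mono.
exists k1, k2.+1; split.
- by rewrite ltnS; exact: k1min.
- move=> r; apply/idP/andP.
    by move=> rG; rewrite gF// ltnS k1min ?k2max.
  case=> rF /andP[h1 h2]; apply: fg => //; apply/eqP; rewrite eq_le; apply/andP; split.
    by rewrite -(gs _ k2G) mono// gF.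
  by rewrite -(gs _ k1G) mono// gF.
- apply: hull_contact => // a b aF bF /andP[ak kb].
  rewrite lt_neqAle mono ?(leq_trans (ltnW ak) kb)// andbT; apply/negP => /eqP e.
  have /k1min : a \in group j s.
    apply: fg => //; apply/eqP; rewrite eq_le -(gs _ k1G) (mono a k1)// ?gF// ?(ltnW ak)//=.
    by rewrite e mono// gF.
  by rewrite leqNgt ak.
apply: hull_contact => // a b aF bF /andP[ak kb].
rewrite lt_neqAle mono ?(leq_trans (ltnW ak) kb)// andbT; apply/negP => /eqP e.
have /k2max : b \in group j s.
  apply: fg => //; apply/eqP; rewrite eq_le -(gs _ k2G) (mono k2 b)// ?gF// ?(ltnW kb)// andbT.
  by rewrite -e mono// gF.
by rewrite leqNgt kb.
Qed.

Lemma group_prefix j s k : (j <= J)%N -> alive j s ->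
  \sum_(r in group j s | (r < k)%N) sig j s
  <= \sum_(r in group j s | (r < k)%N) slp (dat (Y j s)) r.
Proof.
move=> jJ sa; have [k1 [k2 [k12 gE h1 h2]]] := group_interval jJ sa.
rewrite (eq_bigr (sig j)); last by move=> r /andP[/groupP[_ _ ->]].
have [kk|kk] := ltnP (minn k k2) k1.
  rewrite !big1// => r /andP[]; rewrite gE => /andP[_ /andP[a b]] c;
    by move: kk; rewrite ltnNge (leq_trans a)// leq_min (ltnW b) (ltnW c).
have e F : \sum_(r in group j s | (r < k)%N) F r
    = \sum_(r in front j s | (k1 <= r < minn k k2)%N) F r :> R.
  apply: eq_bigl => r; rewrite gE -andbA; congr (_ && _).
  by rewrite leq_min; case: (_ <= r)%N; case: (r < k)%N; case: (r < k2)%N.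
by rewrite !e !sum_interval// h1 lerB// hull_prefix.
Qed.

Lemma group_total j s : (j <= J)%N -> alive j s ->
  \sum_(r in group j s) slp (dat (Y j s)) r = \sum_(r in group j s) sig j s.
Proof.
move=> jJ sa; have [k1 [k2 [/ltnW k12 gE h1 h2]]] := group_interval jJ sa.
rewrite [RHS](eq_bigr (sig j)); last by move=> r /groupP[_ _ ->].
have e F : \sum_(r in group j s) F r = \sum_(r in front j s | (k1 <= r < k2)%N) F r :> R.
  exact: eq_bigl.
by rewrite !e !sum_interval// h1 h2.
Qed.

Lemma group_suffix j s k : (j <= J)%N -> alive j s ->
  \sum_(r in group j s | (k <= r)%N) slp (dat (Y j s)) r
  <= \sum_(r in group j s | (k <= r)%N) sig j s.
Proof.
move=> jJ sa; have := group_prefix k jJ sa; have := group_total jJ sa.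
rewrite (sum_split_cut _ _ k) [in RHS](sum_split_cut _ _ k) => h1 h2; lra.
Qed.

(** The largest speed of a front is the mean of the slopes over its last group. *)
Lemma hull_le j s c : (j <= J)%N -> alive j s ->
  (forall k, \sum_(r in front j s | (k <= r)%N) slp (dat (Y j s)) r
      <= \sum_(r in front j s | (k <= r)%N) c) ->
  sig j s <= c.
Proof.
move=> jJ sa hc; have sF := front_refl sa; have [m mF mmax] := set_max sF.
apply: le_trans (front_speed_mono jJ sF mF (mmax _ sF)) _.
have ma := front_alive mF; have mG := group_refl ma; have eY := frontY mF.
have fE : front j m = front j s by apply/finset.setP => r; rewrite !inE eY.
have [k1 [k2 [_ gE _ _]]] := group_interval jJ ma; rewrite fE in gE.
have mk2 : (m < k2)%N by move: mG; rewrite gE => /and3P[].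
have e F : \sum_(r in front j s | (k1 <= r)%N) F r = \sum_(r in group j m) F r :> R.
  apply: eq_bigl => r; rewrite gE; case rF : (r \in front j s) => //=.
  by rewrite (leq_ltn_trans (mmax _ rF) mk2) andbT.
have := hc k1; rewrite !e -eY (group_total jJ ma) !sumr_const ler_pMn2r//.
by apply/card_gt0P; exists m.
Qed.

Lemma hull_ge j s c : (j <= J)%N -> alive j s ->
  (forall k, \sum_(r in front j s | (r < k)%N) c
      <= \sum_(r in front j s | (r < k)%N) slp (dat (Y j s)) r) ->
  c <= sig j s.
Proof.
move=> jJ sa hc; have sF := front_refl sa; have [m mF mmin] := set_min sF.
apply: le_trans (front_speed_mono jJ mF sF (mmin _ sF)).
have ma := front_alive mF; have mG := group_refl ma; have eY := frontY mF.
have fE : front j m = front j s by apply/finset.setP => r; rewrite !inE eY.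
have [k1 [k2 [_ gE _ _]]] := group_interval jJ ma; rewrite fE in gE.
have k1m : (k1 <= m)%N by move: mG; rewrite gE => /and3P[].
have e F : \sum_(r in front j s | (r < k2)%N) F r = \sum_(r in group j m) F r :> R.
  apply: eq_bigl => r; rewrite gE; case rF : (r \in front j s) => //=.
  by rewrite (leq_trans k1m (mmin _ rF)).
have := hc k2; rewrite !e -eY (group_total jJ ma) !sumr_const ler_pMn2r//.
by apply/card_gt0P; exists m.
Qed.

Lemma hull_total j s : (j <= J)%N -> alive j s ->
  \sum_(r in front j s) sig j r = \sum_(r in front j s) slp (dat (Y j s)) r.
Proof.
move=> jJ sa; have /= := @hull_contact j s n jJ sa.
have e F : \sum_(r in front j s | (r < n)%N) F r = \sum_(r in front j s) F r :> R.
  by apply: eq_bigl => r; rewrite ltn_ord andbT.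
rewrite !e; apply=> a b _ _ /andP[_]; by rewrite leqNgt ltn_ord.
Qed.

(** * Collisions of groups *)

Lemma together_arrival j s r : together j s r -> arrival j r = arrival j s.
Proof. by rewrite /together /arrival => /andP[/eqP -> /eqP ->]. Qed.

Lemma group_arrival j s r : r \in group j s -> arrival j r = arrival j s.
Proof. by rewrite inE => /andP[_ /together_arrival]. Qed.

Lemma Y_incr j s : (j < J)%N -> alive j.+1 s -> Y j s <= Y j.+1 s.
Proof.
move=> jJ sa; rewrite Y_next// /arrival lerDl mulr_ge0//; last exact: ltW (dt_gt0 jJ).
by have := sig_gtN1 jJ (alive_decr jJ sa); lra.
Qed.

(** The group keeps its waves and becomes a whole front, whose slopes have moved by
    at most Kwv times the change of the datum. *)
Lemma single_change j s : (j < J)%N -> alive j.+1 s ->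
  (forall r, alive j r -> arrival j r = arrival j s -> together j s r) ->
  `|sig j.+1 s - sig j s| <= Kwv * (cum (Y j.+1 s) - cum (Y j s)).
Proof.
move=> jJ sa1 hs; have sa := alive_decr jJ sa1; have jJ' := ltnW jJ.
have sg r : r \in group j s -> sgn r = sgn s.
  by move=> /groupP[ra e _]; apply: (sgn_front jJ').
have fE : front j.+1 s = group j s.
  apply/finset.setP => r; apply/idP/idP.
    rewrite inE => /andP[ra /eqP e]; have ra' := alive_decr jJ ra.
    by rewrite inE ra' hs// -!Y_next.
  move=> rG; have [ra _ _] := groupP rG.
  have ra1 : alive j.+1 r.
    apply: survival_same => // q qa e; rewrite (sg r)// sg// inE qa hs//.
    by rewrite e (group_arrival rG).
  by rewrite inE ra1 !Y_next// (group_arrival rG) eqxx.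
apply: (@le_trans _ _ (Kwv * `|dat (Y j s) - dat (Y j.+1 s)|)); last first.
  by apply: ler_wpM2l => //; apply: dat_cum; exact: Y_incr.
set u := dat (Y j s); set u' := dat (Y j.+1 s).
have hu r : `|slp u r - slp u' r| <= Kwv * `|u - u'| by exact: slp_wv.
rewrite ler_norml; apply/andP; split.
  rewrite lerBrDl; apply: hull_ge => // k; rewrite -/u' fE.
  apply: (@le_trans _ _ (\sum_(r in group j s | (r < k)%N) (slp u r - Kwv * `|u - u'|))).
    by rewrite !big_split /= lerD2r; exact: group_prefix.
  by apply: ler_sum => r _; rewrite lerBlDr -lerBlDl; exact: le_trans (ler_norm _) (hu r).
rewrite lerBlDl; apply: hull_le => // k; rewrite -/u' fE.
apply: (@le_trans _ _ (\sum_(r in group j s | (k <= r)%N) (slp u r + Kwv * `|u - u'|))).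
  by apply: ler_sum => r _; rewrite -lerBlDl; apply: le_trans (ler_norm _) _; rewrite distrC.
by rewrite !big_split /= lerD2r; exact: group_suffix.
Qed.

Lemma group_lt j s r : (j < J)%N -> alive j s -> alive j r -> (s < r)%N ->
  arrival j s = arrival j r -> ~~ together j s r ->
  [/\ Y j s < Y j r, sig j r < sig j s &
    forall a b, a \in group j s -> b \in group j r -> (a < b)%N].
Proof.
move=> jJ sa ra sr e nt.
have h : Y j s < Y j r.
  rewrite lt_neqAle Y_mono ?(ltnW sr) ?(ltnW jJ)// andbT.
  apply: contra nt => /eqP eY; move: e; rewrite /arrival eY => /addrI /mulIf.
  by rewrite gt_eqF ?dt_gt0// /together eY eqxx => /(_ isT) /addrI ->; rewrite eqxx.
split=> //.
  rewrite -(ltrD2l 1) -(ltr_pM2r (dt_gt0 jJ)).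
  by move: e; rewrite /arrival; lra.
move=> a b /groupP[aa aY _] /groupP[ba bY _]; rewrite ltnNge; apply/negP => ba'.
by move: h; rewrite -aY -bY ltNge Y_mono// ltnW.
Qed.

Lemma sum_setU (D D' : {set 'I_n}) (P : pred 'I_n) (F : 'I_n -> R) :
  [disjoint D & D'] ->
  \sum_(r in D :|: D' | P r) F r = \sum_(r in D | P r) F r + \sum_(r in D' | P r) F r.
Proof.
move=> dD; rewrite !big_mkcondr /= -bigU//=.
by apply: eq_bigl => r; rewrite !inE.
Qed.

Lemma sum_constE (P : pred 'I_n) (c : R) : \sum_(r | P r) c = c * #|P|%:R.
Proof. by rewrite sumr_const mulr_natr. Qed.

(** The group on the left is the faster one, so the hull of the slopes of both
    groups is a single segment and its slope is the barycentre of the speeds. *)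
Lemma merge_speed j s r : (j < J)%N -> alive j s -> alive j r -> (s < r)%N ->
  arrival j s = arrival j r -> ~~ together j s r -> sgn s = sgn r ->
  let a := #|group j s|%:R in let b := #|group j r|%:R in
  [/\ forall q, q \in group j s :|: group j r ->
       alive j.+1 q /\ front j.+1 q = group j s :|: group j r,
   forall q, q \in group j s -> sig j s - sig j.+1 q = b * ((sig j s - sig j r) / (a + b)) &
   forall q, q \in group j r -> sig j.+1 q - sig j r = a * ((sig j s - sig j r) / (a + b))].
Proof.
move=> jJ sa ra sr e nt esg a b; have jJ' := ltnW jJ.
have [hY hsig hlt] := group_lt jJ sa ra sr e nt.
have [h2 eu eu'] := two_groups jJ sa ra e nt.
have sgL q : q \in group j s -> sgn q = sgn s.
  by move=> /groupP[qa eq _]; apply: (sgn_front jJ').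
have sgG q : q \in group j r -> sgn q = sgn r.
  by move=> /groupP[qa eq _]; apply: (sgn_front jJ').
have inU q : alive j q -> arrival j q = arrival j s -> q \in group j s :|: group j r.
  by move=> qa eq; move: (h2 q qa eq); rewrite !inE qa.
have Ua q : q \in group j s :|: group j r -> alive j q /\ arrival j q = arrival j s.
  by rewrite inE => /orP[] qG; have [qa _ _] := groupP qG; split=> //;
    rewrite (group_arrival qG).
have Us q : q \in group j s :|: group j r -> sgn q = sgn s.
  by rewrite inE => /orP[/sgL//|/sgG ->].
have Ual q : q \in group j s :|: group j r -> alive j.+1 q.
  move=> qU; have [qa eq] := Ua q qU; apply: survival_same => // p pa ep.
  by rewrite (Us q)// Us//; apply: inU => //; rewrite ep.
have fE q : q \in group j s :|: group j r -> front j.+1 q = group j s :|: group j r.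
  move=> qU; have [qa eq] := Ua q qU; apply/finset.setP => p; apply/idP/idP.
    rewrite inE => /andP[pa]; rewrite (Y_next jJ pa) (Y_next jJ (Ual _ qU)) eq => /eqP ep.
    by apply: inU => //; exact: alive_decr pa.
  move=> pU; have [pa ep] := Ua p pU.
  by rewrite inE (Ual _ pU) (Y_next jJ (Ual _ pU)) (Y_next jJ (Ual _ qU)) ep eq eqxx.
have a0 : 0 < a by rewrite ltr0n; apply/card_gt0P; exists s; exact: group_refl.
have b0 : 0 < b by rewrite ltr0n; apply/card_gt0P; exists r; exact: group_refl.
pose th := (sig j s - sig j r) / (a + b).
have th0 : 0 <= th by apply: divr_ge0; [rewrite subr_ge0 ltW|apply: addr_ge0; exact: ltW].
(* the barycentre of the two speeds with weights a and b *)
pose c := sig j s - b * th.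
have cE : c = sig j r + a * th.
  by rewrite /c /th; field; rewrite gt_eqF// addr_gt0.
have dis : [disjoint group j s & group j r].
  rewrite finset.disjoints_subset; apply/fintype.subsetP => q qL; rewrite inE; apply/negP => qG.
  by have := hlt _ _ qL qG; rewrite ltnn.
have cut k : a * #|[pred q in group j r | (q < k)%N]|%:R
    <= b * #|[pred q in group j s | (q < k)%N]|%:R.
  have [/eqP ->|] := boolP (#|[pred q in group j r | (q < k)%N]| == 0%N).
    by rewrite mulr0 mulr_ge0// ltW.
  rewrite -lt0n => /card_gt0P[q]; rewrite inE => /andP[qG qk].
  have -> : #|[pred q in group j s | (q < k)%N]| = #|group j s|.
    apply: eq_card => p; rewrite inE.
    by apply/andP/idP => [[]//|pL]; split=> //; exact: ltn_trans (hlt _ _ pL qG) qk.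
  rewrite mulrC ler_wpM2r ?(ltW a0)// ler_nat; apply: subset_leq_card.
  by apply/fintype.subsetP => p; rewrite inE => /andP[].
have ge_c q : q \in group j s :|: group j r -> c <= sig j.+1 q.
  move=> qU; have [qa eq] := Ua q qU.
  have uq : dat (Y j.+1 q) = dat (arrival j s) by rewrite (Y_next jJ (Ual _ qU)) eq.
  apply: hull_ge; rewrite ?Ual// => k; rewrite uq fE// !sum_setU//.
  have := group_prefix k jJ' sa; have := group_prefix k jJ' ra; rewrite eu eu'.
  set S1 := \sum_(_ in group j r | _) slp _ _.
  set S2 := \sum_(_ in group j s | _) slp _ _.
  have h := cut k; rewrite !sum_constE /=.
  move: h; set b' := #|_|%:R; set a' := #|_|%:R => h H1 H2.
  have -> : c * a' + c * b' = sig j s * a' + sig j r * b' - th * (b * a' - a * b').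
    by rewrite {1}/c cE; ring.
  have : 0 <= th * (b * a' - a * b') by apply: mulr_ge0 => //; rewrite subr_ge0.
  lra.
(* no speed is less than c and their sum is that of the slopes, hence of c *)
have speed q : q \in group j s :|: group j r -> sig j.+1 q = c.
  move=> qU; apply/eqP; rewrite -subr_eq0; apply/eqP; move: q qU; apply: psumr_eq0P.
    by move=> q qU; rewrite subr_ge0 ge_c.
  have sU : s \in group j s :|: group j r by rewrite inE group_refl.
  have us : dat (Y j.+1 s) = dat (arrival j s) by rewrite (Y_next jJ (Ual _ sU)).
  have := hull_total jJ (Ual _ sU); rewrite fE// us sumrB => ->.
  have e2 F : \sum_(q in group j s :|: group j r) F q
      = \sum_(q in group j s) F q + \sum_(q in group j r) F q :> R.
    have := sum_setU xpredT F dis; by rewrite !(eq_bigl _ _ (fun q => andbT _)).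
  have := group_total jJ' sa; have := group_total jJ' ra; rewrite eu eu' !e2 => -> ->.
  by rewrite !sum_constE -/a -/b {2}cE /c; ring.
split.
- by move=> q qU; split; [exact: Ual|exact: fE].
- move=> q qL; rewrite speed; last by rewrite inE qL.
  by rewrite /c opprB addrC subrK.
- move=> q qG; rewrite speed; last by rewrite inE qG orbT.
  by rewrite cE addrC addKr.
Qed.

(** * Memory of the last encounter *)

Definition joined j s r := [&& alive j s, alive j r & Y j s == Y j r].

Fixpoint met j s r := joined j s r || (if j is i.+1 then met i s r else false).

(** The value -Kww for two waves that never sat together makes [weight] at least
    the bound of [slp_ww] on the difference of their slopes. *)
Fixpoint memo j s r : R :=
  if joined j s r then Kwwv * cum (Y j s)
  else if j is i.+1 then memo i s r else - Kww.

Lemma alive_le i j s : (i <= j)%N -> (j <= J)%N -> alive j s -> alive i s.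
Proof.
elim: j => [|j IH]; first by rewrite leqn0 => /eqP ->.
by rewrite leq_eqVlt => /predU1P[->//|ij] jJ /(alive_decr jJ); exact: IH (ltnW jJ).
Qed.

Lemma metP j s r : reflect (exists2 i, (i <= j)%N & joined i s r) (met j s r).
Proof.
elim: j => [|j IH] /=.
  rewrite orbF; apply: (iffP idP) => [h|[i]]; first by exists 0%N.
  by rewrite leqn0 => /eqP ->.
apply: (iffP orP) => [[h|/IH[i ij h]]|[i]].
- by exists j.+1.
- by exists i => //; exact: leqW.
by rewrite leq_eqVlt => /predU1P[->|ij] h; [left|right; apply/IH; exists i].
Qed.

Lemma joined_sub j s a b r : (j <= J)%N -> joined j s r ->
  (s <= a)%N -> (a <= b)%N -> (b <= r)%N -> alive j a -> alive j b -> joined j a b.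
Proof.
move=> jJ /and3P[sa ra /eqP e] h1 h2 h3 aa ba; rewrite /joined aa ba /=.
have y1 := Y_mono jJ sa aa h1; have y2 := Y_mono jJ aa ba h2.
have y3 := Y_mono jJ ba ra h3.
by apply/eqP; lra.
Qed.

Lemma met_sub j s a b r : (j <= J)%N -> met j s r ->
  (s <= a)%N -> (a <= b)%N -> (b <= r)%N -> alive j a -> alive j b -> met j a b.
Proof.
move=> jJ /metP[i ij h] h1 h2 h3 aa ba; apply/metP; exists i => //.
by apply: joined_sub h h1 h2 h3 _ _; rewrite ?(alive_le ij)//; exact: leq_trans jJ.
Qed.

Lemma joined_met j s r : joined j s r -> met j s r.
Proof. by case: j => [|j] /= ->. Qed.

Definition ascending s r := sgn s = sgn r /\ 0 <= sgn s * (hgt r - hgt s).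

Lemma met_ascending j s r : (j <= J)%N -> met j s r -> (s <= r)%N -> ascending s r.
Proof.
move=> jJ /metP[i ij /and3P[sa ra /eqP e]] sr; have iJ := leq_trans ij jJ.
split; first exact: sgn_front e.
by rewrite (hgt_front iJ sa ra e sr) mulr_ge0// ltW.
Qed.

Lemma ascending_trans s a r : ascending s a -> ascending a r -> ascending s r.
Proof.
move=> [e h] [e' h']; split; first by rewrite e.
by move: h'; rewrite -e; lra.
Qed.

Lemma ascending_dist s r : ascending s r -> `|hgt s - hgt r| = sgn s * (hgt r - hgt s).
Proof.
by case=> _ h; rewrite distrC -[LHS]mul1r -(sgn_norm s) -normrM ger0_norm.
Qed.

Lemma arrival_sandwich j s q r : (j < J)%N -> alive j s -> alive j q -> alive j r ->
  (s <= q)%N -> (q <= r)%N -> arrival j s = arrival j r -> arrival j q = arrival j s.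
Proof.
move=> jJ sa qa ra sq qr e.
have := arrival_mono jJ sa qa sq; have := arrival_mono jJ qa ra qr; lra.
Qed.

(** A cancellation starts with the waves closest to those of opposite sign, so it
    cannot remove a wave and spare one which lies between the two signs. *)
Lemma no_loss j s q r : (j < J)%N -> met j s r -> alive j.+1 s -> alive j.+1 r ->
  (s <= q)%N -> (q <= r)%N -> alive j q -> alive j.+1 q.
Proof.
move=> jJ m sa1 ra1 sq qr qa; apply/negPn/negP => nqa.
have jJ' := ltnW jJ; have sa := alive_decr jJ sa1; have ra := alive_decr jJ ra1.
have inside p : alive j p -> (s <= p)%N -> (p <= r)%N -> sgn p = sgn s.
  move=> pa sp pr; have mp := met_sub jJ' m (leqnn s) sp pr sa pa.
  by have [-> _] := met_ascending jJ' mp sp.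
have sq' : (s < q)%N.
  rewrite ltn_neqAle sq andbT; apply: contra nqa => /eqP e.
  by rewrite -(val_inj e).
have qr' : (q < r)%N.
  rewrite ltn_neqAle qr andbT; apply: contra nqa => /eqP e.
  by rewrite (val_inj e).
have /existsP[p /and3P[pa /eqP ep sp]] :
    [exists p, [&& alive j p, arrival j p == arrival j q & sgn p != sgn q]].
  apply: contraR nqa => /existsPn h.
  apply: survival_same => // p pa ep; have := h p.
  by rewrite pa ep eqxx /= negbK => /eqP.
have qs := inside q qa sq qr.
have [qp|pq] := leqP q p.
  have [pr|rp] := leqP p r.
    by move: sp; rewrite qs (inside p)// ?eqxx// (leq_trans sq).
  have er := arrival_sandwich jJ qa ra pa qr (ltnW rp) (esym ep).
  have e1 : sgn q = sgn r by rewrite qs (inside r)// (leq_trans sq qr).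
  have e2 : sgn q != sgn p by rewrite eq_sym.
  move/negP: nqa; apply.
  exact: (survival_left jJ qa ra pa (introT andP (conj qr' rp)) (esym ep)
    (etrans er (esym ep)) e1 e2 ra1).
have [sp'|ps] := leqP s p.
  by move: sp; rewrite qs (inside p)// ?eqxx// ltnW// (ltn_trans pq).
have es := arrival_sandwich jJ pa sa qa (ltnW ps) sq ep.
move/negP: nqa; apply.
by apply: (survival_right jJ pa sa qa (introT andP (conj ps sq')) (esym es) ep (esym qs) _ sa1);
  rewrite -qs.
Qed.

Lemma cum_mono y z : y <= z -> cum y <= cum z.
Proof. by move=> yz; rewrite -subr_ge0; apply: le_trans (dat_cum yz). Qed.

Lemma memo_joined j s r : joined j s r -> memo j s r = Kwwv * cum (Y j s).
Proof. by case: j => [|j] /= ->. Qed.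

Lemma memo_not_joined j s r : ~~ joined j.+1 s r -> memo j.+1 s r = memo j s r.
Proof. by move=> /negPf /= ->. Qed.

Lemma memo_not_met j s r : ~~ met j s r -> memo j s r = - Kww.
Proof.
elim: j => [|j IH] /=; first by rewrite orbF => /negPf ->.
by rewrite negb_or => /andP[/negPf -> /IH].
Qed.

Lemma memo_le j s r : (j <= J)%N -> alive j s -> memo j s r <= Kwwv * cum (Y j s).
Proof.
elim: j => [|j IH] jJ sa /=; case: ifP => // _.
  by apply: (@le_trans _ _ 0); rewrite ?oppr_le0// mulr_ge0.
apply: le_trans (IH (ltnW jJ) (alive_decr jJ sa)) _.
by apply: ler_wpM2l => //; apply: cum_mono; exact: Y_incr.
Qed.

Lemma memo_ge j s r : - Kww <= memo j s r.
Proof.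
have h i : - Kww <= Kwwv * cum (Y i s).
  by apply: (@le_trans _ _ 0); rewrite ?oppr_le0// mulr_ge0.
by elim: j => [|j IH] /=; case: ifP.
Qed.

Lemma memo_incr j s r : (j < J)%N -> memo j s r <= memo j.+1 s r.
Proof.
move=> jJ /=; case: ifP => // /and3P[sa _ _].
apply: le_trans (memo_le _ (ltnW jJ) (alive_decr jJ sa)) _.
by apply: ler_wpM2l => //; apply: cum_mono; exact: Y_incr.
Qed.

(** When two waves sit together, so do all the waves between them: the inner pair
    has met at least as recently as the outer one. *)
Lemma memo_nest j s a b r : (j <= J)%N -> alive j s -> alive j a -> alive j b -> alive j r ->
  (s <= a)%N -> (a <= b)%N -> (b <= r)%N -> memo j s r <= memo j a b.
Proof.
move=> jJ sa aa ba ra h1 h2 h3.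
have [jn|nj] := boolP (joined j s r).
  rewrite !memo_joined//; last exact: joined_sub jn h1 h2 h3 aa ba.
  have /and3P[_ _ /eqP ->] := joined_sub jJ jn (leqnn s) h1 (leq_trans h2 h3) sa aa.
  by [].
elim: j jJ sa aa ba ra nj => [|j IH] jJ sa aa ba ra nj.
  rewrite [memo 0 s r]memo_not_met; first exact: memo_ge.
  by rewrite /= orbF.
rewrite memo_not_joined//; apply: le_trans (memo_incr _ _ jJ).
have [jn|nj'] := boolP (joined j s r); last by apply: IH nj'; rewrite ?(ltnW jJ)//; exact: alive_decr.
have al := fun q => @alive_decr j q jJ; have jJ' := ltnW jJ.
rewrite !memo_joined//; last exact: joined_sub jn h1 h2 h3 (al _ aa) (al _ ba).
by have /and3P[_ _ /eqP ->] := joined_sub jJ' jn (leqnn s) h1 (leq_trans h2 h3) (al _ sa) (al _ aa).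
Qed.

(** * The inequality across a cut *)

(** How much the difference of the slopes of a and b may have grown since they
    were last together, once the datum has been swept up to eta. *)
Definition weight j eta a b := (Kwwv * cum eta - memo j a b) * `|hgt a - hgt b|.

Definition rect j eta (A B : {set 'I_n}) := \sum_(a in A) \sum_(b in B)
  (slp (dat eta) a - slp (dat eta) b - weight j eta a b).

(** The heights add up along an ascending triple, and by [memo_nest] the outer pair
    has the smallest memory, hence the largest factor. *)
Lemma weight_superadditive j eta s a r : (j <= J)%N ->
  alive j s -> alive j a -> alive j r -> (s <= a)%N -> (a <= r)%N ->
  ascending s a -> ascending a r ->
  weight j eta s a + weight j eta a r <= weight j eta s r.
Proof.
move=> jJ sa aa ra h1 h2 asc asc'; rewrite /weight.
have [d1 d2] := (ascending_dist asc, ascending_dist asc').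
have d3 := ascending_dist (ascending_trans asc asc').
have e : `|hgt s - hgt r| = `|hgt s - hgt a| + `|hgt a - hgt r|.
  by rewrite d1 d2 d3; case: asc => <- _; ring.
have n1 := normr_ge0 (hgt s - hgt a); have n2 := normr_ge0 (hgt a - hgt r).
have m1 := memo_nest jJ sa sa aa ra (leqnn s) h1 h2.
have m2 := memo_nest jJ sa aa ra ra h1 h2 (leqnn r).
rewrite e mulrDr; apply: lerD; apply: ler_wpM2r => //; by rewrite lerB.
Qed.

(** Sum each hypothesis over the index it does not mention: l b cancels, and
    w a b + w b c <= w a c. *)
Lemma rect_chain (l : 'I_n -> R) (w : 'I_n -> 'I_n -> R) (A B C : {set 'I_n}) b0 :
  b0 \in B ->
  (forall a b c, a \in A -> b \in B -> c \in C -> w a b + w b c <= w a c) ->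
  \sum_(a in A) \sum_(b in B) (l a - l b - w a b) <= 0 ->
  \sum_(b in B) \sum_(c in C) (l b - l c - w b c) <= 0 ->
  \sum_(a in A) \sum_(c in C) (l a - l c - w a c) <= 0.
Proof.
move=> b0B hw h1 h2.
have B0 : 0 < #|B|%:R :> R by rewrite ltr0n; apply/card_gt0P; exists b0.
rewrite -(ler_pM2r B0) mul0r.
have -> : (\sum_(a in A) \sum_(c in C) (l a - l c - w a c)) * #|B|%:R
  = \sum_(a in A) \sum_(c in C) \sum_(b in B) (l a - l c - w a c).
  rewrite mulr_suml; apply: eq_bigr => a _; rewrite mulr_suml; apply: eq_bigr => c _.
  by rewrite sum_constE.
apply: (@le_trans _ _ (\sum_(a in A) \sum_(c in C) \sum_(b in B) (l a - l b - w a b)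
    + \sum_(a in A) \sum_(c in C) \sum_(b in B) (l b - l c - w b c))).
  rewrite -big_split; apply: ler_sum => a aA; rewrite -big_split; apply: ler_sum => c cC.
  rewrite -big_split; apply: ler_sum => b bB /=; have := hw _ _ _ aA bB cC; lra.
have -> : \sum_(a in A) \sum_(c in C) \sum_(b in B) (l a - l b - w a b)
   = #|C|%:R * \sum_(a in A) \sum_(b in B) (l a - l b - w a b).
  by rewrite mulr_sumr; apply: eq_bigr => a _; rewrite sum_constE mulrC.
have -> : \sum_(a in A) \sum_(c in C) \sum_(b in B) (l b - l c - w b c)
   = (\sum_(b in B) \sum_(c in C) (l b - l c - w b c)) * #|A|%:R.
  by rewrite sum_constE exchange_big.
by rewrite -[leRHS]addr0; apply: lerD; [apply: mulr_ge0_le0|apply: mulr_le0_ge0].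
Qed.

Lemma rect_bigID j eta (A B : {set 'I_n}) (P Q : pred 'I_n) :
  rect j eta A B = rect j eta [set a in A | P a] [set b in B | Q b]
    + rect j eta [set a in A | ~~ P a] [set b in B | Q b]
    + rect j eta A [set b in B | ~~ Q b].
Proof.
rewrite /rect.
have e (D : {set 'I_n}) (S : pred 'I_n) (G : 'I_n -> R) :
   \sum_(a in D) G a = \sum_(a in [set a in D | S a]) G a + \sum_(a in [set a in D | ~~ S a]) G a.
  rewrite (bigID S) /=; congr (_ + _); by apply: eq_bigl => a; rewrite !inE.
rewrite -(e A P) -big_split; apply: eq_bigr => a _; exact: e.
Qed.

Definition below j (x : 'I_n) k := [set s | alive j s & (x <= s < k)%N].
Definition above j k (y : 'I_n) := [set s | alive j s & (k <= s <= y)%N].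

(** The waves x' and y' witness that the outermost waves of the rectangle have sat
    together with waves of the other side of the cut, so that by [no_loss] the
    rectangle keeps its waves as long as its corners survive. *)
Definition cut_bound j (cut : nat -> Prop) := forall k x y x' y' eta,
  alive j x -> alive j y -> alive j x' -> alive j y' ->
  (x < k)%N -> (k <= y)%N -> (k <= x')%N -> (y' < k)%N ->
  met j x x' -> met j y' y -> cut k ->
  (forall s, alive j s -> (s < k)%N -> Y j s <= eta) ->
  rect j eta (below j x k) (above j k y) <= 0.

Definition split_cut j k := forall s r, alive j s -> alive j r -> (s < k <= r)%N ->
  ~~ together j s r.
Definition far_cut j k := forall s r, alive j s -> alive j r -> (s < k <= r)%N ->
  Y j s != Y j r.

Lemma far_bound0 : cut_bound 0 (far_cut 0).
Proof.
move=> k x y x' y' eta xa ya xa' ya' xk ky kx' yk' /=; rewrite !orbF => mx my fk _.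
have := fk x x' xa xa'; rewrite xk kx' => /(_ isT).
by case/and3P: mx => _ _ ->.
Qed.

(** If no front lies across the cut at node j + 1, then no group did at node j,
    for it would have moved as one; and neither the rectangle nor the memory of
    its pairs has changed. *)
Lemma far_bound_step j : (j < J)%N -> cut_bound j (split_cut j) ->
  cut_bound j.+1 (far_cut j.+1).
Proof.
move=> jJ Pj k x y x' y' eta xa ya xa' ya' xk ky kx' yk' mx my fk he.
have jJ' := ltnW jJ.
have nj a b : (a < k)%N -> (k <= b)%N -> ~~ joined j.+1 a b.
  move=> ak kb; apply/negP => /and3P[aa ba e].
  by have := fk a b aa ba; rewrite ak kb e => /(_ isT).
have {}mx : met j x x' by move: mx => /= /orP[|//]; rewrite (negPf (nj _ _ xk kx')).
have {}my : met j y' y by move: my => /= /orP[|//]; rewrite (negPf (nj _ _ yk' ky)).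
have al q := @alive_decr j q jJ.
have inx q : alive j q -> (x <= q)%N -> (q <= x')%N -> alive j.+1 q.
  by move=> qa h1 h2; apply: (no_loss jJ mx).
have iny q : alive j q -> (y' <= q)%N -> (q <= y)%N -> alive j.+1 q.
  by move=> qa h1 h2; apply: (no_loss jJ my).
have -> : below j.+1 x k = below j x k.
  apply/finset.setP => q; rewrite !inE; apply/andP/andP => -[qa /andP[h1 h2]].
    by rewrite al// h1 h2.
  by rewrite inx ?h1 ?h2// ltnW// (leq_trans h2).
have -> : above j.+1 k y = above j k y.
  apply/finset.setP => q; rewrite !inE; apply/andP/andP => -[qa /andP[h1 h2]].
    by rewrite al// h1 h2.
  by rewrite iny ?h1 ?h2// ltnW// (leq_trans yk').
have -> : rect j.+1 eta (below j x k) (above j k y) = rect j eta (below j x k) (above j k y).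
  apply: eq_bigr => a; rewrite inE => /and3P[_ _ ak]; apply: eq_bigr => b.
  by rewrite inE => /and3P[_ kb _]; rewrite /weight memo_not_joined ?nj.
apply: (Pj k x y x' y'); rewrite ?al//.
- move=> s r sa ra /andP[sk kr]; apply/negP => tg.
  have [s1 [s1a ss1 s1k xs1]] : exists s1, [/\ alive j.+1 s1, (s <= s1)%N, (s1 < k)%N & (x <= s1)%N].
    have [xs|sx] := leqP x s; last by exists x; rewrite ltnW.
    by exists s; rewrite inx// ltnW// (leq_trans sk).
  have [r1 [r1a rr1 kr1 r1x]] : exists r1, [/\ alive j.+1 r1, (r1 <= r)%N, (k <= r1)%N & (r1 <= x')%N].
    have [rx|xr] := leqP r x'; last by exists x'; rewrite ltnW.
    by exists r; rewrite inx// ltnW// (leq_trans xk).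
  have er := together_arrival tg.
  have s1r1 : (s1 <= r1)%N by rewrite ltnW// (leq_trans s1k).
  have e1 := arrival_sandwich jJ sa (al _ s1a) ra ss1 (leq_trans s1r1 rr1) (esym er).
  have e2 := arrival_sandwich jJ sa (al _ r1a) ra (leq_trans ss1 s1r1) rr1 (esym er).
  have := fk s1 r1 s1a r1a; rewrite s1k kr1 => /(_ isT).
  by rewrite !Y_next// e1 e2 eqxx.
move=> s sa sk; have [sy|ys] := leqP s y'.
  apply: le_trans (Y_mono jJ' sa (al _ ya') sy) _.
  by apply: le_trans (Y_incr jJ ya') _; exact: he.
have sa1 : alive j.+1 s by apply: iny => //; [exact: ltnW|exact: leq_trans (ltnW sk) ky].
by apply: le_trans (Y_incr jJ sa1) _; exact: he.
Qed.

Lemma front_joined j s a b : alive j s -> a \in front j s -> b \in front j s -> joined j a b.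
Proof.
by move=> sa; rewrite !inE => /andP[aa /eqP ea] /andP[ba /eqP eb]; rewrite /joined aa ba ea eb /=.
Qed.

(** The hull touches the graph at the cut, so the slopes below the cut have a
    smaller sum than the speeds, and those above a larger one, while the speeds
    increase.  This is at the point of the front; [slp_wwv] brings it to eta. *)
Lemma front_rect j s k eta (x y : 'I_n) : (j <= J)%N -> alive j s -> split_cut j k ->
  (x < k)%N -> (k <= y)%N -> Y j s <= eta ->
  rect j eta [set a in front j s | (x <= a < k)%N] [set b in front j s | (k <= b <= y)%N] <= 0.
Proof.
move=> jJ sa sk xk ky seta.
set A := finset _; set B := finset _.
have hA a : a \in A -> [/\ a \in front j s, (x <= a)%N & (a < k)%N].
  by rewrite inE => /and3P[].
have hB b : b \in B -> [/\ b \in front j s, (k <= b)%N & (b <= y)%N].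
  by rewrite inE => /and3P[].
have contact : \sum_(r in front j s | (r < k)%N) sig j r
  = \sum_(r in front j s | (r < k)%N) slp (dat (Y j s)) r.
  apply: (hull_contact jJ sa) => a b aF bF /andP[ak kb].
  have := sk a b (front_alive aF) (front_alive bF); rewrite ak kb => /(_ isT).
  rewrite /together (frontY aF) (frontY bF) eqxx /= => ne.
  by rewrite lt_neqAle ne (front_speed_mono jJ aF bF)// ltnW// (leq_trans ak).
have sA F : \sum_(a in A) F a = \sum_(r in front j s | (r < k)%N) F r
     - \sum_(r in front j s | (r < x)%N) F r :> R.
  by rewrite -(sum_interval _ _ (ltnW xk)); apply: eq_bigl => r; rewrite inE.
have sB F : \sum_(b in B) F b = \sum_(r in front j s | (r < y.+1)%N) F r
     - \sum_(r in front j s | (r < k)%N) F r :> R.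
  by rewrite -(sum_interval _ _ (leqW ky)); apply: eq_bigl => r; rewrite inE ltnS.
have lA : \sum_(a in A) slp (dat (Y j s)) a <= \sum_(a in A) sig j a.
  by rewrite !sA contact; apply: lerB => //; exact: hull_prefix.
have lB : \sum_(b in B) sig j b <= \sum_(b in B) slp (dat (Y j s)) b.
  by rewrite !sB contact; apply: lerB => //; exact: hull_prefix.
apply: (@le_trans _ _ (\sum_(a in A) \sum_(b in B) (slp (dat (Y j s)) a - slp (dat (Y j s)) b))).
  apply: ler_sum => a /hA[aF xa ak]; apply: ler_sum => b /hB[bF kb _].
  have es : sgn a = sgn b.
    apply: (@sgn_front j); rewrite ?(front_alive aF) ?(front_alive bF) ?(frontY aF) ?(frontY bF)//.
  have := slp_wwv (dat eta) (dat (Y j s)) es.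
  rewrite /weight memo_joined; last exact: front_joined sa aF bF.
  rewrite (frontY aF) -mulrBr.
  have := dat_cum seta; rewrite distrC => hd h.
  have h2 : Kwwv * `|dat eta - dat (Y j s)| * `|hgt a - hgt b|
     <= Kwwv * (cum eta - cum (Y j s)) * `|hgt a - hgt b|.
    by apply: ler_wpM2r => //; apply: ler_wpM2l.
  move: (le_trans (ler_norm _) (le_trans h h2)); lra.
have E (g : 'I_n -> R) : \sum_(a in A) \sum_(b in B) (g a - g b)
    = #|B|%:R * \sum_(a in A) g a - #|A|%:R * \sum_(b in B) g b.
  under eq_bigr => a _ do rewrite sumrB sumr_const -mulr_natr.
  by rewrite sumrB -mulr_suml sumr_const -[_ *+ #|A|]mulr_natr mulrC [X in _ - X]mulrC.
apply: (@le_trans _ _ (\sum_(a in A) \sum_(b in B) (sig j a - sig j b))).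
  by rewrite !E; apply: lerB; apply: ler_wpM2l.
apply: sumr_le0 => a /hA[aF _ ak]; apply: sumr_le0 => b /hB[bF kb _].
by rewrite subr_le0 (front_speed_mono jJ aF bF)// ltnW// (leq_trans ak).
Qed.

(** If a front F lies across the cut, the rectangle A x B is divided by the ends of
    F.  The middle block is [front_rect].  The block of waves on the left of F and
    of waves in F is obtained by chaining at the left end of F, which is a cut
    between positions, and similarly on the right. *)
Lemma cut_bound_split j : (j <= J)%N -> cut_bound j (far_cut j) -> cut_bound j (split_cut j).
Proof.
move=> jJ Pf k x y x' y' eta xa ya xa' ya' xk ky kx' yk' mx my sk he.
have [/existsP[s /existsP[r /and5P[sa ra sk' kr /eqP e]]]|] :=
    boolP [exists s, exists r, [&& alive j s, alive j r, (s < k)%N, (k <= r)%N & Y j s == Y j r]];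
  last first.
  move=> /existsPn h; apply: (Pf k x y x' y') => // s r sa ra /andP[sk' kr].
  have /existsPn/(_ r) := h s; by rewrite sa ra sk' kr.
have seta : Y j s <= eta by exact: he.
have sF := front_refl sa.
have rF : r \in front j s by rewrite inE ra e eqxx.
have [k1 k1F k1min] := set_min sF; have [k2 k2F k2max] := set_max sF.
have k1s := k1min _ sF; have rk2 := k2max _ rF.
have k1k : (k1 < k)%N by exact: leq_ltn_trans sk'.
have kk2 : (k <= k2)%N by exact: leq_trans rk2.
have inF a : alive j a -> (k1 <= a)%N -> (a <= k2)%N -> a \in front j s.
  move=> aa h1 h2; have y1 := Y_mono jJ (front_alive k1F) aa h1.
  have y2 := Y_mono jJ aa (front_alive k2F) h2.
  move: y1 y2; rewrite (frontY k1F) (frontY k2F) inE aa /= => y1 y2.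
  by rewrite eq_le y1 y2.
set A := below j x k; set B := above j k y.
rewrite (rect_bigID _ _ _ _ (fun a => k1 <= a)%N (fun b => b <= k2)%N).
(* A1, A2 are the waves of A before the front and in it; B1, B2 those of B in the
   front and after it *)
set A2 := finset _; set B1 := finset _; set A1 := finset _; set B2 := finset _.
have A2P a : (a \in A2) = [&& alive j a, (x <= a)%N, (a < k)%N & (k1 <= a)%N].
  by rewrite !inE; case: (alive j a); case: (x <= a)%N; case: (a < k)%N.
have A1P a : (a \in A1) = [&& alive j a, (x <= a)%N, (a < k)%N & (a < k1)%N].
  by rewrite !inE /= -ltnNge; case: (alive j a); case: (x <= a)%N; case: (a < k)%N.
have B1P b : (b \in B1) = [&& alive j b, (k <= b)%N, (b <= y)%N & (b <= k2)%N].
  by rewrite !inE; case: (alive j b); case: (k <= b)%N; case: (b <= y)%N.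
have B2P b : (b \in B2) = [&& alive j b, (k <= b)%N, (b <= y)%N & (k2 < b)%N].
  by rewrite !inE /= -ltnNge; case: (alive j b); case: (k <= b)%N; case: (b <= y)%N.
have A2F a : a \in A2 -> a \in front j s.
  rewrite A2P => /and4P[aa _ ak k1a]; apply: inF => //.
  by rewrite ltnW// (leq_trans ak).
have B1F b : b \in B1 -> b \in front j s.
  rewrite B1P => /and4P[ba kb _ bk2]; apply: inF => //.
  by rewrite ltnW// (leq_trans k1k).
have r21 : rect j eta A2 B1 <= 0.
  have -> : A2 = [set a in front j s | (x <= a < k)%N].
    apply/finset.setP => a; rewrite [RHS]inE; apply/idP/idP => [h|].
      by rewrite A2F//; move: h; rewrite A2P => /and4P[_ -> -> _].
    case/and3P=> aF h1 h2; by rewrite A2P (front_alive aF) h1 h2 k1min.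
  have -> : B1 = [set b in front j s | (k <= b <= y)%N].
    apply/finset.setP => b; rewrite [RHS]inE; apply/idP/idP => [h|].
      by rewrite B1F//; move: h; rewrite B1P => /and4P[_ -> -> _].
    case/and3P=> bF h1 h2; by rewrite B1P (front_alive bF) h1 h2 k2max.
  exact: front_rect.
have asc_x a b : a \in A -> alive j b -> (a <= b)%N -> (b <= x')%N -> ascending a b.
  rewrite inE => /and3P[aa xa1 ak] ba ab bx.
  exact: (met_ascending jJ (met_sub jJ mx xa1 ab bx aa ba)).
have A1A a : a \in A1 -> a \in A by rewrite inE => /andP[].
have B2B b : b \in B2 -> b \in B by rewrite inE => /andP[].
have r11 : rect j eta A1 B1 <= 0.
  have [->|[a0]] := finset.set_0Vmem A1; first by rewrite /rect big_set0.
  rewrite A1P => /and4P[a0a xa0 a0k a0k1].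
  have xk1 : (x < k1)%N by exact: leq_ltn_trans a0k1.
  have sA2 : s \in A2 by rewrite A2P sa sk' k1s ltnW// (leq_trans xk1).
  have [yy yA2 yymax] := set_max sA2.
  have [yya xyy yyk k1yy] := and4P (etrans (esym (A2P yy)) yA2).
  have yyx' : (yy <= x')%N by rewrite ltnW// (leq_trans yyk).
  have r12 : rect j eta A1 A2 <= 0.
    have -> : A1 = below j x k1.
      apply/finset.setP => a; rewrite A1P inE; apply/and4P/and3P => -[aa xa1 h]; split=> //.
      exact: ltn_trans h k1k.
    have -> : A2 = above j k1 yy.
      apply/finset.setP => a; apply/idP/idP => h.
        by move: (h) (yymax _ h); rewrite A2P inE => /and4P[-> _ _ ->] ->.
      move: h; rewrite inE A2P => /and3P[-> k1a ayy].
      by rewrite k1a (leq_ltn_trans ayy yyk) (leq_trans (ltnW xk1) k1a).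
    apply: (Pf k1 x yy x' x eta) => //; first exact: leq_trans (ltnW k1k) kx'.
    - exact: met_sub mx (leqnn x) xyy yyx' xa yya.
    - move=> a b aa ba /andP[ak1 k1b]; apply/negP => /eqP eab.
      have h1 := Y_mono jJ aa (front_alive k1F) (ltnW ak1).
      have h2 := Y_mono jJ (front_alive k1F) ba k1b.
      have /k1min : a \in front j s.
        by rewrite inE aa /= -(frontY k1F) eq_le h1 /= eab.
      by rewrite leqNgt ak1.
    - by move=> a aa ak1; apply: he => //; exact: ltn_trans k1k.
  apply: rect_chain yA2 _ r12 r21 => a b c aA1 bA2 cB1.
  have := aA1; rewrite A1P => /and4P[aa xa1 ak ak1].
  have := bA2; rewrite A2P => /and4P[ba xb bk k1b].
  have := cB1; rewrite B1P => /and4P[ca kc cy ck2].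
  apply: weight_superadditive => //.
  - by rewrite ltnW// (leq_trans ak1).
  - by rewrite ltnW// (leq_trans bk).
  - apply: asc_x => //; first exact: A1A; first by rewrite ltnW// (leq_trans ak1).
    by rewrite ltnW// (leq_trans bk).
  - apply: (met_ascending jJ); last by rewrite ltnW// (leq_trans bk).
    by apply/joined_met/(front_joined sa); [exact: A2F|exact: B1F].
have rA1 : rect j eta A B1 <= 0.
  rewrite /rect (bigID (fun a => k1 <= a)%N) /=.
  have -> : \sum_(a in A | (k1 <= a)%N) \sum_(b in B1) (slp (dat eta) a - slp (dat eta) b - weight j eta a b) = rect j eta A2 B1.
    by apply: eq_bigl => a; rewrite [in RHS]inE.
  have -> : \sum_(a in A | ~~ (k1 <= a)%N) \sum_(b in B1) (slp (dat eta) a - slp (dat eta) b - weight j eta a b) = rect j eta A1 B1.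
    by apply: eq_bigl => a; rewrite [in RHS]inE.
  by rewrite -[leRHS]addr0; exact: lerD.
have r2 : rect j eta A B2 <= 0.
  have [->|[b0]] := finset.set_0Vmem B2.
    by rewrite /rect big1// => a _; rewrite big_set0.
  rewrite B2P => /and4P[b0a kb0 b0y k2b0].
  have k2y : (k2 < y)%N by exact: leq_trans b0y.
  have rB1 : r \in B1 by rewrite B1P ra kr rk2 ltnW// (leq_ltn_trans rk2).
  have [xx xB1 xxmin] := set_min rB1.
  have [xxa kxx xxy xxk2] := and4P (etrans (esym (B1P xx)) xB1).
  have r12 : rect j eta B1 B2 <= 0.
    have -> : B2 = above j k2.+1 y.
      apply/finset.setP => b; rewrite B2P inE; apply/and4P/and3P; first by case.
      by case=> ba h1 h2; split=> //; rewrite ltnW// (leq_ltn_trans kk2).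
    have -> : B1 = below j xx k2.+1.
      apply/finset.setP => b; apply/idP/idP => h.
        by move: (h) (xxmin _ h); rewrite B1P inE ltnS => /and4P[-> _ _ ->] ->.
      move: h; rewrite inE B1P ltnS => /and3P[-> xxb bk2]; rewrite bk2 (leq_trans kxx xxb).
      by rewrite ltnW// (leq_ltn_trans bk2).
    apply: (Pf k2.+1 xx y y y' eta) => //.
    - by rewrite ltnS; apply: leq_trans (ltnW yk') kk2.
    - exact: met_sub my (leq_trans (ltnW yk') kxx) xxy (leqnn y) xxa ya.
    - move=> a b aa ba /andP[ak2 k2b]; apply/negP => /eqP eab.
      have h1 := Y_mono jJ aa (front_alive k2F) ak2.
      have h2 := Y_mono jJ (front_alive k2F) ba (ltnW k2b).
      have /k2max : b \in front j s.
        by rewrite inE ba /= -(frontY k2F) eq_le h2 -eab h1.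
      by rewrite leqNgt k2b.
    - move=> a aa ak2; apply: le_trans seta; rewrite -(frontY k2F).
      exact: Y_mono (front_alive k2F) _.
  apply: rect_chain xB1 _ rA1 r12 => a b c aA bB1 cB2.
  have := aA; rewrite inE => /and3P[aa xa1 ak].
  have := bB1; rewrite B1P => /and4P[ba kb bY bk2].
  have := cB2; rewrite B2P => /and4P[ca kc cy k2c].
  have ab : (a <= b)%N by rewrite ltnW// (leq_trans ak).
  have bc : (b <= c)%N by rewrite ltnW// (leq_ltn_trans bk2).
  have asc_bc : ascending b c.
    apply: (met_ascending jJ) => //; apply: met_sub my _ bc cy ba ca => //.
    by rewrite ltnW// (leq_trans yk').
  have asc_ab : ascending a b.
    have [k1a|ak1] := leqP k1 a.
      apply: (met_ascending jJ) => //; apply/joined_met/(front_joined sa); last exact: B1F.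
      by apply: A2F; rewrite A2P aa xa1 ak k1a.
    apply: (@ascending_trans a s b).
      apply: asc_x => //; first by rewrite ltnW// (leq_trans ak1).
      by rewrite ltnW// (leq_trans sk').
    apply: (met_ascending jJ); last by rewrite ltnW// (leq_trans sk').
    by apply/joined_met/(front_joined sa) => //; exact: B1F.
  exact: weight_superadditive.
by rewrite -[leRHS]addr0; apply: lerD => //; rewrite -[leRHS]addr0; exact: lerD.
Qed.

Lemma cut_boundP j : (j <= J)%N -> cut_bound j (split_cut j).
Proof.
elim: j => [|j IH] jJ; apply: cut_bound_split => //; first exact: far_bound0.
by apply: far_bound_step => //; apply: IH; exact: ltnW.
Qed.

(** * Merging *)

Lemma Y_le_arrival j s : (j < J)%N -> alive j s -> Y j s <= arrival j s.
Proof.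
move=> jJ sa; rewrite /arrival lerDl mulr_ge0//; last exact: ltW (dt_gt0 jJ).
by have := sig_gtN1 jJ sa; lra.
Qed.

(** The pairs that have met lie in a rectangle around the cut between the groups, to
    which [cut_boundP] applies; the other pairs are bounded by [slp_ww]. *)
Lemma merge_rect j s r : (j < J)%N -> alive j s -> alive j r -> (s < r)%N ->
  arrival j s = arrival j r -> ~~ together j s r -> sgn s = sgn r ->
  rect j (arrival j s) (group j s) (group j r) <= 0.
Proof.
move=> jJ sa ra sr e nt esg; have jJ' := ltnW jJ.
have [hY hsig hlt] := group_lt jJ sa ra sr e nt.
have [h2 eu eu'] := two_groups jJ sa ra e nt.
set L := group j s; set G := group j r; set z := arrival j s.
have La a : a \in L -> alive j a by move/groupP => [].
have Ga a : a \in G -> alive j a by move/groupP => [].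
have Lz a : a \in L -> arrival j a = z by exact: group_arrival.
have Gz a : a \in G -> arrival j a = z by rewrite /z e; exact: group_arrival.
have LG a b q : a \in L -> b \in G -> alive j q -> (a <= q)%N -> (q <= b)%N ->
    (q \in L) || (q \in G).
  move=> aL bG qa aq qb; have := arrival_sandwich jJ (La _ aL) qa (Ga _ bG) aq qb.
  rewrite (Lz _ aL) (Gz _ bG) => /(_ erefl) eq; have := h2 q qa eq.
  by rewrite !inE qa.
have sgLG a b : a \in L -> b \in G -> sgn a = sgn b.
  move=> /groupP[aa ea _] /groupP[ba eb _].
  by rewrite (sgn_front jJ' aa sa ea) (sgn_front jJ' ba ra eb).
have nmet a b : a \in L -> b \in G -> ~~ met j a b ->
    slp (dat z) a - slp (dat z) b - weight j z a b <= 0.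
  move=> aL bG /memo_not_met m; rewrite subr_le0 /weight m opprK.
  apply: le_trans (ler_norm _) _; apply: le_trans (slp_ww _ (sgLG _ _ aL bG)) _.
  by apply: ler_wpM2r => //; rewrite lerDr mulr_ge0.
pose L1 := [set a in L | [exists b in G, met j a b]].
pose G1 := [set b in G | [exists a in L, met j a b]].
have le1 : rect j z L G <= rect j z L1 G1.
  rewrite /rect; set F := fun a b => slp (dat z) a - slp (dat z) b - weight j z a b.
  have -> : \sum_(a in L1) \sum_(b in G1) F a b =
      \sum_(a in L) \sum_(b in G) if (a \in L1) && (b \in G1) then F a b else 0.
    have -> : \sum_(a in L1) \sum_(b in G1) F a b = \sum_(a in L | a \in L1) \sum_(b in G | b \in G1) F a b.
      rewrite (_ : \sum_(a in L | a \in L1) _ = \sum_(a in L1) \sum_(b in G | b \in G1) F a b).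
        by apply: eq_bigr => a _; apply: eq_bigl => b; rewrite !inE andbA andbb.
      by apply: eq_bigl => a; rewrite !inE andbA andbb.
    rewrite big_mkcondr; apply: eq_bigr => a _; case: (a \in L1) => /=.
      by rewrite big_mkcondr.
    by rewrite big1.
  apply: ler_sum => a aL; apply: ler_sum => b bG; case: ifPn => // nab.
  apply: nmet => //; apply: contra nab => m; rewrite !inE.
  move: aL bG; rewrite !inE => /andP[aa ta] /andP[ba tb].
  by rewrite aa ta ba tb /=; apply/andP; split; apply/existsP;
    [exists b|exists a]; rewrite inE ?aa ?ta ?ba ?tb.
apply: le_trans le1 _.
have [->|[x0 x0L]] := finset.set_0Vmem L1; first by rewrite /rect big_set0.
have [x xL1 xmin] := set_min x0L.
have := xL1; rewrite inE => /andP[xL /exists_inP[x' x'G mx]].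
have x'G1 : x' \in G1 by rewrite inE x'G; apply/exists_inP; exists x.
have [y yG1 ymax] := set_max x'G1.
have := yG1; rewrite inE => /andP[yG /exists_inP[y' y'L my]].
have [k kG kmin] := set_min (group_refl ra).
have -> : L1 = below j x k.
  apply/finset.setP => a; apply/idP/idP => h.
    have aL : a \in L by move: h; rewrite inE => /andP[].
    by rewrite inE (La _ aL) xmin// hlt.
  move: h; rewrite inE => /and3P[aa xa ak].
  have aL : a \in L.
    have /orP[//|/kmin] := LG _ _ _ xL kG aa xa (ltnW ak).
    by rewrite leqNgt ak.
  rewrite inE aL; apply/exists_inP; exists x' => //.
  apply: met_sub mx xa _ (leqnn _) aa (Ga _ x'G) => //.
  by rewrite ltnW// (leq_trans ak)// kmin.
have -> : G1 = above j k y.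
  apply/finset.setP => b; apply/idP/idP => h.
    have bG : b \in G by move: h; rewrite inE => /andP[].
    by rewrite inE (Ga _ bG) ymax// kmin.
  move: h; rewrite inE => /and3P[ba kb bY].
  have bG : b \in G.
    have y'b : (y' <= b)%N by rewrite ltnW// (leq_trans (hlt _ _ y'L kG)).
    have /orP[bL|//] := LG _ _ _ y'L yG ba y'b bY.
    by have := hlt _ _ bL kG; rewrite ltnNge kb.
  rewrite inE bG; apply/exists_inP; exists y' => //.
  apply: met_sub my (leqnn _) _ bY (La _ y'L) ba => //.
  by rewrite ltnW// (leq_trans (hlt _ _ y'L kG)).
apply: (cut_boundP jJ' (La _ xL) (Ga _ yG) (Ga _ x'G) (La _ y'L)) mx my _ _.
- exact: hlt.
- exact: kmin.
- exact: kmin.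
- exact: hlt.
- move=> a b aa ba /andP[ak kb]; apply/negP => /andP[/eqP eY /eqP es].
  have ka := Ga _ kG.
  have h1 := Y_mono jJ' aa ka (ltnW ak); have h3 := Y_mono jJ' ka ba kb.
  have eYk : Y j a = Y j k by lra.
  have h4 := sig_front_mono jJ' aa ka eYk (ltnW ak).
  have h5 := sig_front_mono jJ' ka ba (etrans (esym eYk) eY) kb.
  have [_ kY ks] := groupP kG.
  have /kmin : a \in group j r.
    rewrite inE aa /together -kY -ks eYk eqxx /=; apply/eqP; lra.
  by rewrite leqNgt ak.
- move=> a aa ak; apply: le_trans (Y_mono jJ' aa (Ga _ kG) (ltnW ak)) _.
  by have [_ -> _] := groupP kG; rewrite /z e; exact: Y_le_arrival.
Qed.

Lemma dist_between j a b (D : {set 'I_n}) : (j <= J)%N -> alive j a -> alive j b ->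
  Y j a = Y j b ->
  (forall q, alive j q -> Y j q = Y j a ->
     (sig j a <= sig j q <= sig j b) || (sig j b <= sig j q <= sig j a) -> q \in D) ->
  `|hgt a - hgt b| <= eps * #|D|%:R.
Proof.
move=> jJ; wlog ab : a b / (a <= b)%N => [hw|] aa ba e aD.
  have [ab|ba'] := leqP a b; first exact: hw.
  rewrite distrC; apply: hw => //; first exact: ltnW.
  by move=> q qa qe h; apply: aD; rewrite ?e// orbC.
rewrite ascending_dist; last first.
  by apply: (met_ascending jJ) => //; apply: joined_met; rewrite /joined aa ba e /=.
rewrite (hgt_front jJ aa ba e ab); apply: ler_wpM2l; first exact: ltW.
rewrite ler_nat; apply: subset_leq_card; apply/fintype.subsetP => q.
rewrite inE => /and3P[qa /ltnW aq qb].
have y1 := Y_mono jJ aa qa aq; have y2 := Y_mono jJ qa ba qb.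
have eq : Y j q = Y j a by lra.
by apply: aD => //; rewrite (sig_front_mono jJ aa qa) ?(sig_front_mono jJ qa ba)// eq.
Qed.

Lemma dist_front j a b : (j <= J)%N -> alive j a -> alive j b ->
  Y j a = Y j b -> `|hgt a - hgt b| <= eps * #|front j a|%:R.
Proof.
by move=> jJ aa ba e; apply: (dist_between jJ) => // q qa qe _; rewrite inE qa qe eqxx.
Qed.

Lemma dist_group j s a b : (j <= J)%N -> a \in group j s -> b \in group j s ->
  `|hgt a - hgt b| <= eps * #|group j s|%:R.
Proof.
move=> jJ /groupP[aa ea sa] /groupP[ba eb sb].
apply: (dist_between jJ) => //; first by rewrite ea eb.
by move=> q qa qe; rewrite sa sb orbb -eq_le inE qa /together qe ea eqxx.
Qed.

(** The total change is 2 |L| |G| (sL - sG) / (|L| + |G|), the numerator is bounded by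
    [merge_rect], and the heights in a weight differ by at most the height
    eps (|L| + |G|) of the merged front, which absorbs the denominator. *)
Lemma merge_change j s r : (j < J)%N -> alive j s -> alive j r -> (s < r)%N ->
  arrival j s = arrival j r -> ~~ together j s r -> sgn s = sgn r ->
  \sum_(q in group j s :|: group j r) `|sig j.+1 q - sig j q|
  <= 2 * eps * \sum_(a in group j s) \sum_(b in group j r) (memo j.+1 a b - memo j a b).
Proof.
move=> jJ sa ra sr e nt esg; have jJ' := ltnW jJ.
have [hY hsig hlt] := group_lt jJ sa ra sr e nt.
have [_ eu eu'] := two_groups jJ sa ra e nt.
have [hU hL hG] := merge_speed jJ sa ra sr e nt esg.
have hr := merge_rect jJ sa ra sr e nt esg.
set L := group j s; set G := group j r; set z := arrival j s.
move: hU hL hG hr; rewrite -/L -/G -/z => hU hL hG hr.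
set S := \sum_(a in L) _.
have [A AE] : {A : R | A = #|L|%:R} by exists #|L|%:R.
have [B BE] : {B : R | B = #|G|%:R} by exists #|G|%:R.
pose d := sig j s - sig j r.
have A0 : 0 < A by rewrite AE ltr0n; apply/card_gt0P; exists s; exact: group_refl.
have B0 : 0 < B by rewrite BE ltr0n; apply/card_gt0P; exists r; exact: group_refl.
have d0 : 0 < d by rewrite subr_gt0.
have {}hL q : q \in L -> sig j s - sig j.+1 q = B * (d / (A + B)) by rewrite AE BE; exact: hL.
have {}hG q : q \in G -> sig j.+1 q - sig j r = A * (d / (A + B)) by rewrite AE BE; exact: hG.
have dAB : 0 <= d / (A + B) by apply: divr_ge0; [exact: ltW|apply: addr_ge0; exact: ltW].
have dis : [disjoint L & G].
  rewrite finset.disjoints_subset; apply/fintype.subsetP => q qL; rewrite inE; apply/negP => qG.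
  by have := hlt _ _ qL qG; rewrite ltnn.
have -> : \sum_(q in L :|: G) `|sig j.+1 q - sig j q| = 2 * (A * B * d / (A + B)).
  have := sum_setU xpredT (fun q => `|sig j.+1 q - sig j q|) dis.
  rewrite !(eq_bigl _ _ (fun q => andbT _)) => ->.
  have -> : \sum_(q in L) `|sig j.+1 q - sig j q| = A * (B * (d / (A + B))).
    transitivity (\sum_(q in L) (B * (d / (A + B)))); last by rewrite sumr_const AE mulr_natl.
    apply: eq_bigr => q qL.
    by have [_ _ ->] := groupP qL; rewrite distrC hL// ger0_norm// mulr_ge0// ltW.
  have -> : \sum_(q in G) `|sig j.+1 q - sig j q| = B * (A * (d / (A + B))).
    transitivity (\sum_(q in G) (A * (d / (A + B)))); last by rewrite sumr_const BE mulr_natl.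
    apply: eq_bigr => q qG.
    by have [_ _ ->] := groupP qG; rewrite hG// ger0_norm// mulr_ge0// ltW.
  by field; rewrite gt_eqF// addr_gt0.
rewrite -[leRHS]mulrA; apply: ler_wpM2l => //.
rewrite ler_pdivrMr; last exact: addr_gt0.
have sumE : \sum_(a in L) \sum_(b in G) (slp (dat z) a - slp (dat z) b) = A * B * d.
  have hA := group_total jJ' sa; have hB := group_total jJ' ra.
  move: hA hB; rewrite eu eu' -/z -/L -/G !sumr_const -!(mulr_natl (sig j _)) -AE -BE => hA hB.
  under eq_bigr => a _ do rewrite sumrB sumr_const.
  by rewrite sumrB sumr_const sumrMnl hA hB -[_ *+ #|G|]mulr_natr -[_ *+ #|L|]mulr_natr -AE -BE /d; ring.
have {hr} := hr; rewrite /rect.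
under eq_bigr => a _ do rewrite sumrB.
rewrite sumrB sumE subr_le0 => /le_trans; apply.
rewrite /S mulrAC mulr_sumr; apply: ler_sum => a aL; rewrite mulr_sumr; apply: ler_sum => b bG.
have aU : a \in L :|: G by rewrite inE aL.
have bU : b \in L :|: G by rewrite inE bG orbT.
have [aa1 fa] := hU _ aU; have [ba1 fb] := hU _ bU.
have eab : Y j.+1 a = Y j.+1 b.
  by rewrite !Y_next// (group_arrival aL) (group_arrival bG).
rewrite /weight [memo j.+1 a b]memo_joined; last by rewrite /joined aa1 ba1 eab /=.
rewrite (Y_next jJ aa1) (group_arrival aL) -/z mulrC; apply: ler_wpM2r.
  have [aa ea _] := groupP aL; rewrite subr_ge0; apply: le_trans (memo_le _ jJ' aa) _.
  apply: ler_wpM2l => //; apply: cum_mono; rewrite ea; exact: Y_le_arrival.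
have cE : A + B = #|L :|: G|%:R.
  by rewrite AE BE cardsU disjoint_setI0// cards0 subn0 natrD.
by rewrite cE -fa; exact: dist_front.
Qed.

(** * Cancellation *)

(** The speed is the mean of the slopes over the group G.  Times |G|, the quantity
    on the left is a sum of differences of slopes over K x (G minus K). *)
Lemma partial_mean j s (K : {set 'I_n}) : (j <= J)%N -> alive j s -> K \subset group j s ->
  `|\sum_(q in K) slp (dat (Y j s)) q - #|K|%:R * sig j s|
  <= Kww * eps * #|K|%:R * #|group j s :\: K|%:R.
Proof.
move=> jJ sa KG; set D := group j s :\: K; set G := group j s.
have G0 : 0 < #|G|%:R :> R by rewrite ltr0n; apply/card_gt0P; exists s; exact: group_refl.
have cG : #|G|%:R = #|K|%:R + #|D|%:R :> R by rewrite -(cardsID K G) (finset.setIidPr KG) natrD.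
set l := slp (dat (Y j s)).
have tot := group_total jJ sa.
rewrite -/G sumr_const -mulr_natl (big_setID K) /= (finset.setIidPr KG) -/D -/l in tot.
have key : #|G|%:R * (\sum_(q in K) l q - #|K|%:R * sig j s)
    = \sum_(a in K) \sum_(b in D) (l a - l b).
  under [RHS]eq_bigr => a _ do rewrite sumrB sumr_const.
  rewrite sumrB sumrMnl sumr_const -[_ *+ #|D|]mulr_natr -[_ *+ #|K|]mulr_natr mulrBr [X in _ - X]mulrCA -tot cG; ring.
rewrite -(ler_pM2l G0) -[X in X * _ <= _](ger0_norm (ltW G0)) -normrM key.
apply: le_trans (ler_norm_sum _ _ _) _.
apply: (@le_trans _ _ (\sum_(a in K) \sum_(b in D) Kww * (eps * #|G|%:R))).
  apply: ler_sum => a aK; apply: le_trans (ler_norm_sum _ _ _) _.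
  apply: ler_sum => b; rewrite inE => /andP[_ bG].
  have aG := fintype.subsetP KG _ aK.
  have [aa ea _] := groupP aG; have [ba eb _] := groupP bG.
  have eab : Y j a = Y j b by rewrite ea eb.
  apply: le_trans (slp_ww _ (sgn_front jJ aa ba eab)) _; apply: ler_wpM2l => //.
  exact: dist_group aG bG.
rewrite sumr_const sumr_const -[_ *+ #|D|]mulr_natr -[_ *+ #|K|]mulr_natr.
by rewrite le_eqVlt; apply/orP; left; apply/eqP; ring.
Qed.

(** The survivors are an initial segment of the left group or a final segment of
    the right one.  The hull of such a segment has all its slopes on the same side
    of the slope of the group, so the sum of the absolute changes is the absolute
    value of the sum, to which [partial_mean] applies. *)
Lemma cancel_change j s r : (j < J)%N -> alive j s -> alive j r -> (s < r)%N ->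
  arrival j s = arrival j r -> ~~ together j s r -> sgn s != sgn r ->
  \sum_(q in group j s :|: group j r | alive j.+1 q) `|sig j.+1 q - sig j q|
  <= Kww * eps * #|[set q in group j s :|: group j r | alive j.+1 q]|%:R
     * #|[set q in group j s :|: group j r | ~~ alive j.+1 q]|%:R.
Proof.
move=> jJ sa ra sr e nt nsg; have jJ' := ltnW jJ; set U := group j s :|: group j r.
have [hY hsig hlt] := group_lt jJ sa ra sr e nt.
have [h2 eu eu'] := two_groups jJ sa ra e nt.
set L := group j s; set G := group j r; set z := arrival j s.
set K := [set q in U | _]; set D := [set q in U | ~~ _].
have sgL a : a \in L -> sgn a = sgn s.
  by move=> /groupP[aa ea _]; exact: (sgn_front jJ').
have sgG a : a \in G -> sgn a = sgn r.
  by move=> /groupP[aa ea _]; exact: (sgn_front jJ').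
have La a : a \in L -> alive j a by move/groupP => [].
have Ga a : a \in G -> alive j a by move/groupP => [].
have Lz a : a \in L -> arrival j a = z by exact: group_arrival.
have Gz a : a \in G -> arrival j a = z by rewrite /z e; exact: group_arrival.
have Uz a : a \in U -> arrival j a = z by rewrite inE => /orP[/Lz|/Gz].
have -> : \sum_(q in U | alive j.+1 q) `|sig j.+1 q - sig j q| = \sum_(q in K) `|sig j.+1 q - sig j q|.
  by apply: eq_bigl => q; rewrite !inE.
have Ka q : q \in K -> alive j.+1 q by rewrite inE => /andP[].
have KU q : q \in K -> q \in U by rewrite inE => /andP[].
have fK q : q \in K -> front j.+1 q = K.
  move=> qK; apply/finset.setP => p; apply/idP/idP.
    rewrite inE => /andP[pa /eqP]; rewrite (Y_next jJ pa) (Y_next jJ (Ka _ qK)) (Uz _ (KU _ qK)) => ep.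
    have pa' := alive_decr jJ pa; have := h2 _ pa' ep.
    by rewrite !inE pa pa' /= andbT.
  move=> pK; rewrite inE (Ka _ pK) /= (Y_next jJ (Ka _ pK)) (Y_next jJ (Ka _ qK)).
  by rewrite (Uz _ (KU _ qK)) (Uz _ (KU _ pK)).
have uK q : q \in K -> dat (Y j.+1 q) = dat z.
  by move=> qK; rewrite (Y_next jJ (Ka _ qK)) (Uz _ (KU _ qK)).
have Ktot q : q \in K -> \sum_(a in K) sig j.+1 a = \sum_(a in K) slp (dat z) a.
  by move=> qK; have := hull_total jJ (Ka _ qK); rewrite fK// uK.
have dieG a b : a \in L -> b \in G -> alive j.+1 a -> alive j.+1 b -> False.
  move=> aL bG a1 b1; have := survival_opp jJ (La _ aL) (Ga _ bG).
  by rewrite (Lz _ aL) (Gz _ bG) (sgL _ aL) (sgG _ bG) a1 b1 => /(_ erefl nsg).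
have side g : alive j g -> dat (Y j g) = dat z -> K \subset group j g -> group j g \subset U ->
    (forall q, q \in K -> sig j g <= sig j.+1 q) \/ (forall q, q \in K -> sig j.+1 q <= sig j g) ->
    \sum_(q in K) `|sig j.+1 q - sig j q| <= Kww * eps * #|K|%:R * #|D|%:R.
  move=> ga eg KG GU hle.
  have -> : \sum_(q in K) `|sig j.+1 q - sig j q| = \sum_(q in K) `|sig j.+1 q - sig j g|.
    by apply: eq_bigr => q /(fintype.subsetP KG) /groupP[_ _ ->].
  have -> : \sum_(q in K) `|sig j.+1 q - sig j g| = `|\sum_(q in K) (sig j.+1 q - sig j g)|.
    case: hle => hle.
      rewrite ger0_norm; last by apply: sumr_ge0 => q qK; rewrite subr_ge0 hle.
      by apply: eq_bigr => q qK; rewrite ger0_norm// subr_ge0 hle.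
    rewrite ler0_norm; last by apply: sumr_le0 => q qK; rewrite subr_le0 hle.
    by rewrite -sumrN; apply: eq_bigr => q qK; rewrite ler0_norm// subr_le0 hle.
  rewrite sumrB sumr_const -[_ *+ #|K|]mulr_natl.
  have [K0|[q qK]] := finset.set_0Vmem K.
    by rewrite K0 !big_set0 cards0 mul0r subrr normr0 mulr0 mul0r.
  rewrite (Ktot _ qK); have := partial_mean jJ' ga KG; rewrite eg => h; apply: le_trans h _.
  apply: ler_wpM2l; first by rewrite !mulr_ge0// ltW.
  rewrite ler_nat; apply: subset_leq_card; apply/fintype.subsetP => p /finset.setDP[pG pK].
  by rewrite inE (fintype.subsetP GU _ pG); move: pK; rewrite inE (fintype.subsetP GU _ pG).
have [K0|[q0 q0K]] := finset.set_0Vmem K.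
  by rewrite K0 big_set0 cards0 mulr0 mul0r.
have := KU _ q0K; rewrite inE => /orP[q0L|q0G].
  have KL : K \subset L.
    apply/fintype.subsetP => q qK; have := KU _ qK; rewrite inE => /orP[//|qG].
    by case: (dieG _ _ q0L qG (Ka _ q0K) (Ka _ qK)).
  apply: (side s) => //; first by apply/fintype.subsetP => q qL; rewrite inE qL.
  left=> q qK; have [m mK mmax] := set_max q0K.
  apply: (hull_ge jJ (Ka _ qK)) => k; rewrite fK// uK//.
  have KE (F : 'I_n -> R) : \sum_(p in K | (p < k)%N) F p = \sum_(p in L | (p < minn k m.+1)%N) F p.
    apply: eq_bigl => p; rewrite leq_min ltnS; apply/andP/and3P => [[pK pk]|[pL pk pm]].
      by split=> //; [exact: (fintype.subsetP KL)|exact: mmax].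
    split=> //; have pU : p \in U by rewrite inE pL.
    rewrite inE pU /=.
    move: pm; rewrite leq_eqVlt => /predU1P[/val_inj ->|pm]; first exact: Ka.
    have mL := fintype.subsetP KL _ mK.
    have esg : sgn p = sgn m by rewrite !sgL.
    have nsg' : sgn p != sgn r by rewrite sgL.
    apply: (survival_left jJ (La _ pL) (La _ mL) ra) (Ka _ mK) => //.
    - by rewrite pm hlt// group_refl.
    - by rewrite (Lz _ pL) /z e.
    - by rewrite (Lz _ mL) /z e.
  have := group_prefix (minn k m.+1) jJ' sa; rewrite eu => h.
  by rewrite (KE (fun=> sig j s)) (KE (slp (dat z))).
have KG : K \subset G.
  apply/fintype.subsetP => q qK; have := KU _ qK; rewrite inE => /orP[qL|//].
  by case: (dieG _ _ qL q0G (Ka _ qK) (Ka _ q0K)).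
apply: (side r) => //; first by apply/fintype.subsetP => q qG; rewrite inE qG orbT.
right=> q qK; have [m mK mmin] := set_min q0K.
apply: (hull_le jJ (Ka _ qK)) => k; rewrite fK// uK//.
have KE (F : 'I_n -> R) : \sum_(p in K | (k <= p)%N) F p = \sum_(p in G | (maxn k m <= p)%N) F p.
  apply: eq_bigl => p; rewrite geq_max; apply/andP/and3P => [[pK pk]|[pG pk pm]].
    by split=> //; [exact: (fintype.subsetP KG)|exact: mmin].
  split=> //; have pU : p \in U by rewrite inE pG orbT.
  rewrite inE pU /=.
  move: pm; rewrite leq_eqVlt => /predU1P[/val_inj <-|pm]; first exact: Ka.
  have mG := fintype.subsetP KG _ mK.
  have esg : sgn m = sgn p by rewrite !sgG.
  have nsg' : sgn s != sgn m by rewrite (sgG _ mG).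
  apply: (survival_right jJ sa (Ga _ mG) (Ga _ pG)) (Ka _ mK) => //.
  - by rewrite pm hlt// group_refl.
  - by rewrite (Gz _ mG).
  - by rewrite (Gz _ pG).
have := group_suffix (maxn k m) jJ' ra; rewrite eu' => h.
by rewrite (KE (fun=> sig j r)) (KE (slp (dat z))).
Qed.

(** * The potential *)

(** The three terms pay for the crossings of the datum, the cancellations and the
    mergings. *)
Definition crossings j := \sum_(s | alive j s) (tv - cum (Y j s)).
Definition population j : R := #|[set s | alive j s]|%:R.
Definition couplings j := \sum_(p : 'I_n * 'I_n | [&& alive j p.1, alive j p.2 & (p.1 < p.2)%N])
   (Kwwv * tv - memo j p.1 p.2).
Definition potential j :=
  Kwv * eps * crossings j + Kww * eps ^+ 2 * n%:R * population j + 2 * eps ^+ 2 * couplings j.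

Lemma sum_drop (I : finType) (P Q : pred I) (F G : I -> R) :
  (forall i, Q i -> P i) -> (forall i, P i -> 0 <= F i) ->
  \sum_(i | Q i) (F i - G i) <= \sum_(i | P i) F i - \sum_(i | Q i) G i.
Proof.
move=> QP F0; rewrite sumrB lerD2r [leRHS](bigID Q) /=.
rewrite (eq_bigl Q) => [|i]; first by rewrite lerDl sumr_ge0// => i /andP[/F0].
by case Qi : (Q i); rewrite ?andbT ?andbF// QP.
Qed.

Lemma crossings_drop j : (j < J)%N ->
  \sum_(s | alive j.+1 s) (cum (Y j.+1 s) - cum (Y j s)) <= crossings j - crossings j.+1.
Proof.
move=> jJ; apply: le_trans (sum_drop _ _ _); last 2 first.
- by move=> s; exact: alive_decr.
- by move=> s _; rewrite subr_ge0.
by apply: ler_sum => s _; lra.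
Qed.

Lemma couplings_drop j : (j < J)%N ->
  \sum_(p : 'I_n * 'I_n | [&& alive j.+1 p.1, alive j.+1 p.2 & (p.1 < p.2)%N])
    (memo j.+1 p.1 p.2 - memo j p.1 p.2) <= couplings j - couplings j.+1.
Proof.
move=> jJ; apply: le_trans (sum_drop _ _ _); last 2 first.
- by move=> p /and3P[? ? ->]; rewrite !(alive_decr jJ).
- move=> p /and3P[pa _ _]; rewrite subr_ge0; apply: le_trans (memo_le _ (ltnW jJ) pa) _.
  exact: ler_wpM2l.
by apply: ler_sum => s _; lra.
Qed.

Lemma population_drop j (D : {set 'I_n}) : (j < J)%N ->
  (forall s, s \in D -> alive j s && ~~ alive j.+1 s) ->
  #|D|%:R <= population j - population j.+1.
Proof.
move=> jJ hD; rewrite lerBrDr -natrD ler_nat.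
rewrite -(@cardsID _ [set s | alive j.+1 s] [set s | alive j s]) addnC leq_add//.
  by apply: subset_leq_card; apply/fintype.subsetP => s; rewrite !inE => h; rewrite h (alive_decr jJ).
by apply: subset_leq_card; apply/fintype.subsetP => s /hD; rewrite !inE andbC.
Qed.

Lemma node_change j : (j < J)%N ->
  eps * \sum_(s | alive j.+1 s) `|sig j.+1 s - sig j s| <= potential j - potential j.+1.
Proof.
move=> jJ; have jJ' := ltnW jJ.
have c0 := crossings_drop jJ; have m0 := couplings_drop jJ.
have p0 : 0 <= population j - population j.+1.
  have := @population_drop j finset.set0 jJ; rewrite cards0; apply => s; by rewrite inE.
have m1 : 0 <= couplings j - couplings j.+1.
  apply: le_trans m0; apply: sumr_ge0 => p _; rewrite subr_ge0; exact: memo_incr.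
have e2 : 0 < eps ^+ 2 by rewrite exprn_gt0.
have nn : 0 <= n%:R :> R by rewrite ler0n.
have KP : 0 <= Kww * eps ^+ 2 * n%:R * (population j - population j.+1).
  by rewrite !mulr_ge0// ltW.
have EC : 0 <= 2 * eps ^+ 2 * (couplings j - couplings j.+1) by rewrite !mulr_ge0// ltW.
have dS s : alive j.+1 s -> 0 <= Kwv * (cum (Y j.+1 s) - cum (Y j s)).
  by move=> sa; rewrite mulr_ge0// subr_ge0; apply: cum_mono; exact: Y_incr.
have reduce (P : pred 'I_n) (V : R) :
    (forall s, alive j.+1 s -> P s -> `|sig j.+1 s - sig j s| <= Kwv * (cum (Y j.+1 s) - cum (Y j s))) ->
    \sum_(s | alive j.+1 s && ~~ P s) `|sig j.+1 s - sig j s| <= V ->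
    eps * V <= Kww * eps ^+ 2 * n%:R * (population j - population j.+1)
      + 2 * eps ^+ 2 * (couplings j - couplings j.+1) ->
    eps * \sum_(s | alive j.+1 s) `|sig j.+1 s - sig j s| <= potential j - potential j.+1.
  move=> hP hV hV'; rewrite (bigID P) /= mulrDr.
  have h1 : \sum_(s | alive j.+1 s && P s) `|sig j.+1 s - sig j s|
      <= Kwv * \sum_(s | alive j.+1 s) (cum (Y j.+1 s) - cum (Y j s)).
    rewrite mulr_sumr [leRHS](bigID P) /=.
    apply: (@le_trans _ _ (\sum_(s | alive j.+1 s && P s) Kwv * (cum (Y j.+1 s) - cum (Y j s)))).
      by apply: ler_sum => s /andP[sa Ps]; exact: hP.
    by rewrite lerDl sumr_ge0// => s /andP[sa _]; exact: dS.
  have h2 : eps * \sum_(s | alive j.+1 s && P s) `|sig j.+1 s - sig j s|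
     <= Kwv * eps * (crossings j - crossings j.+1).
    rewrite [Kwv * eps]mulrC -mulrA; apply: ler_wpM2l; first exact: ltW.
    by apply: le_trans h1 _; exact: ler_wpM2l.
  have h3 : eps * \sum_(s | alive j.+1 s && ~~ P s) `|sig j.+1 s - sig j s| <= eps * V.
    by apply: ler_wpM2l => //; exact: ltW.
  rewrite /potential; lra.
have [/existsP[s0 /existsP[r0 /and4P[sa ra /eqP e nt]]]|hno] :=
    boolP [exists s, exists r, [&& alive j s, alive j r, arrival j s == arrival j r
     & ~~ together j s r]]; last first.
  apply: (reduce xpredT 0).
  - move=> s sa1 _; apply: single_change => // r ra er.
    apply/negPn/negP => nt; move/existsPn: hno => /(_ s) /existsPn /(_ r).
    by rewrite (alive_decr jJ sa1) ra er eqxx nt.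
  - by rewrite big1// => s; rewrite andbF.
  - by rewrite mulr0 addr_ge0.
wlog sr : s0 r0 sa ra e nt / (s0 < r0)%N => [hw|].
  have [h|h|h] := ltngtP s0 r0; [exact: (hw s0 r0)| |].
    apply: (hw r0 s0) => //; move: nt; rewrite /together eq_sym [sig j _ == _]eq_sym.
    by [].
  by move: nt; rewrite /together (val_inj h) !eqxx.
have [hY hsig hlt] := group_lt jJ sa ra sr e nt.
have [h2 _ _] := two_groups jJ sa ra e nt.
pose U := group j s0 :|: group j r0.
have UP q : alive j q -> (q \in U) = (arrival j q == arrival j s0).
  move=> qa; apply/idP/eqP; last by move=> eq; have := h2 q qa eq; rewrite !inE qa.
  by rewrite inE => /orP[/group_arrival ->|/group_arrival ->].
have hfar s : alive j.+1 s -> s \notin U ->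
    `|sig j.+1 s - sig j s| <= Kwv * (cum (Y j.+1 s) - cum (Y j s)).
  move=> sa1 sU; have sa' := alive_decr jJ sa1; apply: single_change => // r ra' er.
  apply/negPn/negP => nt'; move: sU; rewrite UP// => /eqP; apply.
  by apply: (one_collision jJ sa' ra' sa ra (esym er) nt' e nt).
have sumU : \sum_(s | alive j.+1 s && ~~ (s \notin U)) `|sig j.+1 s - sig j s|
   = \sum_(q in U | alive j.+1 q) `|sig j.+1 q - sig j q|.
  by apply: eq_bigl => q; rewrite negbK andbC.
have [esg|nsg] := eqVneq (sgn s0) (sgn r0).
  have mc := merge_change jJ sa ra sr e nt esg.
  apply: (reduce (fun s => s \notin U) _ hfar); first exact: lexx.
  rewrite sumU.
  have h1 : \sum_(q in U | alive j.+1 q) `|sig j.+1 q - sig j q|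
     <= \sum_(q in U) `|sig j.+1 q - sig j q|.
    by rewrite [leRHS](bigID (alive j.+1)) /= lerDl sumr_ge0.
  have h3 : \sum_(a in group j s0) \sum_(b in group j r0) (memo j.+1 a b - memo j a b)
      <= couplings j - couplings j.+1.
    apply: le_trans m0; rewrite pair_big /=.
    have [hU _ _] := merge_speed jJ sa ra sr e nt esg.
    rewrite [leRHS](bigID (fun c : 'I_n * 'I_n => (c.1 \in group j s0) && (c.2 \in group j r0))) /=.
    rewrite (eq_bigl (fun p : 'I_n * 'I_n => [&& alive j.+1 p.1, alive j.+1 p.2 & (p.1 < p.2)%N] &&
       ((p.1 \in group j s0) && (p.2 \in group j r0)))).
      by rewrite lerDl sumr_ge0// => p _; rewrite subr_ge0 memo_incr.
    move=> p; apply/idP/idP => [/andP[h h']|/andP[]//].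
    have al a : a \in group j s0 :|: group j r0 -> alive j.+1 a by move=> /hU[].
    by rewrite h h' hlt// !al// inE ?h ?h' ?orbT.
  have h4 : eps * \sum_(q in U) `|sig j.+1 q - sig j q| <= 2 * eps ^+ 2 * (couplings j - couplings j.+1).
    have -> : 2 * eps ^+ 2 * (couplings j - couplings j.+1)
       = eps * (2 * eps * (couplings j - couplings j.+1)) by ring.
    apply: ler_wpM2l; first exact: ltW.
    by apply: le_trans mc _; apply: ler_wpM2l => //; rewrite mulr_ge0// ltW.
  have h5 : eps * \sum_(q in U | alive j.+1 q) `|sig j.+1 q - sig j q|
     <= eps * \sum_(q in U) `|sig j.+1 q - sig j q| by apply: ler_wpM2l => //; exact: ltW.
  lra.
have cc := cancel_change jJ sa ra sr e nt nsg.
apply: (reduce (fun s => s \notin U) _ hfar); first exact: lexx.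
rewrite sumU.
set K := [set q in _ | alive j.+1 q] in cc; set D := [set q in _ | _] in cc.
have Dp : #|D|%:R <= population j - population j.+1.
  apply: population_drop => // q; rewrite inE => /andP[qU ->]; rewrite andbT.
  by move: qU; rewrite inE => /orP[/groupP[]|/groupP[]].
have Kn : #|K|%:R <= n%:R :> R by rewrite ler_nat -[X in (_ <= X)%N]card_ord max_card.
have h : eps * \sum_(q in U | alive j.+1 q) `|sig j.+1 q - sig j q|
   <= eps * (Kww * eps * #|K|%:R * #|D|%:R) by apply: ler_wpM2l => //; exact: ltW.
have h' : Kww * eps ^+ 2 * (#|K|%:R * #|D|%:R)
   <= Kww * eps ^+ 2 * (n%:R * (population j - population j.+1)).
  apply: ler_wpM2l; first by rewrite mulr_ge0// ltW.
  exact: ler_pM.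
lra.
Qed.

Lemma total_change :
  \sum_(0 <= j < J) (eps * \sum_(s | alive j.+1 s) `|sig j.+1 s - sig j s|)
  <= (3 * Kww + 2 * Kwwv * tv) * (eps * n%:R) ^+ 2 + Kwv * (eps * n%:R) * tv.
Proof.
apply: (@le_trans _ _ (potential 0 - potential J)).
  have -> : potential 0 - potential J = \sum_(0 <= j < J) (potential j - potential j.+1).
    rewrite -[LHS]opprB -telescope_sumr// -sumrN.
    by apply: eq_bigr => j _; rewrite opprB.
  by rewrite !big_seq; apply: ler_sum => j; rewrite mem_index_iota => /andP[_ jJ]; exact: node_change.
have tv0 : 0 <= tv by apply: le_trans (cum_ge0 0) (cum_le 0).
have nn : 0 <= n%:R :> R by rewrite ler0n.
have e2 : 0 < eps ^+ 2 by rewrite exprn_gt0.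
have hJ : 0 <= potential J.
  rewrite /potential !addr_ge0// !mulr_ge0// ?(ltW eps_gt0)// ?(ltW e2)//.
    by apply: sumr_ge0 => s _; rewrite subr_ge0.
  apply: sumr_ge0 => p /and3P[pa _ _]; rewrite subr_ge0; apply: le_trans (memo_le _ (leqnn J) pa) _.
  exact: ler_wpM2l.
have card_le (P : pred 'I_n) (F : 'I_n -> R) c : 0 <= c -> (forall s, F s <= c) ->
    \sum_(s | P s) F s <= n%:R * c.
  move=> c0 Fc; apply: (@le_trans _ _ (\sum_(s | P s) c)); first exact: ler_sum.
  rewrite sumr_const -[_ *+ _]mulr_natl; apply: ler_wpM2r => //.
  by rewrite ler_nat -[X in (_ <= X)%N]card_ord max_card.
have c1 : crossings 0 <= n%:R * tv by apply: card_le => // s; rewrite lerBlDr lerDl.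
have c2 : population 0 <= n%:R by rewrite ler_nat -[X in (_ <= X)%N]card_ord max_card.
have c3 : couplings 0 <= n%:R ^+ 2 * (Kwwv * tv + Kww).
  have k0 : 0 <= Kwwv * tv + Kww by rewrite addr_ge0// mulr_ge0.
  apply: (@le_trans _ _ (\sum_(p : 'I_n * 'I_n) (Kwwv * tv + Kww))).
    rewrite /couplings big_mkcond; apply: ler_sum => p _; case: ifP => // _.
    by rewrite lerD2l lerNl memo_ge.
  by rewrite sumr_const -[_ *+ _]mulr_natl card_prod card_ord natrM expr2.
apply: (@le_trans _ _ (potential 0)); first lra.
have d1 : Kwv * eps * crossings 0 <= Kwv * eps * (n%:R * tv).
  by apply: ler_wpM2l => //; rewrite mulr_ge0// ltW.
have d2 : Kww * eps ^+ 2 * n%:R * population 0 <= Kww * eps ^+ 2 * n%:R * n%:R.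
  by apply: ler_wpM2l => //; rewrite !mulr_ge0// ltW.
have d3 : eps ^+ 2 * couplings 0 <= eps ^+ 2 * (n%:R ^+ 2 * (Kwwv * tv + Kww)).
  by apply: ler_wpM2l => //; exact: ltW.
rewrite /potential; lra.
Qed.

End WaveHistory.

(** * Slopes of the flux *)

Section Flux.
Local Open Scope classical_set_scope.
Local Open Scope ring_scope.
Variable R : realType.
Implicit Types (g : R -> R) (f : R -> R -> R) (C eps u v w : R).

Lemma mean_value g a b : (forall x, derivable g x 1) -> a < b ->
  exists2 c, a < c < b & g b - g a = derive1 g c * (b - a).
Proof.
move=> dg ab.
have [||c] := @MVT R g (derive1 g) a b ab.
- by move=> x _; rewrite derive1E; apply/derivableP.
- apply: derivable_within_continuous => x _; exact: dg.
by rewrite in_itv /= => ? ?; exists c.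
Qed.

Lemma lipschitz_derive g dg C : (forall x : R, is_derive x 1 g (dg x)) ->
  (forall x, `|dg x| <= C) -> forall a b, `|g a - g b| <= C * `|a - b|.
Proof.
move=> hg gC a b; wlog ab : a b / a < b => [hw|].
  have [ab|ba|->] := ltgtP a b; first exact: hw.
    by rewrite distrC [in leRHS]distrC; exact: hw.
  by rewrite !subrr !normr0 mulr0.
have dg1 x : derivable g x 1 by have [] := hg x.
have [c _ e] := mean_value dg1 ab.
rewrite distrC [in leRHS]distrC e normrM ler_wpM2r// derive1E.
by have [_ ->] := hg c.
Qed.

Lemma is_derive_translate g a (x : R) : (forall x, derivable g x 1) ->
  is_derive x 1 (fun y => g (y + a)) (derive1 g (x + a)).
Proof.
move=> dg; have h1 : is_derive x 1 (shift a) (1 : R) by exact: is_derive_shift.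
have h2 : is_derive (shift a x) 1 g (derive1 g (x + a)).
  by rewrite derive1E; apply/derivableP.
by have := is_derive1_comp h2 h1; rewrite mulr1.
Qed.

(** The slope of the interpolated flux on the cell [w, w + eps]. *)
Definition cell_slope f eps u w : R := (f (w + eps) u - f w u) / eps.

Lemma supnorm_ge f : has_ubound (abs_range f) -> forall w v, `|f w v| <= supnorm f.
Proof. by move=> h w v; apply: ub_le_sup => //; exists (w, v). Qed.

Lemma supnorm_ge0 f : has_ubound (abs_range f) -> 0 <= supnorm f.
Proof. by move=> h; apply: le_trans (supnorm_ge h 0 0). Qed.

Definition w_derivable f := forall u w, derivable (f ^~ u) w 1.
Definition v_derivable f := forall u w, derivable (f w) u 1.

Lemma is_derive_w f u w : w_derivable f -> is_derive w 1 (f ^~ u) (pdw f w u).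
Proof. by move=> df; rewrite /pdw derive1E; apply/derivableP. Qed.

Lemma is_derive_v f u w : v_derivable f -> is_derive u 1 (f w) (pdv f w u).
Proof. by move=> df; rewrite /pdv derive1E; apply/derivableP. Qed.

Lemma second_difference_w f C eps u : 0 <= eps -> w_derivable f -> w_derivable (pdw f) ->
  (forall w v, `|pdw (pdw f) w v| <= C) -> forall w z,
  `|(f (w + eps) u - f w u) - (f (z + eps) u - f z u)| <= C * eps * `|w - z|.
Proof.
move=> e0 df ddf hC; pose g w := f (w + eps) u - f w u.
apply: (@lipschitz_derive g (fun w => pdw f (w + eps) u - pdw f w u)).
  move=> x; apply: is_deriveB; last exact: is_derive_w.
  by apply: is_derive_translate => y; exact: df.
move=> x; have := @lipschitz_derive (pdw f ^~ u) _ C (fun x => is_derive_w u x ddf)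
  (fun x => hC x u) (x + eps) x.
by rewrite addrAC subrr add0r (ger0_norm e0).
Qed.

Lemma difference_wv f C eps w u z : 0 <= eps -> v_derivable f -> w_derivable (pdv f) ->
  (forall w v, `|pdw (pdv f) w v| <= C) ->
  `|(f (w + eps) u - f w u) - (f (w + eps) z - f w z)| <= C * eps * `|u - z|.
Proof.
move=> e0 df ddf hC; pose g u := f (w + eps) u - f w u.
apply: (@lipschitz_derive g (fun u => pdv f (w + eps) u - pdv f w u)).
  by move=> x; apply: is_deriveB; exact: is_derive_v.
move=> x; have := @lipschitz_derive (pdv f ^~ x) _ C (fun y => is_derive_w x y ddf)
  (fun y => hC y x) (w + eps) w.
by rewrite addrAC subrr add0r (ger0_norm e0).
Qed.

Lemma third_difference f C eps w y u z : 0 <= eps -> v_derivable f ->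
  w_derivable (pdv f) -> w_derivable (pdw (pdv f)) ->
  (forall w v, `|pdw (pdw (pdv f)) w v| <= C) ->
  `|((f (w + eps) u - f w u) - (f (y + eps) u - f y u))
    - ((f (w + eps) z - f w z) - (f (y + eps) z - f y z))| <= C * eps * `|w - y| * `|u - z|.
Proof.
move=> e0 df d1 d2 hC.
pose g u := (f (w + eps) u - f w u) - (f (y + eps) u - f y u).
apply: (@lipschitz_derive g (fun u => (pdv f (w + eps) u - pdv f w u) - (pdv f (y + eps) u - pdv f y u))).
  by move=> x; apply: is_deriveB; apply: is_deriveB; exact: is_derive_v.
by move=> x; exact: second_difference_w.
Qed.

Section Class.
Variables (f : R -> R -> R) (eps : R).
Hypothesis f_C3 : class_C 3 f.
Hypothesis f_bounded : forall l, (size l <= 3)%N -> has_ubound (abs_range (partial l f)).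
Hypothesis eps_gt0 : 0 < eps.

Let dw l : (size l < 3)%N -> w_derivable (partial l f).
Proof. by move=> h u w; have [] := f_C3.1 l h w u. Qed.

Let dv l : (size l < 3)%N -> v_derivable (partial l f).
Proof. by move=> h u w; have [] := f_C3.1 l h w u. Qed.

Lemma cell_slope_ww u w z :
  `|cell_slope f eps u w - cell_slope f eps u z| <= supnorm (pdw (pdw f)) * `|w - z|.
Proof.
rewrite /cell_slope -mulrBl normrM [`|eps^-1|]gtr0_norm ?invr_gt0// ler_pdivrMr// mulrAC.
apply: second_difference_w; first exact: ltW.
- exact: (@dw [::]).
- exact: (@dw [:: true]).
- exact/supnorm_ge/(@f_bounded [:: true; true]).
Qed.

Lemma cell_slope_wv u z w :
  `|cell_slope f eps u w - cell_slope f eps z w| <= supnorm (pdw (pdv f)) * `|u - z|.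
Proof.
rewrite /cell_slope -mulrBl normrM [`|eps^-1|]gtr0_norm ?invr_gt0// ler_pdivrMr// mulrAC.
apply: difference_wv; first exact: ltW.
- exact: (@dv [::]).
- exact: (@dw [:: false]).
- exact/supnorm_ge/(@f_bounded [:: true; false]).
Qed.

Lemma cell_slope_wwv u z w y :
  `|(cell_slope f eps u w - cell_slope f eps z w) - (cell_slope f eps u y - cell_slope f eps z y)|
  <= supnorm (pdw (pdw (pdv f))) * `|u - z| * `|w - y|.
Proof.
have -> : (cell_slope f eps u w - cell_slope f eps z w) - (cell_slope f eps u y - cell_slope f eps z y)
  = (((f (w + eps) u - f w u) - (f (y + eps) u - f y u))
    - ((f (w + eps) z - f w z) - (f (y + eps) z - f y z))) / eps.
  by rewrite /cell_slope; field; rewrite gt_eqF.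
rewrite normrM [`|eps^-1|]gtr0_norm ?invr_gt0// ler_pdivrMr//.
have -> : supnorm (pdw (pdw (pdv f))) * `|u - z| * `|w - y| * eps
   = supnorm (pdw (pdw (pdv f))) * eps * `|w - y| * `|u - z| by ring.
apply: third_difference; first exact: ltW.
- exact: (@dv [::]).
- exact: (@dw [:: false]).
- exact: (@dw [:: true; false]).
- exact/supnorm_ge/(@f_bounded [:: true; true; false]).
Qed.

Lemma cell_slope_gtN1 (Iw Iv : interval R) u w :
  (forall a b, a \in Iw -> b \in Iv -> - 1 < pdw f a b) ->
  w \in Iw -> w + eps \in Iw -> u \in Iv -> - 1 < cell_slope f eps u w.
Proof.
move=> h wI weI uI.
have ww : w < w + eps by rewrite ltrDl.
have [c /andP[c1 c2] e] := mean_value (fun x => @dw [::] isT u x) ww.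
rewrite /cell_slope [f _ _ - _]e addrAC subrr add0r mulfK ?gt_eqF//.
apply: h => //.
have := @interval_is_interval R Iw w (w + eps); apply => //; rewrite ?ltW//.
Qed.

End Class.
End Flux.

(** * Envelopes of the interpolated flux *)

Section ConvexFunction.
Local Open Scope classical_set_scope.
Local Open Scope ring_scope.
Variable R : realType.

Lemma convex_functionP (a b : R) (h : R -> R) :
  convex_function (`[a, b]%classic : set R) h <->
  forall x y t, a <= x <= b -> a <= y <= b -> 0 <= t <= 1 ->
    h (t * x + (1 - t) * y) <= t * h x + (1 - t) * h y.
Proof.
split=> [hc x y t xab yab /andP[t0 t1]|hc t x y].
  have := hc (Itv01 t0 t1) x y; rewrite !inE /= !in_itv /= => /(_ xab yab).
  by rewrite !convRE /unstable.onem /=.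
rewrite !inE /= !in_itv /= => xab yab; rewrite !convRE /unstable.onem /=.
by apply: hc => //; apply/andP.
Qed.
End ConvexFunction.

Section Lattice.
Local Open Scope classical_set_scope.
Local Open Scope ring_scope.
Variables (R : realType) (eps : R) (a : int) (k : nat).
Hypothesis eps_gt0 : 0 < eps.

Definition node (i : nat) : R := (a + i%:Z)%:~R * eps.
(** The affine function through the points i and i + 1 of the graph of H. *)
Definition chord (H : nat -> R) (i : nat) (z : R) : R :=
  H i + (z / eps - (a + i%:Z)%:~R) * (H i.+1 - H i).

Lemma node_div i : node i / eps = (a + i%:Z)%:~R.
Proof. by rewrite /node mulfK// gt_eqF. Qed.

Lemma node_mono i j : (i <= j)%N -> node i <= node j.
Proof. by move=> ij; rewrite /node ler_pM2r// ler_int; lia. Qed.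

Lemma chord_node H i j : chord H i (node j) = H i + (j%:R - i%:R) * (H i.+1 - H i).
Proof. by rewrite /chord node_div !intrD; congr (_ + _ * _); rewrite -!pmulrn; ring. Qed.

Lemma chord_conv H i x y t :
  chord H i (t * x + (1 - t) * y) = t * chord H i x + (1 - t) * chord H i y.
Proof. by rewrite /chord; field; rewrite gt_eqF. Qed.

Lemma interp_node g i : interp eps g (node i) = g (node i).
Proof. by rewrite /interp node_div intrKfloor subrr mul0r addr0. Qed.

Lemma interp_chord g i z : node i <= z -> z <= node i.+1 ->
  interp eps g z = chord (fun j => g (node j)) i z.
Proof.
move=> h1; rewrite le_eqVlt => /predU1P[->|h2].
  by rewrite interp_node chord_node -natr1; ring.
have e : Num.floor (z / eps) = a + i%:Z.
  apply: floor_def; rewrite ler_pdivlMr// ltr_pdivrMr//; apply/andP; split=> //.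
  by rewrite -addrA [i%:Z + 1]addrC -intS.
by rewrite /interp e /chord /node -addrA [i%:Z + 1]addrC -intS.
Qed.

Lemma chord_le H H' i i' z : node i <= z <= node i.+1 ->
  chord H' i' (node i) <= H i -> chord H' i' (node i.+1) <= H i.+1 ->
  chord H' i' z <= chord H i z.
Proof.
move=> /andP[z1 z2] h1 h2; pose t : R := z / eps - (a + i%:Z)%:~R.
have t0 : 0 <= t by rewrite subr_ge0 ler_pdivlMr.
have t1 : t <= 1.
  rewrite lerBlDr ler_pdivrMr//; apply: le_trans z2 _.
  by rewrite /node -[1]/(1%:~R) -intrD intS addrCA.
have ez : z = (1 - t) * node i + (1 - (1 - t)) * node i.+1.
  by rewrite /node intS !intrD /t intrD; field; rewrite gt_eqF.
rewrite {1}ez chord_conv.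
apply: (@le_trans _ _ ((1 - t) * H i + (1 - (1 - t)) * H i.+1)); last by rewrite /chord -/t; lra.
by apply: lerD; apply: ler_wpM2l => //; lra.
Qed.

Variable g : R -> R.
Hypothesis k_gt0 : (0 < k)%N.

Let F i := g (node i).
Definition lower i := conv_env (node 0) (node k) (interp eps g) (node i).
Let minorants := [set h : R -> R | convex_function (`[node 0, node k]%classic : set R) h /\
    forall z, node 0 <= z <= node k -> h z <= interp eps g z].

Lemma lower_ub i : (i <= k)%N -> ubound [set h (node i) | h in minorants] (F i).
Proof.
move=> ik _ [h [_ hm] <-]; rewrite /F -(interp_node g i); apply: hm.
by rewrite !node_mono.
Qed.

Lemma minorant_le_lower h i : (i <= k)%N -> minorants h -> h (node i) <= lower i.
Proof.
move=> ik hm; apply: ub_le_sup; last by exists h.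
by exists (F i); exact: lower_ub.
Qed.

Lemma cell_of (z : R) : node 0 <= z <= node k ->
  exists2 i, (i < k)%N & node i <= z <= node i.+1.
Proof.
move=> /andP[z0 zk].
have : exists i, (i < k)%N && (z <= node i.+1).
  by exists k.-1; rewrite prednK// leqnn.
move=> /ex_minnP[i /andP[ik zi] imin]; exists i => //; rewrite zi andbT.
case: i ik zi imin => [//|i] ik zi imin; rewrite leNgt; apply/negP => zi'.
by have := imin i; rewrite (ltnW ik) (ltW zi') /= ltnn => /(_ isT).
Qed.

(** A lattice function lying above each of its own chords is the trace of the
    maximum of these chords, which is a convex function on the line. *)
Lemma chord_minorant (H : nat -> R) :
  (forall i j, (i < k)%N -> (j <= k)%N -> chord H i (node j) <= H j) ->
  (forall j, (j <= k)%N -> H j <= F j) ->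
  forall j, (j <= k)%N -> H j <= lower j.
Proof.
move=> Hc HF j jk.
pose h z := \big[Order.max/chord H 0 z]_(i < k) chord H i z.
have hge i z : (i < k)%N -> chord H i z <= h z.
  by move=> ik; rewrite /h -[i]/(val (Ordinal ik)); apply: le_bigmax.
have hle z c : (forall i, (i < k)%N -> chord H i z <= c) -> h z <= c.
  by move=> hc; apply: bigmax_le => [|i _]; apply: hc.
have hmin : minorants h.
  split.
    apply/convex_functionP => x y t _ _ /andP[t0 t1]; apply: hle => i ik.
    rewrite chord_conv; apply: lerD; apply: ler_wpM2l; rewrite ?subr_ge0 ?hge//.
  move=> z /cell_of[m mk /andP[m1 m2]]; rewrite (interp_chord _ m1 m2).
  apply: hle => i ik; apply: chord_le; first by rewrite m1.
    exact: le_trans (Hc i m ik (ltnW mk)) (HF m (ltnW mk)).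
  exact: le_trans (Hc i m.+1 ik mk) (HF m.+1 mk).
apply: le_trans (minorant_le_lower jk hmin).
move: jk; rewrite leq_eqVlt => /predU1P[->|jk]; last first.
  by apply: le_trans (hge j (node j) jk); rewrite chord_node subrr mul0r addr0.
have pk : (k.-1 < k)%N by rewrite prednK.
apply: le_trans (hge _ _ pk); rewrite chord_node prednK//.
rewrite -[k in X in _ <= _ + (X - _) * _](prednK k_gt0) -natr1; lra.
Qed.

Lemma chord_le_convex (H : nat -> R) :
  (forall i, (i.+1 < k)%N -> H i.+1 - H i <= H i.+2 - H i.+1) ->
  forall i j, (i < k)%N -> (j <= k)%N -> chord H i (node j) <= H j.
Proof.
move=> Hm i j ik jk; rewrite chord_node.
have mono p q : (p <= q)%N -> (q < k)%N -> H p.+1 - H p <= H q.+1 - H q.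
  elim: q => [|q IH]; first by rewrite leqn0 => /eqP ->.
  rewrite leq_eqVlt => /predU1P[->//|pq] qk.
  by apply: le_trans (IH pq (ltnW qk)) _; exact: Hm.
have [ij|ji] := leqP i j.
  rewrite -(subnKC ij) in jk *; elim: (j - i)%N jk => [|d IH] jk.
    by rewrite addn0 subrr mul0r addr0.
  have := IH (leq_trans _ jk); rewrite addnS leqnSn => /(_ isT).
  have := mono i (i + d)%N (leq_addr _ _); rewrite addnS in jk; move=> /(_ jk).
  rewrite -natr1 !natrD; lra.
rewrite -(subnKC (ltnW ji)) in ik *; elim: (i - j)%N ik => [|d IH] ik.
  by rewrite addn0 subrr mul0r addr0.
have := IH (leq_ltn_trans _ ik); rewrite addnS leqnSn => /(_ isT).
rewrite addnS in ik; have := mono (j + d)%N (j + d).+1 (leqnSn _) ik.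
rewrite -natr1 !natrD => h1 h2.
have : 0 <= d%:R * ((H (j + d).+2 - H (j + d).+1) - (H (j + d).+1 - H (j + d)%N)).
  by rewrite mulr_ge0// subr_ge0.
lra.
Qed.

Lemma convex_le_lower (H : nat -> R) :
  (forall i, (i.+1 < k)%N -> H i.+1 - H i <= H i.+2 - H i.+1) ->
  (forall j, (j <= k)%N -> H j <= F j) ->
  forall j, (j <= k)%N -> H j <= lower j.
Proof. by move=> Hm; apply: chord_minorant; exact: chord_le_convex. Qed.

Lemma affine_le_lower (c d : R) : (forall j, (j <= k)%N -> c + d * j%:R <= F j) ->
  forall j, (j <= k)%N -> c + d * j%:R <= lower j.
Proof. by move=> h; apply: (@convex_le_lower (fun j => c + d * j%:R)) => // i _; lra. Qed.

Lemma lattice_lbound : {M : R | forall j, (j <= k)%N -> M <= F j}.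
Proof.
exists (\big[Order.min/F 0]_(i < k.+1) F i) => j jk.
by rewrite -[j]/(val (Ordinal (jk : (j < k.+1)%N))); apply: bigmin_le.
Qed.

Lemma minorant_exists : exists M, minorants (cst M).
Proof.
have [M hM] := lattice_lbound; exists M; split.
  by apply/convex_functionP => x y t _ _ _; rewrite /cst; lra.
move=> z /cell_of[m mk mz]; have /andP[m1 m2] := mz; rewrite (interp_chord _ m1 m2).
have cM z' : chord (fun=> M) 0 z' = M by rewrite /chord subrr mulr0 addr0.
by rewrite /cst -(cM z); apply: chord_le; rewrite ?cM ?hM// ltnW.
Qed.

Lemma lower_le i : (i <= k)%N -> lower i <= F i.
Proof.
move=> ik; have [M hM] := minorant_exists.
by apply: ge_sup; [exists M, (cst M)|exact: lower_ub].
Qed.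

Lemma lower_first : lower 0 = F 0.
Proof.
apply/eqP; rewrite eq_le lower_le//=; have [M hM] := lattice_lbound.
have M0 := hM 0%N (leq0n _).
(* the line from the first point of the graph with slope M - F 0 <= 0 *)
have := @affine_le_lower (F 0%N) (M - F 0%N) _ 0%N (leq0n _).
rewrite mulr0 addr0; apply => -[|j] jk; first by rewrite mulr0 addr0.
have := hM _ jk.
have : 0 <= j%:R * (F 0%N - M) by rewrite mulr_ge0// subr_ge0.
by rewrite -natr1; lra.
Qed.

Lemma lower_last : lower k = F k.
Proof.
apply/eqP; rewrite eq_le lower_le//=; have [M hM] := lattice_lbound.
have Mk := hM k (leqnn _).
(* the line to the last point of the graph with slope F k - M >= 0 *)
have := @affine_le_lower (F k - (F k - M) * k%:R) (F k - M) _ k (leqnn _).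
rewrite subrK; apply => j; rewrite leq_eqVlt => /predU1P[->|jk]; first by rewrite subrK.
have := hM _ (ltnW jk).
have : 0 <= (k%:R - (j%:R + 1)) * (F k - M).
  by rewrite mulr_ge0 ?subr_ge0// natr1 ler_nat.
lra.
Qed.

Lemma lower_convex i : (i.+1 < k)%N -> lower i.+1 - lower i <= lower i.+2 - lower i.+1.
Proof.
move=> ik.
suff : lower i.+1 <= (lower i + lower i.+2) / 2 by lra.
have [M hM] := minorant_exists.
apply: ge_sup; first by exists M, (cst M).
move=> _ [h hm <-].
have i0 : (i <= k)%N by lia.
have := minorant_le_lower i0 hm; have := minorant_le_lower (ik : (i.+2 <= k)%N) hm.
have [/convex_functionP hc _] := hm.
have := hc (node i) (node i.+2) 2^-1.
have -> : 2^-1 * node i + (1 - 2^-1) * node i.+2 = node i.+1.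
  by rewrite /node !intS !intrD; field.
rewrite !node_mono//; try lia.
move=> /(_ isT isT); rewrite invr_ge0 ler0n invf_le1 ?ler1n// => /(_ isT); lra.
Qed.

(** At a kink below the graph the envelope could be raised a little. *)
Lemma lower_contact i : (i.+1 < k)%N -> lower i.+1 - lower i < lower i.+2 - lower i.+1 ->
  lower i.+1 = F i.+1.
Proof.
move=> ik kink; apply/eqP; rewrite eq_le lower_le ?(ltnW ik)//= leNgt; apply/negP => lt.
(* raising the node i + 1 by d keeps the sequence convex and below the graph *)
pose d := Order.min (F i.+1 - lower i.+1) ((lower i.+2 - lower i.+1 - (lower i.+1 - lower i)) / 2).
have d0 : 0 < d by rewrite lt_min subr_gt0 lt/= divr_gt0// subr_gt0.
have d1 : d <= F i.+1 - lower i.+1 by rewrite ge_min lexx.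
have d2 : d <= (lower i.+2 - lower i.+1 - (lower i.+1 - lower i)) / 2 by rewrite ge_min lexx orbT.
pose H j := lower j + (if j == i.+1 then d else 0).
have := @convex_le_lower H _ _ i.+1 (ltnW ik).
rewrite /H eqxx => h; have {}h : lower i.+1 + d <= lower i.+1.
  apply: h => [j jk|j jk].
    have := lower_convex jk; rewrite !eqSS.
    have [->|ne] := eqVneq j i.
      by rewrite ltn_eqF// (gtn_eqF (ltnSn i)); lra.
    have [->|ne2] := eqVneq j i.+1.
      by rewrite gtn_eqF//; lra.
    by case: eqP => _; lra.
  case: eqP => [->|_]; first lra.
  by rewrite addr0 lower_le.
lra.
Qed.

End Lattice.

Section Hull.
Local Open Scope classical_set_scope.
Local Open Scope ring_scope.
Variable R : realType.

(** The sums of s describe the convex hull of the sequence of the sums of l: it is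
    convex, lies below, and touches wherever it has a kink and at the end. *)
Definition is_hull (k : nat) (l s : nat -> R) : Prop :=
  [/\ forall i, (i.+1 < k)%N -> s i <= s i.+1,
      forall m, (m <= k)%N -> \sum_(0 <= i < m) s i <= \sum_(0 <= i < m) l i &
      forall m, (m <= k)%N -> ((0 < m < k)%N -> s m.-1 < s m) ->
        \sum_(0 <= i < m) s i = \sum_(0 <= i < m) l i].

Lemma eq_hull k l l' s s' : (forall i, (i < k)%N -> l i = l' i) ->
  (forall i, (i < k)%N -> s i = s' i) -> is_hull k l s -> is_hull k l' s'.
Proof.
move=> el es [h1 h2 h3].
have e m (p q : nat -> R) : (forall i, (i < k)%N -> p i = q i) -> (m <= k)%N ->
    \sum_(0 <= i < m) p i = \sum_(0 <= i < m) q i.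
  move=> pq mk; rewrite !big_nat; apply: eq_bigr => i /andP[_ im].
  by apply: pq; exact: leq_trans mk.
split=> [i ik|m mk|m mk hm].
- by rewrite -!es ?h1//; exact: ltnW.
- by rewrite -(e m s s' es mk) -(e m l l' el mk); exact: h2.
rewrite -(e m s s' es mk) -(e m l l' el mk); apply: h3 => // mk'.
have /andP[m0 mk2] := mk'.
by rewrite !es ?hm// prednK// ltnW.
Qed.

Variables (eps : R) (a : int) (k : nat).
Hypothesis eps_gt0 : 0 < eps.
Local Notation node := (node eps a).

Lemma nodeS i : node i.+1 = node i + eps.
Proof. by rewrite /node intS !intrD; ring. Qed.

Lemma slope_node (h : R -> R) i : slope h (node i) (node i.+1) = (h (node i.+1) - h (node i)) / eps.
Proof. by rewrite /slope nodeS [_ + eps - _]addrAC subrr add0r. Qed.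

Lemma sum_increments (h : R -> R) m :
  \sum_(0 <= i < m) slope h (node i) (node i.+1) = (h (node m) - h (node 0)) / eps.
Proof.
under eq_bigr => i _ do rewrite slope_node.
by rewrite -mulr_suml telescope_sumr.
Qed.

Lemma conv_hull (g : R -> R) : (0 < k)%N ->
  is_hull k (fun i => slope g (node i) (node i.+1))
    (fun i => slope (conv_env (node 0) (node k) (interp eps g)) (node i) (node i.+1)).
Proof.
move=> k0; have ei : 0 < eps^-1 by rewrite invr_gt0.
split=> [i ik|m mk|m mk hm].
- by rewrite !slope_node ler_pM2r//; exact: lower_convex.
- rewrite !sum_increments ler_pM2r//.
  have := lower_le a eps_gt0 g k0 mk; have := lower_first a eps_gt0 g k0.
  by rewrite /lower => ->; rewrite lerD2r.
rewrite !sum_increments; congr (_ / _).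
have := lower_first a eps_gt0 g k0; rewrite /lower => ->; congr (_ - _).
case: m mk hm => [|m] mk hm; first exact: (lower_first a eps_gt0 g k0).
move: mk; rewrite leq_eqVlt => /predU1P[->|mk]; first exact: (lower_last a eps_gt0 g k0).
apply: (lower_contact eps_gt0 k0 mk).
by move: hm => /(_ mk) /=; rewrite !slope_node ltr_pM2r.
Qed.

Lemma conc_envE (p q : R) (g : R -> R) u :
  conc_env p q (interp eps g) u = - conv_env p q (interp eps (\- g)) u.
Proof.
rewrite /conc_env /conv_env /inf; congr (- sup _).
have iN z : interp eps (\- g) z = - interp eps g z by rewrite /interp /=; ring.
apply/seteqP; split=> x /=.
  move=> [_ [h [hc hm] <-] <-]; exists (fun z => - h z) => //; split=> // z zpq.
  by rewrite iN lerN2 hm.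
move=> [h [hc hm] <-]; exists (- h u); last by rewrite opprK.
exists (fun z => - h z) => //; split.
  by rewrite (_ : (fun z => - - h z) = h)//; apply/funext => z; rewrite opprK.
by move=> z zpq; rewrite lerNr -iN; exact: hm.
Qed.

Lemma sum_rev (h : nat -> R) m : (m <= k)%N ->
  \sum_(0 <= i < m) h (k - i.+1)%N = \sum_(0 <= i < k) h i - \sum_(0 <= i < k - m) h i.
Proof.
elim: m => [|m IH] mk; first by rewrite big_geq// subn0 subrr.
rewrite big_nat_recr//= IH ?(ltnW mk)//.
have -> : (k - m = (k - m.+1).+1)%N by lia.
by rewrite big_nat_recr//=; ring.
Qed.

(** Across a negative front the waves run through the cells downwards, so the
    slopes of the concave envelope are read from right to left. *)
Lemma conc_hull (g : R -> R) : (0 < k)%N ->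
  is_hull k (fun i => slope g (node (k - i.+1)) (node (k - i.+1).+1))
    (fun i => slope (conc_env (node 0) (node k) (interp eps g))
       (node (k - i.+1)) (node (k - i.+1).+1)).
Proof.
move=> k0.
pose l i := slope (\- g) (node i) (node i.+1).
pose s i := slope (conv_env (node 0) (node k) (interp eps (\- g))) (node i) (node i.+1).
have [h1 h2 h3] : is_hull k l s := conv_hull (\- g) k0.
apply: (@eq_hull k (fun i => - l (k - i.+1)%N) _ (fun i => - s (k - i.+1)%N)).
- by move=> i _; rewrite /l /slope /= -mulNr; congr (_ / _); ring.
- by move=> i _; rewrite /s /slope !conc_envE -mulNr; congr (_ / _); ring.
have tot : \sum_(0 <= i < k) s i = \sum_(0 <= i < k) l i.
  by apply: h3 => //; rewrite ltnn andbF.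
split=> [i ik|m mk|m mk hm].
- rewrite lerN2 (_ : (k - i.+1 = (k - i.+2).+1)%N); last by lia.
  by apply: h1; lia.
- rewrite !sumrN lerN2 !sum_rev// tot lerD2l lerN2; apply: h2; lia.
rewrite !sumrN !sum_rev// tot; congr (- (_ - _)); apply: h3; first lia.
move=> /andP[p1 p2].
have mk' : (0 < m < k)%N by lia.
have := hm mk'; rewrite ltrN2 prednK; last by lia.
have -> : (k - m.+1 = (k - m).-1)%N by lia.
by [].
Qed.

End Hull.

(** * Hulls along a finite set of waves *)

Section Rank.
Variables (R : realType) (n : nat).
Implicit Types (A : {set 'I_n}) (k : nat) (i q r : 'I_n).

Definition rank A k := #|[set q in A | (q < k)%N]|.

Lemma rank_full A k : (n <= k)%N -> rank A k = #|A|.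
Proof.
move=> nk; apply: eq_card => q; rewrite inE (leq_trans (ltn_ord q) nk).
by rewrite andbT.
Qed.

Lemma rank_mono A k l : (k <= l)%N -> (rank A k <= rank A l)%N.
Proof.
move=> kl; apply: subset_leq_card; apply/fintype.subsetP => q; rewrite !inE => /andP[-> qk].
exact: leq_trans kl.
Qed.

Lemma rankS A i : rank A i.+1 = ((i \in A) + rank A i)%N.
Proof.
have e : [set q in A | (q < i.+1)%N] = [set q in A | (q < i)%N] :|: [set q in A | q == i].
  apply/finset.setP => q; rewrite !inE ltnS leq_eqVlt.
  have -> : (q == i :> nat) = (q == i) by [].
  by case: (q \in A); case: (q == i); case: (q < i)%N.
rewrite /rank e cardsU (_ : _ :&: _ = finset.set0); last first.
  apply/finset.setP => q; rewrite !inE; apply/negP => /andP[/andP[_ qi] /andP[_ /eqP e']].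
  by rewrite e' ltnn in qi.
rewrite cards0 subn0 addnC; congr (_ + _)%N.
case iA : (i \in A).
  rewrite (_ : [set q in A | q == i] = [set i]) ?cards1//.
  by apply/finset.setP => q; rewrite !inE; case: eqP => [->|_]; rewrite ?iA// andbF.
by rewrite (_ : [set q in A | q == i] = finset.set0) ?cards0//; apply/finset.setP => q;
  rewrite !inE; case: eqP => [->|_]; rewrite ?iA// andbF.
Qed.

Lemma rank_lt A i k : i \in A -> (i < k)%N -> (rank A i < rank A k)%N.
Proof.
by move=> iA ik; apply: leq_trans (rank_mono A ik); rewrite rankS iA.
Qed.

Lemma rank_lt_card A i : i \in A -> (rank A i < #|A|)%N.
Proof. by move=> iA; rewrite -(@rank_full A n)// rank_lt. Qed.

Lemma rank_sum (V : nmodType) A (phi : nat -> V) k :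
  \sum_(r in A | (r < k)%N) phi (rank A r) = \sum_(0 <= i < rank A k) phi i.
Proof.
elim: k => [|k IH].
  rewrite big1; last by move=> r; rewrite andbF.
  by rewrite (_ : rank A 0 = 0%N) ?big_geq//; apply: eq_card0 => q; rewrite inE andbF.
have [nk|kn] := leqP n k.
  rewrite !rank_full ?(leqW nk)// in IH *; rewrite -IH; apply: eq_bigl => r.
  by rewrite ltnS (leq_trans (ltnW (ltn_ord r)) nk) (leq_trans (ltn_ord r) nk).
pose i := Ordinal kn; have rk := rankS A i; rewrite /= in rk; rewrite rk.
case iA : (i \in A).
  rewrite add1n big_nat_recr//= -IH (bigD1 i)/=; last by rewrite iA ltnSn.
  rewrite addrC; congr (_ + _); apply: eq_bigl => r; rewrite ltnS leq_eqVlt.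
  have -> : (r == k :> nat) = (r == i) by [].
  by case: eqP => [->|]; rewrite ?ltnn ?andbF//= andbT.
rewrite add0n -IH; apply: eq_bigl => r; rewrite ltnS leq_eqVlt.
have -> : (r == k :> nat) = (r == i) by [].
by case: eqP => [->|]; rewrite ?iA.
Qed.

Lemma rank_sum_full (V : nmodType) A (phi : nat -> V) :
  \sum_(r in A) phi (rank A r) = \sum_(0 <= i < #|A|) phi i.
Proof.
rewrite -(@rank_full A n)// -rank_sum; apply: eq_bigl => r.
by rewrite ltn_ord andbT.
Qed.

Lemma rank_cut A k : (0 < rank A k < #|A|)%N ->
  exists a b, [/\ a \in A, b \in A, (a < k <= b)%N, (rank A a).+1 = rank A k & rank A b = rank A k].
Proof.
move=> /andP[h1 h2].
have [a0] := card_gt0P h1; rewrite inE => /andP[a0A a0k].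
have P0 : [pred q in A | (q < k)%N] a0 by rewrite /= a0A.
case: (arg_maxnP (fun r : 'I_n => r : nat) P0) => a /andP[aA ak] amax.
have [b0 b0A kb0] : exists2 b, b \in A & (k <= b)%N.
  apply/exists_inP; apply: contraTT h2 => /existsPn h; rewrite -leqNgt.
  apply: subset_leq_card; apply/fintype.subsetP => q qA; rewrite inE qA ltnNge.
  by have := h q; rewrite qA.
have P1 : [pred q in A | (k <= q)%N] b0 by rewrite /= b0A.
case: (arg_minnP (fun r : 'I_n => r : nat) P1) => b /andP[bA kb] bmin.
exists a, b; split; rewrite ?ak ?kb//.
  rewrite -add1n -[1%N]/(true : nat) -aA -rankS; apply: eq_card => q; rewrite !inE.
  apply/andP/andP => -[qA qk]; split => //; first exact: leq_trans qk ak.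
  by rewrite ltnS; apply: amax; rewrite /= qA.
apply: eq_card => q; rewrite !inE; apply/andP/andP => -[qA qk]; split => //.
  by rewrite ltnNge; apply/negP => kq; have := bmin q; rewrite /= qA kq leqNgt qk => /(_ isT).
exact: leq_trans qk kb.
Qed.

Variables (A : {set 'I_n}) (l s : nat -> R) (L S : 'I_n -> R).
Hypothesis hull : is_hull #|A| l s.
Hypothesis LE : forall r, r \in A -> L r = l (rank A r).
Hypothesis SE : forall r, r \in A -> S r = s (rank A r).

Lemma hull_mono (i j : nat) : (i <= j)%N -> (j < #|A|)%N -> s i <= s j.
Proof.
have [h _ _] := hull; elim: j => [|j IH]; first by rewrite leqn0 => /eqP ->.
rewrite leq_eqVlt => /predU1P[->//|ij] jA; apply: le_trans (IH ij (ltnW jA)) _.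
exact: h.
Qed.

Lemma hull_set_mono q r : q \in A -> r \in A -> (q <= r)%N -> S q <= S r.
Proof.
move=> qA rA qr; rewrite (SE qA) (SE rA).
by apply: hull_mono; [exact: rank_mono|exact: rank_lt_card].
Qed.

Let sums k : (\sum_(r in A | (r < k)%N) S r = \sum_(0 <= i < rank A k) s i) *
  (\sum_(r in A | (r < k)%N) L r = \sum_(0 <= i < rank A k) l i).
Proof.
split; rewrite -rank_sum; apply: eq_bigr => r /andP[rA _]; by rewrite ?SE ?LE.
Qed.

Lemma rank_le_card k : (rank A k <= #|A|)%N.
Proof. by apply: subset_leq_card; apply/fintype.subsetP => q; rewrite inE => /andP[]. Qed.

Lemma hull_set_prefix k :
  \sum_(r in A | (r < k)%N) S r <= \sum_(r in A | (r < k)%N) L r.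
Proof. by rewrite !sums; have [_ h _] := hull; apply: h; exact: rank_le_card. Qed.

Lemma hull_set_contact k :
  (forall a b : 'I_n, a \in A -> b \in A -> (a < k <= b)%N -> S a < S b) ->
  \sum_(r in A | (r < k)%N) S r = \sum_(r in A | (r < k)%N) L r.
Proof.
move=> hk; rewrite !sums; have [_ _ h] := hull; apply: h; first exact: rank_le_card.
move=> /rank_cut[a [b [aA bA akb ea eb]]].
have := hk a b aA bA akb; rewrite (SE aA) (SE bA) eb.
by rewrite -[X in s X.-1]ea.
Qed.

(** The smallest increment of the hull is a mean of increments of the sequence. *)
Lemma hull_gt c : (forall i : nat, (i < #|A|)%N -> c < l i) -> forall i : nat, (i < #|A|)%N -> c < s i.
Proof.
move=> cl i iA; apply: lt_le_trans (hull_mono (leq0n i) iA).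
have A0 : (0 < #|A|)%N by exact: leq_ltn_trans iA.
have : exists m, (0 < m)%N && ((m == #|A|) || ((m < #|A|)%N && (s m.-1 < s m))).
  by exists #|A|; rewrite A0 eqxx.
move=> /ex_minnP[m /andP[m0 hm] mmin].
have mA : (m <= #|A|)%N by case/orP: hm => [/eqP ->|/andP[/ltnW]].
have seq0 j : (j < m)%N -> s j = s 0%N.
  elim: j => // j IH jm; rewrite -IH ?(ltnW jm)//; apply/eqP; rewrite eq_le; apply/andP; split.
    rewrite leNgt; apply/negP => lt; have := mmin j.+1.
    by rewrite lt (leq_trans jm mA) orbT /= leqNgt jm => /(_ isT).
  by apply: hull_mono => //; exact: leq_trans jm mA.
have [_ _ /(_ m mA)] := hull; move=> e.
have {}e : \sum_(0 <= j < m) s j = \sum_(0 <= j < m) l j.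
  apply: e => /andP[_ mA']; case/orP: hm => [/eqP em|/andP[]//].
  by rewrite em ltnn in mA'.
have : \sum_(0 <= j < m) c < \sum_(0 <= j < m) l j.
  rewrite big_nat [ltRHS]big_nat; apply: ltr_sum.
    apply/hasP; exists 0%N; rewrite ?mem_index_iota//.
  by move=> j /andP[_ jm]; apply: cl; exact: leq_trans jm mA.
rewrite -e (@eq_big_nat _ _ _ _ _ s (fun=> s 0%N)); last by move=> j /andP[_ /seq0].
rewrite !sumr_const_nat subn0 ltr_pMn2r//.
Qed.

End Rank.

(** * Removal of waves of opposite signs *)

Lemma sum_below (R : pzRingType) (x : R) (t p : nat) :
  \sum_(0 <= i < p) (if (i < t)%N then x else 0) = x * (minn p t)%:R.
Proof.
elim: p => [|p IH]; first by rewrite big_geq// min0n mulr0.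
rewrite big_nat_recr//= IH; case: (ltnP p t) => h.
  by rewrite (minn_idPl h) -[p.+1%:R]natr1 mulrDr mulr1.
by rewrite (minn_idPr (leqW h)) addr0.
Qed.

Lemma sum_above (R : pzRingType) (x : R) (t p : nat) :
  \sum_(0 <= i < p) (if (t <= i)%N then x else 0) = x * (p - t)%:R.
Proof.
elim: p => [|p IH]; first by rewrite big_geq// sub0n mulr0.
rewrite big_nat_recr//= IH; case: (leqP t p) => h.
  by rewrite subSn// -[(p - t).+1%:R]natr1 mulrDr mulr1.
have -> : (p - t = 0)%N by apply/eqP; rewrite subn_eq0 ltnW.
have -> : (p.+1 - t = 0)%N by apply/eqP; rewrite subn_eq0.
by rewrite addr0.
Qed.

Section Cancellation.
Variables (R : realFieldType) (n : nat) (K : {set 'I_n}) (sg : 'I_n -> R).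
Implicit Types i r q : 'I_n.

Definition before k : R := \sum_(r in K | (r < k)%N) sg r.
(** The survival rule for waves K meeting at a point, in units of eps: relative to
    the state on the left of the point and in the direction of its own sign, the
    wave i occupies the unit interval starting at [sg i * before i], which must lie
    between 0 and the total. *)
Definition stays i := (0 <= sg i * before i) && (sg i * before i + 1 <= sg i * before n).

Variables (a : R) (c : nat).
Hypothesis a1 : a * a = 1.
Hypothesis sgE : forall q, q \in K -> sg q = if (q < c)%N then a else - a.

Let side q : q \in K -> (q < c)%N = (rank K q < rank K c)%N.
Proof.
move=> qK; apply/idP/idP => [/(rank_lt qK)//|h]; rewrite ltnNge; apply/negP => cq.
by move: h; rewrite ltnNge (rank_mono K cq).
Qed.

Let beforeE k : before k = a * (minn (rank K k) (rank K c))%:R - a * (rank K k - rank K c)%:R.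
Proof.
pose phi (p : nat) : R := (if (p < rank K c)%N then a else 0)
   + (if (rank K c <= p)%N then - a else 0).
rewrite /before (eq_bigr (fun q => phi (rank K q))).
  by rewrite (rank_sum K phi) big_split/= sum_below sum_above mulNr.
by move=> q /andP[qK _]; rewrite /phi sgE// side//; case: ltnP; rewrite ?addr0 ?add0r.
Qed.

Let before_left k : (rank K k <= rank K c)%N -> before k = a * (rank K k)%:R.
Proof. by move=> h; rewrite beforeE (minn_idPl h) (eqP (h : _ - _ == 0)%N) mulr0 subr0. Qed.

Let before_right k : (rank K c <= rank K k)%N -> before k = a * ((rank K c).*2%:R - (rank K k)%:R).
Proof. by move=> h; rewrite beforeE (minn_idPr h) natrB// -addnn natrD; ring. Qed.

Lemma stays_left i : i \in K -> (i < c)%N -> stays i = (rank K i + #|K| < (rank K c).*2)%N.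
Proof.
move=> iK ic; have h := ic; rewrite side// in h.
have hc : (rank K c <= rank K n)%N by rewrite (@rank_full _ _ n)// rank_le_card.
rewrite /stays sgE// ic (before_left (ltnW h)) (before_right hc) !mulrA a1 !mul1r ler0n /=.
rewrite (@rank_full _ _ n)//.
have -> : ((rank K i)%:R + 1 <= (rank K c).*2%:R - #|K|%:R :> R) = ((rank K i + #|K|).+1 <= (rank K c).*2)%N.
  by rewrite -(ler_nat R) -[(rank K i + _).+1%:R]natr1 natrD; apply/idP/idP; lra.
by [].
Qed.

Lemma stays_right i : i \in K -> (c <= i)%N -> stays i = ((rank K c).*2 <= rank K i)%N.
Proof.
move=> iK ic; have h : (rank K c <= rank K i)%N by exact: rank_mono.
have hc : (rank K c <= rank K n)%N by rewrite (@rank_full _ _ n)// rank_le_card.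
have hm := rank_lt_card iK.
rewrite /stays sgE// ltnNge ic /= (before_right h) (before_right hc) !mulrA !mulNr a1 !mul1r.
rewrite (@rank_full _ _ n)//.
have -> : (0 <= - ((rank K c).*2%:R - (rank K i)%:R) :> R) = ((rank K c).*2 <= rank K i)%N.
  by rewrite -(ler_nat R); apply/idP/idP; lra.
have -> : - ((rank K c).*2%:R - (rank K i)%:R) + 1 <= - ((rank K c).*2%:R - #|K|%:R) :> R.
  by move: hm; rewrite -(ler_nat R) -[(rank K i).+1%:R]natr1; lra.
by rewrite andbT.
Qed.

(** As many waves are removed on the left as on the right, and a survivor has
    either all of the removed waves on its left or none of them. *)
Lemma stays_before k : (n <= k)%N \/ (exists i, [/\ i \in K, stays i & k = i]) ->
  \sum_(r in K | stays r && (r < k)%N) sg r = before k.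
Proof.
move=> hk; set l := rank K c; set m := #|K|.
have hl : (l <= m)%N by exact: rank_le_card.
have hkm : (rank K k <= m)%N by exact: rank_le_card.
pose phi p : R := if (p < l)%N then (if (p + m < l.*2)%N then a else 0)
  else (if (l.*2 <= p)%N then - a else 0).
have -> : \sum_(r in K | stays r && (r < k)%N) sg r = \sum_(r in K | (r < k)%N) phi (rank K r).
  under eq_bigl => r do rewrite [stays r && _]andbC andbA.
  rewrite big_mkcondr/=; apply: eq_bigr => r /andP[rK _].
  rewrite /phi -(side rK) sgE//; case: (ltnP r c) => rc; first by rewrite stays_left.
  by rewrite stays_right.
rewrite (rank_sum K phi).
have [lm|lm] := leqP m l.*2.
  (* the left side wins: its first 2 l - m waves stay *)
  have -> : \sum_(0 <= p < rank K k) phi p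
    = \sum_(0 <= p < rank K k) (if (p < l.*2 - m)%N then a else 0).
    rewrite !big_nat; apply: eq_bigr => p /= pk; rewrite /phi.
    have [pl|pl] := ltnP p l; first by rewrite ltn_subRL addnC.
    have -> : (l.*2 <= p)%N = false by lia.
    by have -> : (p < l.*2 - m)%N = false by lia.
  rewrite sum_below; case: hk => [nk|[i [iK si ek]]].
    have e : rank K k = m by exact: rank_full.
    rewrite before_right -/l e// -natrB//; congr (_ * _%:R); lia.
  have ic : (i < c)%N.
    rewrite ltnNge; apply/negP => ci; move: si; rewrite stays_right// -/l.
    by have := rank_lt_card iK; rewrite -/m; lia.
  move: si; rewrite stays_left// -/l -/m => si.
  rewrite ek before_left; last by rewrite rank_mono// ltnW.
  by congr (_ * _%:R); lia.
(* the right side wins: its waves of rank at least 2 l stay *)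
have -> : \sum_(0 <= p < rank K k) phi p
    = \sum_(0 <= p < rank K k) (if (l.*2 <= p)%N then - a else 0).
  rewrite !big_nat; apply: eq_bigr => p /= pk; rewrite /phi.
  have [pl|pl] := ltnP p l; last by [].
  have -> : (l.*2 <= p)%N = false by lia.
  by have -> : (p + m < l.*2)%N = false by lia.
have h2 : (l.*2 <= rank K k)%N.
  case: hk => [nk|[i [iK si ek]]].
    by rewrite (rank_full _ nk) ltnW.
  have ic : (c <= i)%N.
    rewrite leqNgt; apply/negP => ci; move: si; rewrite stays_left// -/l -/m; lia.
  by move: si; rewrite stays_right// ek.
rewrite sum_above before_right -/l; last lia.
by rewrite natrB//; ring.
Qed.

Lemma stays_opposite i r : i \in K -> r \in K -> sg i != sg r -> ~~ (stays i && stays r).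
Proof.
wlog ir : i r / (i < c <= r)%N => [H|].
  move=> iK rK; have [ic|ci] := ltnP i c; have [rc|cr] := ltnP r c.
  - by rewrite !sgE// ic rc eqxx.
  - by apply: H => //; rewrite ic.
  - by rewrite eq_sym andbC; apply: H => //; rewrite rc.
  - by rewrite !sgE// !ltnNge ci cr eqxx.
move: ir => /andP[ic cr] iK rK _; rewrite stays_left// stays_right//.
by apply/negP => /andP[h1 h2]; have := rank_lt_card rK; lia.
Qed.

Lemma stays_left_closed s s' : s \in K -> s' \in K -> (s < s')%N ->
  (s' < c)%N -> stays s' -> stays s.
Proof.
move=> sK sK' ss' s'c; rewrite !stays_left ?(ltn_trans ss')//.
have := rank_mono K (ltnW ss'); lia.
Qed.

Lemma stays_right_closed r r' : r \in K -> r' \in K -> (r < r')%N ->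
  (c <= r)%N -> stays r -> stays r'.
Proof.
move=> rK rK' rr' cr; rewrite !stays_right ?(leq_trans cr (ltnW rr'))//.
have := rank_mono K (ltnW rr'); lia.
Qed.

End Cancellation.

(** * Step functions and their variation *)

Section StepFunctions.
Local Open Scope classical_set_scope.
Local Open Scope ring_scope.
Variable R : realType.
Implicit Types (s : seq R) (g : R -> R) (x y z : R).

Lemma left_lim_const g z x c : z < x -> (forall y, z < y < x -> g y = c) -> left_lim g x = c.
Proof.
move=> zx gc; apply: cvg_lim => //; apply: cvg_near_cst.
near=> y; apply: gc; apply/andP; split.
  by near: y; exact: nbhs_left_gt.
by near: y; exact: nbhs_left_lt.
Unshelve. all: by end_near. Qed.

Lemma gap_left s x b : b < x -> exists2 z, b <= z < x & forall a, a \in s -> a < x -> a <= z.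
Proof.
move=> bx; elim: s => [|a s [z /andP[bz zx] hz]]; first by exists b; rewrite // lexx.
have [ax|xa] := ltP a x; last first.
  exists z; first by rewrite bz.
  move=> c; rewrite in_cons => /predU1P[->|cs cx]; last exact: hz.
  by rewrite ltNge xa.
exists (Num.max a z); first by rewrite le_max bz orbT gt_max ax.
move=> c; rewrite in_cons => /predU1P[->|cs cx]; first by rewrite le_max lexx.
by rewrite le_max hz// orbT.
Qed.

Lemma left_lim_sum (I : eqType) (r : seq I) (P : pred I) (a c : I -> R) x :
  left_lim (fun z => \sum_(i <- r | P i && (a i <= z)) c i) x
  = \sum_(i <- r | P i && (a i < x)) c i.
Proof.
have x1 : x - 1 < x by rewrite ltrBlDr ltrDl.
have [z /andP[_ zx] hz] := gap_left (map a r) x1.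
apply: (left_lim_const zx) => y /andP[zy yx]; rewrite big_seq_cond [RHS]big_seq_cond.
apply: eq_bigl => i; case ir : (i \in r) => //=; congr (_ && _); apply/idP/idP => [h|h].
  exact: le_lt_trans yx.
by apply: le_trans (ltW zy); apply: hz => //; exact: map_f.
Qed.

(** A right-continuous step function with jumps in s, vanishing near -oo. *)
Definition step_like s g :=
  (forall x y, x <= y -> (forall a, a \in s -> x < a -> y < a) -> g x = g y) /\
  (exists m, forall x, x <= m -> g x = 0).

Lemma step_left s g z x : step_like s g -> z < x ->
  (forall a, a \in s -> a < x -> a <= z) -> left_lim g x = g z.
Proof.
move=> [gs _] zx hz; apply: (left_lim_const zx) => y /andP[zy yx]; apply/esym/gs; first exact: ltW.
move=> a sa za; rewrite ltNge; apply/negP => ay.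
by have := hz a sa (le_lt_trans ay yx); rewrite leNgt za.
Qed.

Lemma step_jump s g x : step_like s g -> x \notin s -> left_lim g x = g x.
Proof.
move=> hg xs; have x1 : x - 1 < x by rewrite ltrBlDr ltrDl.
have [z /andP[_ zx] hz] := gap_left s x1.
rewrite (step_left hg zx hz); apply: hg.1; first exact: ltW.
move=> a sa za; rewrite lt_neqAle; apply/andP; split.
  by apply: contraNneq xs => ->.
rewrite leNgt; apply/negP => ax.
by have := hz a sa ax; rewrite leNgt za.
Qed.

Lemma seq_max (t : seq R) : t != [::] -> exists2 b, b \in t & forall a, a \in t -> a <= b.
Proof.
elim: t => // a [|c t] IH _.
  by exists a; rewrite ?mem_head// => y; rewrite inE => /eqP ->.
have [//|b bt hb] := IH; exists (Num.max a b).
  by rewrite /Num.max; case: ifP => _; rewrite in_cons ?bt ?orbT ?eqxx.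
by move=> y; rewrite in_cons => /predU1P[->|/hb yb]; rewrite le_max ?lexx ?yb ?orbT.
Qed.

Lemma step_sum s g x : step_like s g ->
  \sum_(y <- undup s | y <= x) (g y - left_lim g y) = g x.
Proof.
move=> hg; pose cnt x := size [seq y <- undup s | y <= x].
have [k] := ubnP (cnt x); elim: k x => // k IH x; rewrite ltnS => hk.
have [h0|/seq_max[b]] := eqVneq [seq y <- undup s | y <= x] [::].
  have h y : y \in s -> x < y.
    move=> ys; rewrite ltNge; apply/negP => yx.
    have : y \in [seq y <- undup s | y <= x] by rewrite mem_filter yx mem_undup.
    by rewrite h0.
  rewrite -big_filter h0 big_nil; have [m hm] := hg.2.
  have [xm|mx] := leP x m; first by rewrite hm.
  rewrite -(hm m (lexx _)); apply: hg.1; first exact: ltW.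
  by move=> a /h.
rewrite mem_filter mem_undup => /andP[bx bs] bmax.
have {}bmax a : a \in s -> a <= x -> a <= b.
  by move=> sa ax; apply: bmax; rewrite mem_filter ax mem_undup.
have b1 : b - 1 < b by rewrite ltrBlDr ltrDl.
have [z /andP[_ zb] hz] := gap_left s b1.
have cntz : (cnt z < k)%N.
  apply: leq_trans hk; rewrite /cnt !size_filter.
  have eqc y : y <= z -> y <= x by move=> yz; exact: le_trans yz (le_trans (ltW zb) bx).
  have bu : b \in undup s by rewrite mem_undup.
  rewrite (permP (perm_to_rem bu)) [X in (_ < X)%N](permP (perm_to_rem bu)) /=.
  rewrite bx leNgt zb /= add1n ltnS; exact: sub_count.
rewrite big_mkcond (bigD1_seq b) ?mem_undup ?undup_uniq//= bx -big_mkcondr.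
have -> : \sum_(y <- undup s | (y != b) && (y <= x)) (g y - left_lim g y) = g z.
  rewrite -(IH z cntz) big_seq_cond [RHS]big_seq_cond; apply: eq_bigl => y.
  case ys : (y \in undup s) => //=; rewrite mem_undup in ys; apply/andP/idP => [[yb yx]|yz].
    by apply: hz => //; rewrite lt_neqAle yb bmax.
  split; last by apply: le_trans yz (le_trans (ltW zb) bx).
  by apply: contraTneq yz => ->; rewrite -ltNge.
rewrite (step_left hg zb hz) subrK; apply: hg.1 => // a sa ba.
by rewrite ltNge; apply/negP => /(bmax a sa); rewrite leNgt ba.
Qed.

Lemma step_fsbig s g (D : set R) x : step_like s g -> finite_set D ->
  (forall y, left_lim g y != g y -> D y) ->
  \sum_(y \in D) (if y <= x then g y - left_lim g y else 0) = g x.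
Proof.
move=> hg Df hD; rewrite -(step_sum x hg).
set F := fun y => if y <= x then _ else _.
have uf : finite_set [set` undup s] by exact: finite_seq.
have -> : \sum_(y \in D) F y = \sum_(y \in D `|` [set` undup s]) F y.
  apply: fsbig_widen; first by move=> y; left.
  move=> y [_ ny] /=; rewrite /F; case: ifP => // _.
  have [->|/hD//] := eqVneq (left_lim g y) (g y); by rewrite subrr.
have -> : \sum_(y \in D `|` [set` undup s]) F y = \sum_(y \in [set` undup s]) F y.
  apply/esym/fsbig_widen; first by move=> y; right.
  move=> y [_ /= ys]; rewrite /F; case: ifP => // _.
  by rewrite (step_jump hg) ?subrr//; move/negP: ys; rewrite mem_undup.
by rewrite -fsbig_seq ?undup_uniq// [RHS]big_mkcond.
Qed.

Lemma exists_jump s g a b : step_like s g -> a <= b -> g a != g b ->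
  exists2 y, a < y <= b & left_lim g y != g y.
Proof.
move=> hg ab; have [/hasP[y _ /andP[h1 h2]] _|/hasPn h] :=
    boolP (has (fun y => (a < y <= b) && (left_lim g y != g y)) (undup s)); first by exists y.
move=> /negP[]; rewrite -(step_sum a hg) -(step_sum b hg); apply/eqP.
rewrite big_mkcond [RHS]big_mkcond; apply: eq_big_seq => y ys.
have [ya|ay] := leP y a; first by rewrite (le_trans ya ab).
case: ifP => // yb; have := h y ys; rewrite ay yb /= negbK => /eqP ->.
by rewrite subrr.
Qed.

Lemma step_translate s g d : step_like s g ->
  step_like [seq a - d | a <- s] (fun x => g (x + d)).
Proof.
move=> [h [m hm]]; split.
  move=> x y xy ha; apply: h; first by rewrite lerD2r.
  move=> a sa xa; have := ha (a - d) (map_f _ sa); rewrite ltrBrDr => /(_ xa).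
  by rewrite ltrBrDr.
by exists (m - d) => x; rewrite lerBrDr; exact: hm.
Qed.

Lemma admissible_step eps g : admissible_datum eps g -> exists s, step_like s g.
Proof.
move=> [rc [A /finite_seqP[F AF] hA] cs _]; exists F; split; last first.
  have /compact_bounded [M [_ hM]] := cs.
  exists (- (`|M| + 1 + 1)) => x xM; apply/eqP/negPn/negP => gx.
  have MM : M < `|M| + 1 by apply: le_lt_trans (ler_norm M) _; rewrite ltrDl.
  have := hM _ MM x; have cx : closure [set x | g x != 0] x by apply: subset_closure.
  move=> /(_ cx) xM'; have {}xM' : `|x| <= `|M| + 1 := xM'.
  by have := ler_norm (- x); rewrite normrN; lra.
move=> x y; rewrite le_eqVlt => /predU1P[->//|xy] ha.
have gz z : x < z <= y -> g z = g y.
  move=> /andP[xz zy]; apply: hA => //; apply/seteqP; split => // a [/=].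
  rewrite in_itv /= => /andP[za ay]; rewrite AF /= => aF.
  by have := ha a aF (lt_le_trans xz za); rewrite ltNge ay.
have := rc x; have /cvg_lim e : g @ x^'+ --> g y.
  apply: cvg_near_cst; near=> z; apply: gz; apply/andP; split.
    by near: z; exact: nbhs_right_gt.
  by near: z; exact: nbhs_right_le.
by move=> /cvg_lim e'; rewrite -e// e'.
Unshelve. all: by end_near. Qed.

Lemma total_variation_const g p q : p <= q -> (forall x, p <= x <= q -> g x = g p) ->
  total_variation p q g = 0%E.
Proof.
move=> pq gc; rewrite nondecreasing_total_variation//.
  by rewrite (gc q) ?subrr// pq lexx.
by move=> x y; rewrite !in_itv /= => hx hy _; rewrite !gc.
Qed.

Lemma total_variation_jump g z y : z < y -> (forall x, z <= x < y -> g x = g z) ->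
  total_variation z y g = `|g y - g z|%:E.
Proof.
move=> zy gc; wlog h : g gc / g z <= g y => [hw|].
  have [h|h] := leP (g z) (g y); first exact: hw.
  rewrite -total_variationN hw /=.
  - by rewrite -opprD normrN.
  - by move=> x /gc ->.
  - by rewrite lerN2 ltW.
rewrite nondecreasing_total_variation ?(ltW zy)// ?ger0_norm ?subr_ge0//.
move=> a b; rewrite !in_itv /= => /andP[za ay] /andP[zb yb] ab.
have [ay'|ya] := ltP a y; last first.
  have -> : a = b by apply/eqP; rewrite eq_le ab (le_trans yb ya).
  by [].
rewrite (gc a) ?za//; have [yb'|yb'] := ltP b y; first by rewrite gc// zb.
by have -> : b = y by apply/eqP; rewrite eq_le yb yb'.
Qed.

Section Variation.
Variables (s : seq R) (g : R -> R).
Hypothesis hg : step_like s g.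
Hypothesis fin : (tot_var setT g < +oo)%E.

Lemma total_variation_lty p q : p <= q -> (total_variation p q g < +oo)%E.
Proof.
move=> pq; apply: le_lt_trans fin; apply: ereal_sup_ubound; exists (p, q) => //=; split => //.
Qed.

Lemma total_variation_fin p q : p <= q -> total_variation p q g \is a fin_num.
Proof. by move=> pq; rewrite ge0_fin_numE ?total_variation_lty// total_variation_ge0. Qed.

Lemma cum_varE p x : p <= x -> (forall z, z <= p -> g z = 0) ->
  tot_var `]-oo, x]%classic g = total_variation p x g.
Proof.
move=> px g0; apply/eqP; rewrite eq_le; apply/andP; split; last first.
  apply: ereal_sup_ubound; exists (p, x) => //=; split => // z.
  by rewrite /= !in_itv /= => /andP[].
apply: ub_ereal_sup => _ [[q r] /= [qr sub] <-].
have rx : r <= x by have := sub r; rewrite /= !in_itv /= qr lexx => /(_ isT).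
pose b := Num.min q p.
have bq : b <= q by rewrite ge_min lexx.
have bp : b <= p by rewrite ge_min lexx orbT.
have -> : total_variation p x g = total_variation b x g.
  have e : total_variation b p g = 0%E.
    by apply: total_variation_const => // z /andP[_ zp]; rewrite !g0.
  by rewrite (total_variationD _ bp px) e add0e.
rewrite (total_variationD _ bq (le_trans qr rx)) (total_variationD _ qr rx).
apply: le_trans (leeDr _ _); last exact: total_variation_ge0.
by rewrite leeDl// total_variation_ge0.
Qed.

Lemma cum_var_fine p x : p <= x -> (forall z, z <= p -> g z = 0) ->
  cum_var g x = fine (total_variation p x g).
Proof. by move=> px g0; rewrite /cum_var (cum_varE px g0). Qed.

Lemma cum_varD x y : x <= y -> cum_var g y = cum_var g x + fine (total_variation x y g).
Proof.
move=> xy; have [m hm] := hg.2; pose p := Num.min m x.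
have px : p <= x by rewrite ge_min lexx orbT.
have g0 z : z <= p -> g z = 0 by move=> zp; apply: hm; apply: le_trans zp _; rewrite ge_min lexx.
rewrite !(@cum_var_fine p)// ?(le_trans px)// (total_variationD _ px xy) fineD//;
  exact: total_variation_fin.
Qed.

Lemma cum_var_dist x y : x <= y -> `|g x - g y| <= cum_var g y - cum_var g x.
Proof.
move=> xy; rewrite (cum_varD xy) addrAC subrr add0r distrC -lee_fin fineK ?total_variation_fin//.
exact: total_variation_ge.
Qed.

Lemma cum_var_mono x y : x <= y -> cum_var g x <= cum_var g y.
Proof. by move=> /cum_var_dist h; rewrite -subr_ge0; apply: le_trans h. Qed.

Lemma cum_var_ge0 x : 0 <= cum_var g x.
Proof.
have [m hm] := hg.2; pose p := Num.min m x.
have px : p <= x by rewrite ge_min lexx orbT.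
rewrite (@cum_var_fine p)// ?fine_ge0 ?total_variation_ge0// => z zp.
by apply: hm; apply: le_trans zp _; rewrite ge_min lexx.
Qed.

Lemma cum_var_step : step_like s (cum_var g).
Proof.
split.
  move=> x y xy ha; rewrite [RHS](cum_varD xy) total_variation_const ?addr0// => z /andP[xz zy].
  by apply/esym/hg.1 => // a sa xa; exact: le_lt_trans zy (ha a sa xa).
have [m hm] := hg.2; exists m => x xm.
rewrite (@cum_var_fine x)// ?total_variationxx//.
by move=> z zx; apply: hm; exact: le_trans xm.
Qed.

Lemma cum_var_jump y : cum_var g y - left_lim (cum_var g) y = `|g y - left_lim g y|.
Proof.
have y1 : y - 1 < y by rewrite ltrBlDr ltrDl.
have [z /andP[_ zy] hz] := gap_left s y1.
rewrite (step_left cum_var_step zy hz) (step_left hg zy hz).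
rewrite (cum_varD (ltW zy)) addrAC subrr add0r total_variation_jump// => x /andP[zx xy].
apply/esym/hg.1 => // a sa za; rewrite ltNge; apply/negP => ax.
by have := hz a sa (le_lt_trans ax xy); rewrite leNgt za.
Qed.

Lemma cum_var_le_TV x : cum_var g x <= TV g.
Proof.
have [m hm] := hg.2; pose p := Num.min m x.
have px : p <= x by rewrite ge_min lexx orbT.
rewrite (@cum_var_fine p)//; last first.
  by move=> z zp; apply: hm; apply: le_trans zp _; rewrite ge_min lexx.
have tf : tot_var setT g \is a fin_num.
  rewrite ge0_fin_numE//; apply: le_trans (total_variation_ge0 g px) _.
  by apply: ereal_sup_ubound; exists (p, x) => //=; split => //.
rewrite /TV fine_le ?total_variation_fin//.
by apply: ereal_sup_ubound; exists (p, x) => //=; split => //.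
Qed.

Lemma cum_var_TV : exists x, cum_var g x = TV g.
Proof.
have [m hm] := hg.2.
have [x [mx hx]] : exists x, m <= x /\ forall a, a \in s -> a <= x.
  have [s0|/seq_max[b bs hb]] := eqVneq s [::].
    by exists m; split => // a; rewrite s0.
  exists (Num.max m b); split; first by rewrite le_max lexx.
  by move=> a /hb ab; rewrite le_max ab orbT.
exists x; rewrite (@cum_var_fine m)//; congr fine; apply/eqP; rewrite eq_le; apply/andP; split.
  by apply: ereal_sup_ubound; exists (m, x) => //=; split => //.
apply: ub_ereal_sup => _ [[q r] /= [qr _] <-].
pose b := Num.min q m; pose c := Num.max r x.
have bq : b <= q by rewrite ge_min lexx.
have bm : b <= m by rewrite ge_min lexx orbT.
have rc : r <= c by rewrite le_max lexx.
have xc : x <= c by rewrite le_max lexx orbT.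
have e1 : total_variation b m g = 0%E.
  by apply: total_variation_const => // z /andP[_ zm]; rewrite !hm.
have e2 : total_variation x c g = 0%E.
  apply: total_variation_const => // z /andP[xz zc]; apply/esym/hg.1 => // a sa xa.
  by have := hx a sa; rewrite leNgt xa.
have -> : total_variation m x g = total_variation b c g.
  rewrite (total_variationD _ bm (le_trans mx xc)) e1 add0e.
  by rewrite (total_variationD _ mx xc) e2 adde0.
rewrite (total_variationD _ bq (le_trans qr rc)) (total_variationD _ qr rc).
apply: le_trans (leeDr _ _); last exact: total_variation_ge0.
by rewrite leeDl// total_variation_ge0.
Qed.

End Variation.
End StepFunctions.

(** * The initial waves *)

Section Waves.
Local Open Scope classical_set_scope.
Local Open Scope ring_scope.
Variables (R : realType) (eps : R) (g : R -> R) (s : seq R).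
Hypothesis eps_gt0 : 0 < eps.
Hypothesis hg : step_like s g.
Hypothesis fin : (tot_var setT g < +oo)%E.
Hypothesis latt : forall x, in_lattice eps (g x).

Let W := cum_var g.
Let hW : step_like s W := cum_var_step hg fin.

Lemma left_lim_value x b : b < x -> exists2 z, b <= z < x &
  left_lim g x = g z /\ left_lim W x = W z.
Proof.
move=> bx; have [z hz1 hz] := gap_left s bx; exists z => //.
have [_ zx] := andP hz1.
by split; [exact: step_left hg zx hz|exact: step_left hW zx hz].
Qed.

Lemma sub1_lt (x : R) : x - 1 < x. Proof. by rewrite ltrBlDr ltrDl. Qed.

Lemma cum_var_lattice x : exists k : nat, W x = k%:R * eps.
Proof.
rewrite -(step_sum x hW); elim/big_ind: _ => [|a b [k ->] [l ->]|y _].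
- by exists 0%N; rewrite mul0r.
- by exists (k + l)%N; rewrite natrD mulrDl.
have [z _ [hz _]] := left_lim_value (sub1_lt y).
rewrite (cum_var_jump hg fin) hz.
have [m1 ->] := latt y; have [m2 ->] := latt z.
exists `|m1 - m2|%N; rewrite -mulrBl -intrB normrM (gtr0_norm eps_gt0); congr (_ * _).
by rewrite -intr_norm -abszE.
Qed.

Lemma TV_lattice : exists n : nat, TV g = n%:R * eps.
Proof. by have [x <-] := cum_var_TV hg; exact: cum_var_lattice. Qed.

Variable n : nat.
Hypothesis TVn : TV g = n%:R * eps.

Lemma wavesE k : waves eps g k <-> (0 < k <= n)%N.
Proof.
rewrite /waves /= TVn mulrCA mulVf ?gt_eqF// mulr1 ler_nat.
by split=> [[-> ->]|/andP[]].
Qed.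

Lemma wave_startP k x : (0 < k <= n)%N ->
  (wave_start eps g k <= x) = (eps * k%:R <= W x).
Proof.
move=> /andP[k0 kn]; set D := [set x | eps * k%:R <= cum_var g x].
have D0 : D !=set0.
  by have [z hz] := cum_var_TV hg; exists z; rewrite /D /= hz TVn mulrC ler_pM2r// ler_nat.
have [m hm] := hW.2.
have lb : lbound D m.
  move=> z zD; rewrite leNgt; apply/negP => zm.
  move: zD; rewrite /D /= -/(W z) hm ?(ltW zm)// pmulr_rle0// lern0; lia.
have hl : has_lbound D by exists m.
have inD : D (wave_start eps g k).
  rewrite /D /= -/(W _) leNgt; apply/negP => lt.
  set y := wave_start eps g k in lt.
  have [y' yy' hy'] : exists2 y', y < y' & forall a, a \in s -> y < a -> y' < a.
    have hn : - (y + 1) < - y by rewrite ltrN2 ltrDl.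
    have [z /andP[_ zy] hz] := gap_left (map -%R s) hn.
    exists ((y - z) / 2); first by lra.
    move=> a sa ya; have := hz (- a) (map_f _ sa); rewrite ltrN2 => /(_ ya); lra.
  have e : W y = W y' by apply: hW.1 => //; exact: ltW.
  have : y' <= y.
    apply: lb_le_inf => // z zD; rewrite leNgt; apply/negP => zy'.
    have := cum_var_mono hg fin (ltW zy'); move: zD; rewrite /D /= -/(W z) -/(W y') -e.
    by move=> h1 h2; have := lt_le_trans lt (le_trans h1 h2); rewrite ltxx.
  by rewrite leNgt yy'.
apply/idP/idP => [h|h]; last exact: ge_inf.
by apply: le_trans inD _; exact: (cum_var_mono hg fin).
Qed.

Lemma wave_start_mono k l : (0 < k)%N -> (k <= l <= n)%N -> wave_start eps g k <= wave_start eps g l.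
Proof.
move=> k0 /andP[kl ln]; rewrite wave_startP ?k0 ?(leq_trans kl)//.
have : eps * l%:R <= W (wave_start eps g l) by rewrite -wave_startP ?(leq_trans k0 kl)//= .
by apply: le_trans; rewrite ler_pM2l// ler_nat.
Qed.

Lemma wave_start_jump k : (0 < k <= n)%N ->
  left_lim W (wave_start eps g k) < eps * k%:R <= W (wave_start eps g k).
Proof.
move=> hk; rewrite -wave_startP// lexx andbT.
have [z /andP[_ zy] [_ ->]] := left_lim_value (sub1_lt (wave_start eps g k)).
by rewrite ltNge -wave_startP// -ltNge.
Qed.

Lemma wave_sign_norm k : (0 < k <= n)%N -> wave_sign eps g k = 1 \/ wave_sign eps g k = -1.
Proof.
move=> hk; have := cum_var_jump hg fin (wave_start eps g k).
have /andP[h1 h2] := wave_start_jump hk; move: h1 h2; rewrite /wave_sign -/W.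
set d := g _ - _ => h1 h2 e; have : 0 < `|d| by rewrite -e; lra.
by rewrite normr_gt0; case: sgrP => // _ _; [left|right].
Qed.

Lemma wave_sign_jump k : let y := wave_start eps g k in
  wave_sign eps g k * (W y - left_lim W y) = g y - left_lim g y.
Proof. by rewrite /= /wave_sign (cum_var_jump hg fin) -numEsg. Qed.

Lemma datum_eq x y : x <= y -> W x = W y -> g x = g y.
Proof.
move=> xy e; have := cum_var_dist hg fin xy; rewrite -/W e subrr normr_le0 subr_eq0.
by move/eqP.
Qed.

Lemma datum_eq0 x : W x = 0 -> g x = 0.
Proof.
move=> W0; have [m hm] := hg.2; have [xm|mx] := leP x m; first exact: hm.
rewrite -(hm m (lexx _)); apply/esym/datum_eq; first exact: ltW.
apply/eqP; rewrite W0 eq_le (cum_var_ge0 hg)// andbT.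
by rewrite -W0; apply: (cum_var_mono hg fin) => //; exact: ltW.
Qed.

Lemma wave_state_full k : (0 < k <= n)%N -> W (wave_start eps g k) = eps * k%:R ->
  wave_state eps g k = g (wave_start eps g k).
Proof.
move=> hk e; rewrite /wave_state -/W -e wave_sign_jump; ring.
Qed.

Lemma lattice_between (c d : nat) (x : R) : W x < eps * c.+1%:R -> eps * c%:R <= W x -> W x = eps * c%:R.
Proof.
have [l ->] := cum_var_lattice x; rewrite mulrC ltr_pM2l// ler_pM2l// ltr_nat ler_nat ltnS => h1 h2.
by rewrite (@anti_leq l c) ?h1.
Qed.

(** The waves enumerate the variation of the datum from left to right, so the sums
    of their signs follow its graph. *)
Lemma wave_chain k : (0 < k <= n)%N ->
  eps * \sum_(r < k) wave_sign eps g r.+1 = wave_state eps g k.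
Proof.
elim: k => // k IH /andP[_ kn].
set y := wave_start eps g k.+1.
have hk1 : (0 < k.+1 <= n)%N by [].
have /andP[j1 j2] := wave_start_jump hk1.
rewrite big_ord_recr/= mulrDr.
have step c : left_lim g y = c -> left_lim W y = eps * k%:R ->
    c + eps * wave_sign eps g k.+1 = wave_state eps g k.+1.
  move=> e1 e2; rewrite /wave_state -/y -/W e1 e2 -natr1; ring.
case: k => [|k] in IH kn y hk1 j1 j2 step *.
  rewrite big_ord0 mulr0; have [z /andP[_ zy] [e1 e2]] := left_lim_value (sub1_lt y).
  have W0 : W z = 0.
    rewrite (@lattice_between 0 0)// ?mulr0//; first by rewrite -e2.
    by exact: (cum_var_ge0 hg).
  by apply: step; rewrite ?e1 ?e2 ?datum_eq0// W0 mulr0.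
have hk : (0 < k.+1 <= n)%N by exact: ltnW.
rewrite IH//; set x := wave_start eps g k.+1.
have xy : x <= y by apply: wave_start_mono; rewrite ?leqnSn.
move: xy; rewrite le_eqVlt => /predU1P[exy|xy].
  rewrite /wave_state /wave_sign -/x -/y exy -[k.+2%:R]natr1; ring.
have Wz z : x <= z -> z < y -> W z = eps * k.+1%:R.
  move=> xz zy; apply: lattice_between => //.
    by rewrite ltNge -wave_startP// -ltNge.
  by rewrite -wave_startP.
rewrite wave_state_full//; last exact: Wz.
have [z /andP[xz zy] [e1 e2]] := left_lim_value xy.
apply: step; last by rewrite e2 Wz.
by rewrite e1; apply/esym/datum_eq => //; rewrite !Wz.
Qed.

Lemma datum_waves x :
  g x = eps * \sum_(r < n | wave_start eps g r.+1 <= x) wave_sign eps g r.+1.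
Proof.
have [k Wx] := cum_var_lattice x.
have kn : (k <= n)%N.
  by have := cum_var_le_TV hg fin x; rewrite TVn -/W Wx ler_pM2r// ler_nat.
have -> : \sum_(r < n | wave_start eps g r.+1 <= x) wave_sign eps g r.+1
   = \sum_(r < k) wave_sign eps g r.+1.
  rewrite (big_ord_widen _ (fun r => wave_sign eps g r.+1) kn); apply: eq_bigl => r.
  by rewrite wave_startP ?ltn_ord// Wx mulrC ler_pM2r// ler_nat.
case: k => [|k] in Wx kn *.
  by rewrite big_ord0 mulr0; apply: datum_eq0; rewrite Wx mul0r.
have hk : (0 < k.+1 <= n)%N by [].
rewrite wave_chain//; set y := wave_start eps g k.+1.
have yx : y <= x by rewrite wave_startP// Wx mulrC.
have Wy : W y = W x.
  apply/eqP; rewrite eq_le (cum_var_mono hg fin)//= Wx mulrC.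
  by have /andP[] := wave_start_jump hk.
rewrite wave_state_full//; first exact/esym/datum_eq.
by rewrite -/y Wy Wx mulrC.
Qed.

Lemma wave_state_range (I : interval R) k : (0 < k <= n)%N -> (forall x, g x \in I) ->
  wave_state eps g k \in I /\ wave_state eps g k - wave_sign eps g k * eps \in I.
Proof.
move=> hk gI; set y := wave_start eps g k.
have [z _ [e1 e2]] := left_lim_value (sub1_lt y).
have /andP[j1 j2] := wave_start_jump hk; rewrite -/y in j1 j2.
have sJ := wave_sign_jump k; rewrite /= -/y in sJ.
have j3 : left_lim W y <= eps * k%:R - eps.
  have [l Wl] := cum_var_lattice z; move: j1; rewrite e2 Wl.
  case: k hk {y j2 sJ e1 e2} => // k hk; rewrite mulrC ltr_pM2l// ltr_nat ltnS => lk.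
  by rewrite -natr1 mulrDr mulr1 addrK ler_pM2l// ler_nat.
have key t : 0 <= t <= W y - left_lim W y -> left_lim g y + wave_sign eps g k * t \in I.
  move=> /andP[t0 t1].
  have gz : g z \in I := gI z; have gy : g y \in I := gI y.
  have [sg|sg] := wave_sign_norm hk; rewrite sg in sJ *; rewrite e1 in sJ *.
    apply: (interval_is_interval gz gy); lra.
  apply: (interval_is_interval gy gz); lra.
rewrite /wave_state -/y -/W; split; first by apply: key; lra.
have -> : left_lim g y + wave_sign eps g k * (eps * k%:R - left_lim W y) - wave_sign eps g k * eps
  = left_lim g y + wave_sign eps g k * (eps * k%:R - eps - left_lim W y) by ring.
by apply: key; move: (eps_gt0); lra.
Qed.

End Waves.

(** * The waves at a node *)

Lemma cells_node (R : realType) (eps : R) (a : int) (k : nat) : 0 < eps ->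
  cells eps (node eps a 0) (node eps a k) = [set m | a <= m < a + k%:Z]%classic.
Proof.
move=> e0; have h : node eps a 0 <= node eps a k by exact: node_mono.
by apply/seteqP; split=> m; rewrite /cells /= (min_l h) (max_r h) /node addr0;
  rewrite !ler_pM2r// !ler_int; lia.
Qed.

Lemma cellsC (R : realType) (eps a b : R) : cells eps a b = cells eps b a.
Proof. by rewrite /cells minC maxC. Qed.

Lemma cells_refl (R : realType) (eps a : R) : 0 < eps -> cells eps a a = classical_sets.set0.
Proof.
move=> e0; rewrite -subset0 => m [/=]; rewrite minxx maxxx => h1 h2.
by have := le_trans h2 h1; rewrite ler_pM2r// ler_int; lia.
Qed.

Lemma sum_cells (R : realType) (V : nmodType) (eps : R) (a : int) (k : nat) (F : int -> V) : 0 < eps ->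
  (\sum_(m \in cells eps (node eps a 0) (node eps a k)) F m = \sum_(0 <= i < k) F (a + i%:Z))%classic.
Proof.
move=> e0; rewrite cells_node//.
rewrite (@reindex_fsbig _ _ _ _ _ (fun i : nat => a + i%:Z) `I_k%classic).
  by rewrite -fsbig_ord big_mkord.
split=> [i /= ik|i j _ _ /addrI [->]//|m /= hm]; first lia.
by exists `|m - a|%N => /=; lia.
Qed.

(** These three are sealed so that comparing two waves never unfolds the recursion
    over the nodes. *)
HB.lock Definition real_position (R : realType) (eps : R) f wbe tc xc w v j s : R :=
  fine (node_position eps f wbe tc xc w v j s).

HB.lock Definition real_speed (R : realType) (eps : R) f wbe tc xc w v j s : R :=
  fine (speed_at eps f wbe (w (tc j)) (v (tc j)) s (node_position eps f wbe tc xc w v j s)).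

HB.lock Definition finite_position (R : realType) (eps : R) f wbe tc xc w v j s : bool :=
  (node_position eps f wbe tc xc w v j s < +oo)%E.

Section Tracing.
Variables (R : realType) (f : R -> R -> R) (eps : R) (wbe vbe : R -> R).
Variables (J n : nat) (tc xc : nat -> R) (w v : R -> R -> R) (sv : seq R).
Hypothesis eps_gt0 : 0 < eps.
Hypothesis step_v : step_like sv vbe.
Implicit Types (i r q : 'I_n) (j k : nat) (x t : R).

Definition npos j i := node_position eps f wbe tc xc w v j i.+1.
Definition live j i := finite_position eps f wbe tc xc w v j i.+1.
Definition pos j i := real_position eps f wbe tc xc w v j i.+1.
Definition sgn i : R := wave_sign eps wbe i.+1.
Definition hgt i : R := wave_state eps wbe i.+1.
Definition base i : R := if sgn i == 1 then hgt i - eps else hgt i.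
Definition spd j i := real_speed eps f wbe tc xc w v j i.+1.

Lemma live_finite j i : live j i = (npos j i < +oo)%E.
Proof. by rewrite /live finite_position.unlock. Qed.

Lemma pos_fine j i : pos j i = fine (npos j i).
Proof. by rewrite /pos real_position.unlock. Qed.

Lemma spd_fine j i : spd j i = fine (speed_at eps f wbe (w (tc j)) (v (tc j)) i.+1 (npos j i)).
Proof. by rewrite /spd real_speed.unlock. Qed.

Definition slopes_gtN1 := forall y i, -1 < cell_slope f eps (vbe y) (base i).

(** In [traced_chain] the cell of a wave is found from the waves on its left; this
    makes the cells of the waves of a front adjacent. *)
Record traced j : Prop := Traced {
  traced_real : forall i, live j i -> npos j i = (pos j i)%:E ;
  traced_mono : forall i r, live j i -> live j r -> (i <= r)%N -> pos j i <= pos j r ;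
  traced_sgn : forall i r, live j i -> live j r -> pos j i = pos j r -> sgn i = sgn r ;
  traced_chain : forall i, live j i ->
    hgt i - sgn i * eps = eps * \sum_(r | live j r && (r < i)%N) sgn r ;
  traced_w : forall x, w (tc j) x = eps * \sum_(i | live j i && (pos j i <= x)) sgn i ;
  traced_v : forall x, v (tc j) x = vbe (x + tc j) }.

Hypothesis sgnP : forall i, sgn i = 1 \/ sgn i = -1.

Lemma sgn_norm i : `|sgn i| = 1.
Proof. by have [->|->] := sgnP i; rewrite ?normrN normr1. Qed.

Lemma sgn_sqr i : sgn i * sgn i = 1.
Proof. by have [->|->] := sgnP i; ring. Qed.

Definition fr j x := [set i | live j i && (pos j i == x)].

Section Node.
Variable j : nat.
Hypothesis T : traced j.

Lemma left_lim_w x : left_lim (w (tc j)) x = eps * \sum_(i | live j i && (pos j i < x)) sgn i.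
Proof.
have -> : w (tc j) = fun z => \sum_(i | live j i && (pos j i <= z)) eps * sgn i.
  by apply/funext => z; rewrite (traced_w T) mulr_sumr.
by rewrite left_lim_sum mulr_sumr.
Qed.

Lemma left_lim_lattice x : exists a : int, left_lim (w (tc j)) x = a%:~R * eps.
Proof.
rewrite left_lim_w; elim/big_ind: _ => [|y z [a ha] [b hb]|i _].
- by exists 0; rewrite mulr0 mul0r.
- by exists (a + b); rewrite mulrDr ha hb intrD mulrDl.
by have [->|->] := sgnP i; [exists 1|exists (-1)]; rewrite ?intrN mulrC.
Qed.

Lemma fr_sum_sgn x i k : i \in fr j x ->
  \sum_(r in fr j x | (r < k)%N) sgn r = sgn i * (rank (fr j x) k)%:R.
Proof.
rewrite inE => /andP[li /eqP xi].
have e : {in fr j x, forall r, sgn r = sgn i}.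
  by move=> r; rewrite inE => /andP[lr /eqP xr]; apply: (traced_sgn T) => //; rewrite xr.
rewrite (eq_bigr (fun=> sgn i)); last by move=> r /andP[/e].
rewrite sumr_const mulr_natr; congr (_ *+ _); apply: eq_card => q; by rewrite [RHS]inE.
Qed.

Lemma fr_state x i : i \in fr j x ->
  hgt i = left_lim (w (tc j)) x + sgn i * eps * (rank (fr j x) i).+1%:R.
Proof.
move=> iF; have := iF; rewrite inE => /andP[li /eqP xi].
have := traced_chain T li; rewrite left_lim_w.
rewrite (bigID (fun r => pos j r < x)) /= => h.
have e1 : \sum_(r | live j r && (r < i)%N && (pos j r < x)) sgn r = \sum_(r | live j r && (pos j r < x)) sgn r.
  apply: eq_bigl => r; case lr : (live j r) => //=; apply/andP/idP => [[]//|h']; split => //.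
  rewrite ltnNge; apply/negP => ir; have := traced_mono T li lr ir.
  by rewrite xi leNgt h'.
have e2 : \sum_(r | live j r && (r < i)%N && ~~ (pos j r < x)) sgn r
   = \sum_(r in fr j x | (r < i)%N) sgn r.
  apply: eq_bigl => r; rewrite inE -leNgt; case lr : (live j r) => //=.
  rewrite andbC; case ri : (r < i)%N; rewrite ?andbF ?andbT// eq_le.
  by have := traced_mono T lr li (ltnW ri); rewrite xi => ->.
move: h; rewrite e1 e2 (fr_sum_sgn _ iF) mulrDr -natr1 => h.
rewrite -[LHS](subrK (sgn i * eps)) h; ring.
Qed.

Lemma fr_right x i : i \in fr j x ->
  w (tc j) x = left_lim (w (tc j)) x + sgn i * eps * #|fr j x|%:R.
Proof.
move=> iF; rewrite left_lim_w (traced_w T) (bigID (fun r => pos j r < x)) /= mulrDr.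
congr (_ * _ + _).
  apply: eq_bigl => r; rewrite -andbA; congr (_ && _).
  by apply/andP/idP => [[]//|h]; split => //; exact: ltW.
have -> : \sum_(r | live j r && (pos j r <= x) && ~~ (pos j r < x)) sgn r
   = \sum_(r in fr j x | (r < n)%N) sgn r.
  apply: eq_bigl => r; rewrite inE -leNgt ltn_ord andbT -andbA; congr (_ && _).
  by rewrite eq_le.
by rewrite (fr_sum_sgn _ iF) rank_full//; ring.
Qed.

Lemma fr_empty x : fr j x = finset.set0 -> w (tc j) x = left_lim (w (tc j)) x.
Proof.
move=> F0; rewrite left_lim_w (traced_w T); congr (_ * _); apply: eq_bigl => r.
case lr : (live j r) => //=; rewrite le_eqVlt; case: eqP => //= xr.
have := finset.in_set0 r; by rewrite -F0 inE lr xr eqxx.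
Qed.

Lemma fr_pos x i : i \in fr j x -> sgn i = 1 -> exists a : int,
  [/\ left_lim (w (tc j)) x = node eps a 0, w (tc j) x = node eps a #|fr j x| &
  forall r, r \in fr j x -> [/\ sgn r = 1, hgt r - eps = node eps a (rank (fr j x) r) &
     hgt r = node eps a (rank (fr j x) r).+1]].
Proof.
move=> iF si; have [a ha] := left_lim_lattice x; exists a; split.
- by rewrite ha /node addr0.
- by rewrite (fr_right iF) si ha /node intrD; ring.
move=> r rF; have sr : sgn r = 1.
  move: iF rF; rewrite !inE => /andP[li /eqP xi] /andP[lr /eqP xr].
  by rewrite -si; apply: (traced_sgn T) => //; rewrite xr.
have hr : hgt r = node eps a (rank (fr j x) r).+1.
  by rewrite (fr_state rF) sr ha /node intrD; ring.
by split=> //; rewrite hr nodeS addrK.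
Qed.

Lemma fr_neg x i : i \in fr j x -> sgn i = -1 -> exists a : int,
  [/\ w (tc j) x = node eps a 0, left_lim (w (tc j)) x = node eps a #|fr j x| &
  forall r, r \in fr j x -> [/\ sgn r = -1,
     hgt r = node eps a (#|fr j x| - (rank (fr j x) r).+1) &
     hgt r + eps = node eps a (#|fr j x| - (rank (fr j x) r).+1).+1]].
Proof.
move=> iF si; have [b hb] := left_lim_lattice x; exists (b - #|fr j x|%:Z); split.
- by rewrite (fr_right iF) si hb /node addr0 intrB; ring.
- by rewrite hb /node subrK.
move=> r rF; have sr : sgn r = -1.
  move: iF rF; rewrite !inE => /andP[li /eqP xi] /andP[lr /eqP xr].
  by rewrite -si; apply: (traced_sgn T) => //; rewrite xr.
have hr : hgt r = node eps (b - #|fr j x|%:Z) (#|fr j x| - (rank (fr j x) r).+1).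
  rewrite (fr_state rF) sr hb /node -subzn; last exact: rank_lt_card.
  by rewrite !intrD !intrN; ring.
by split=> //; rewrite nodeS hr.
Qed.

Lemma spdE x r : r \in fr j x -> spd j r =
  if sgn r == 1 then slope (conv_env (left_lim (w (tc j)) x) (w (tc j) x) (interp eps (f ^~ (v (tc j) x)))) (hgt r - eps) (hgt r)
  else slope (conc_env (w (tc j) x) (left_lim (w (tc j)) x) (interp eps (f ^~ (v (tc j) x)))) (hgt r) (hgt r + eps).
Proof.
rewrite inE => /andP[lr /eqP xr]; rewrite spd_fine (traced_real T lr) xr /=.
by rewrite /sgn; case: ifP.
Qed.

Lemma card_fr x i : i \in fr j x -> (0 < #|fr j x|)%N.
Proof. by move=> iF; apply/card_gt0P; exists i. Qed.

(** The states along a front are consecutive nodes of the interpolation, from left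
    to right or conversely according to the sign, hence [conv_hull] and
    [conc_hull]. *)
Lemma fr_hull x i : i \in fr j x -> exists l s,
  is_hull #|fr j x| l s /\
  forall r, r \in fr j x -> spd j r = s (rank (fr j x) r) /\
    cell_slope f eps (v (tc j) x) (base r) = l (rank (fr j x) r).
Proof.
move=> iF; have k0 := card_fr iF; set g := f ^~ (v (tc j) x).
have [si|si] := sgnP i.
  have [a [ea eb h]] := fr_pos iF si.
  exists (fun m : nat => slope g (node eps a m) (node eps a m.+1)).
  exists (fun m : nat => slope (conv_env (node eps a 0) (node eps a #|fr j x|) (interp eps g))
     (node eps a m) (node eps a m.+1)).
  split; first exact: conv_hull.
  move=> r rF; have [sr h1 h2] := h r rF.
  rewrite (spdE rF) sr eqxx h1 h2 ea eb; split=> //.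
  by rewrite /base sr eqxx h1 slope_node /cell_slope -nodeS.
have [a [ea eb h]] := fr_neg iF si.
exists (fun m : nat => slope g (node eps a (#|fr j x| - m.+1)) (node eps a (#|fr j x| - m.+1).+1)).
exists (fun m : nat => slope (conc_env (node eps a 0) (node eps a #|fr j x|) (interp eps g))
     (node eps a (#|fr j x| - m.+1)) (node eps a (#|fr j x| - m.+1).+1)).
split; first exact: conc_hull.
have N1 : (-1 == 1 :> R) = false by apply/eqP; lra.
move=> r rF; have [sr h1 h2] := h r rF.
rewrite (spdE rF) sr N1 h1 -h1 h2 h1 ea eb; split=> //.
by rewrite /base sr N1 h1 slope_node /cell_slope -nodeS.
Qed.

(** The waves of a front are in bijection with its elementary jumps. *)
Lemma fr_cells x i : i \in fr j x -> exists c : 'I_n -> int,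
  (forall r, r \in fr j x -> cells eps (left_lim (w (tc j)) x) (w (tc j) x) (c r) /\
    spd j r = cell_speed eps (f ^~ (v (tc j) x)) (left_lim (w (tc j)) x) (w (tc j) x) (c r)) /\
  forall F : int -> R,
    (\sum_(m \in cells eps (left_lim (w (tc j)) x) (w (tc j) x)) F m = \sum_(r in fr j x) F (c r))%classic.
Proof.
move=> iF; have k0 := card_fr iF; set k := #|fr j x|.
have nlt a : node eps a 0 < node eps a k by rewrite /node ltr_pM2r// ltr_int; lia.
have nS a (m : nat) : (a + m%:Z + 1)%:~R * eps = node eps a m.+1.
  by rewrite /node -addrA -[m%:Z + 1]addrC -intS.
have rk r : r \in fr j x -> (rank (fr j x) r < k)%N by exact: rank_lt_card.
have ck a (m : nat) : (m < k)%N -> cells eps (node eps a 0) (node eps a k) (a + m%:Z).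
  by move=> mk; rewrite cells_node//= lerDl ltrD2l ltz_nat mk andbT.
have [si|si] := sgnP i.
  have [a [ea eb h]] := fr_pos iF si.
  exists (fun r => a + (rank (fr j x) r)%:Z); split=> [r rF|F].
    have [sr h1 h2] := h r rF; have := rk r rF => rkr.
    rewrite ea eb; split; first exact: ck.
    by rewrite (spdE rF) sr eqxx h1 h2 ea eb /cell_speed nlt nS.
  rewrite ea eb sum_cells//.
  by rewrite -(rank_sum_full (fr j x) (fun m : nat => F (a + m%:Z))).
have [a [ea eb h]] := fr_neg iF si.
have N1 : (-1 == 1 :> R) = false by apply/eqP; lra.
exists (fun r => a + (k - (rank (fr j x) r).+1)%N%:Z); split=> [r rF|F].
  have [sr h1 h2] := h r rF; have := rk r rF => rkr.
  rewrite ea eb cellsC; split; first by apply: ck; rewrite /k; lia.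
  by rewrite (spdE rF) sr N1 h2 h1 ea eb /cell_speed ltNge (ltW (nlt a)) /= nS.
rewrite ea eb cellsC sum_cells//.
rewrite (rank_sum_full (fr j x) (fun m : nat => F (a + (k - m.+1)%N%:Z))).
by rewrite big_nat_rev/=; apply: eq_bigr => m _; rewrite add0n.
Qed.

Lemma fr_riemann x t z :
  riemann_w eps (f ^~ (v (tc j) x)) (left_lim (w (tc j)) x) (w (tc j) x) t z
    - left_lim (w (tc j)) x
  = \sum_(r in fr j x) (if spd j r * t <= z then eps * sgn r else 0).
Proof.
rewrite /riemann_w addrAC subrr add0r.
have [F0|[i iF]] := finset.set_0Vmem (fr j x).
  by rewrite F0 big_set0 (fr_empty F0) cells_refl// fsbig_set0.
have [c [hc ->]] := fr_cells iF; apply: eq_bigr => r rF.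
have [_ <-] := hc r rF; case: ifP => // _; rewrite (fr_right rF) addrAC subrr add0r.
have k0 : 0 < eps * #|fr j x|%:R by rewrite mulr_gt0// ltr0n (card_fr iF).
rewrite -mulrA sgrM (gtr0_sg k0) mulr1 mulrC.
by have [->|->] := sgnP r; rewrite ?sgrN sgr1.
Qed.

Lemma fr_jump x i : i \in fr j x -> left_lim (w (tc j)) x != w (tc j) x.
Proof.
move=> iF; rewrite (fr_right iF) -subr_eq0 opprD addNKr oppr_eq0 -mulrA mulf_neq0//.
  by have [->|->] := sgnP i; rewrite ?oppr_eq0 oner_eq0.
by rewrite mulf_neq0 ?gt_eqF// ltr0n (card_fr iF).
Qed.

Lemma no_fr_jump x : left_lim (w (tc j)) x != w (tc j) x -> exists i, i \in fr j x.
Proof.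
have [F0|[i iF] _] := finset.set_0Vmem (fr j x); last by exists i.
by rewrite (fr_empty F0) eqxx.
Qed.

Lemma step_vj : step_like [seq a - tc j | a <- sv] (v (tc j)).
Proof.
have -> : v (tc j) = fun x => vbe (x + tc j) by apply/funext => x; rewrite (traced_v T).
exact: step_translate.
Qed.

Lemma jumps_finite : finite_set (jumps (w (tc j)) (v (tc j))).
Proof.
apply: (@sub_finite_set _ _ [set` [seq pos j i | i <- enum 'I_n] ++ [seq a - tc j | a <- sv]]%classic).
  move=> y /= [/no_fr_jump[i]|hv]; rewrite mem_cat.
    by rewrite inE => /andP[_ /eqP <-]; rewrite map_f// mem_enum.
  apply/orP; right; apply/negPn/negP => ny; move/negP: hv; apply; apply/eqP.
  exact: step_jump step_vj ny.
exact: finite_seq.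
Qed.

(** Regrouping the elementary jumps of all fronts by waves. *)
Lemma evolve_w_waves t x :
  evolve_w eps f (w (tc j)) (v (tc j)) t x
  = eps * \sum_(i | live j i && (pos j i + spd j i * t <= x)) sgn i.
Proof.
rewrite /evolve_w.
under eq_fsbigr => y _ do rewrite fr_riemann.
have /finite_seqP[l0 l0E] := jumps_finite.
have [l [lE lu]] : exists l : seq R, jumps (w (tc j)) (v (tc j)) = [set` l]%classic /\ uniq l.
  exists (undup l0); rewrite undup_uniq l0E; split=> //.
  by apply/seteqP; split=> y /=; rewrite mem_undup.
rewrite lE -fsbig_seq//.
pose G i : R := if pos j i + spd j i * t <= x then eps * sgn i else 0.
transitivity (\sum_(y <- l) \sum_(i | live j i && (pos j i == y)) G i).
  apply: eq_bigr => y _; apply: eq_big => [i|i]; first by rewrite inE.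
  by rewrite inE => /andP[_ /eqP yi]; rewrite /G -yi lerBrDl.
under eq_bigr => y _ do rewrite big_mkcondr.
rewrite exchange_big/= mulr_sumr [RHS]big_mkcondr; apply: eq_bigr => i li.
have il : pos j i \in l.
  have : jumps (w (tc j)) (v (tc j)) (pos j i).
    by left; apply: (@fr_jump _ i); rewrite inE li eqxx.
  by rewrite lE.
rewrite (bigD1_seq (pos j i))//= eqxx big1 ?addr0// => y.
by rewrite eq_sym => /negPf ->.
Qed.

Lemma evolve_v_shift t x : evolve_v (w (tc j)) (v (tc j)) t x = vbe (x + t + tc j).
Proof.
rewrite -(traced_v T) -(step_fsbig (x + t) step_vj jumps_finite); last by move=> y h; right.
rewrite /evolve_v; apply: eq_fsbigr => y _; rewrite /riemann_v.
have -> : (x - y < - t) = ~~ (y <= x + t) by rewrite -ltNge; apply/idP/idP; lra.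
by case: (y <= x + t) => /=; rewrite ?subrr.
Qed.

Lemma in_fronts i : live j i -> fronts eps f (w (tc j)) (v (tc j)) (pos j i, spd j i).
Proof.
move=> li; have iF : i \in fr j (pos j i) by rewrite inE li eqxx.
have [c [hc _]] := fr_cells iF; have [h1 h2] := hc i iF.
by right; exists (c i).
Qed.

(** By [hull_gt] a speed exceeds every lower bound of the slopes of the front. *)
Lemma spd_gtN1 i : slopes_gtN1 -> live j i -> -1 < spd j i.
Proof.
move=> slope_gtN1 li; have iF : i \in fr j (pos j i) by rewrite inE li eqxx.
have [l [s [hl hr]]] := fr_hull iF; have [-> _] := hr i iF.
apply: (hull_gt hl) (rank_lt_card iF) => m mk.
have [r rF <-] : exists2 r, r \in fr j (pos j i) & rank (fr j (pos j i)) r = m.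
  apply/'exists_in_eqP; apply: contraT => /exists_inPn h.
  have := @rank_sum_full _ _ (fr j (pos j i)) (fun p => (p == m) : nat).
  rewrite big1 => [|r rF]; last by rewrite (negPf (h r rF)).
  rewrite (big_mkord xpredT (fun p => (p == m) : nat)) (bigD1 (Ordinal mk))//= eqxx; lia.
by have [_ <-] := hr r rF; rewrite (traced_v T); exact: slope_gtN1.
Qed.

End Node.

(** * From one node to the next *)

Definition dt j : R := tc j.+1 - tc j.
Definition arr j i : R := pos j i + spd j i * dt j.

Lemma speed_spd j i : traced j -> live j i ->
  speed_at eps f wbe (w (tc j)) (v (tc j)) i.+1 (npos j i) = (spd j i)%:E.
Proof. by move=> T li; rewrite spd_fine (traced_real T li). Qed.

Lemma npos_next j i : traced j -> live j i -> npos j.+1 i =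
  if (arr j i == xc j.+1) && ~~ survives eps wbe (w (tc j.+1)) i.+1 (xc j.+1) then +oo%E
  else (arr j i)%:E.
Proof.
move=> T li; rewrite {1}/npos /= -/(npos j i) speed_spd// (traced_real T li) -EFinM -EFinD.
by rewrite eqe.
Qed.

Lemma npos_dead j i : 0 < dt j -> ~~ live j i -> npos j.+1 i = +oo%E.
Proof.
move=> d0; rewrite live_finite -leNgt leye_eq => /eqP e.
by rewrite /npos /= -/(npos j i) e /= gt0_mulye ?lte_fin// addye//; case: ifP.
Qed.

Hypothesis slope_gtN1 : slopes_gtN1.
Hypothesis sol : wavefront_solution eps f wbe vbe J tc xc w v.

Section NextNode.
Variable j : nat.
Hypotheses (jJ : (j < J)%N) (T : traced j).

Lemma dt_gt0 : 0 < dt j.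
Proof. by rewrite subr_gt0; exact: (wfs_incr sol). Qed.

Lemma next_le : (j < J)%N -> tc j.+1 <= tc j.+1. Proof. by []. Qed.

Lemma w_next x : w (tc j.+1) x = eps * \sum_(i | live j i && (arr j i <= x)) sgn i.
Proof.
have [-> _] := wfs_evolve sol x (ltnW jJ) (ltW (wfs_incr sol jJ)) next_le.
exact: evolve_w_waves.
Qed.

Lemma v_next x : v (tc j.+1) x = vbe (x + tc j.+1).
Proof.
have [_ ->] := wfs_evolve sol x (ltnW jJ) (ltW (wfs_incr sol jJ)) next_le.
by rewrite evolve_v_shift//; congr vbe; ring.
Qed.

Lemma no_meeting t (p q : R * R) : 0 < t < dt j ->
  fronts eps f (w (tc j)) (v (tc j)) p -> fronts eps f (w (tc j)) (v (tc j)) q ->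
  p.1 + p.2 * t = q.1 + q.2 * t -> p = q.
Proof.
move=> /andP[t0 t1] pF qF e.
apply: (@wfs_no_collision _ _ _ _ _ _ _ _ _ _ sol j (tc j + t) (q.1 + q.2 * t)).
- exact: ltnW.
- by rewrite ltrDl.
- by move=> _; move: t1; rewrite /dt; lra.
- by rewrite addrAC subrr add0r; split.
- by rewrite addrAC subrr add0r; split.
Qed.

Lemma meeting (p q : R * R) : fronts eps f (w (tc j)) (v (tc j)) p -> fronts eps f (w (tc j)) (v (tc j)) q ->
  p.1 + p.2 * dt j = q.1 + q.2 * dt j -> p <> q ->
  q.1 + q.2 * dt j = xc j.+1 /\ forall p', fronts eps f (w (tc j)) (v (tc j)) p' ->
    p'.1 + p'.2 * dt j = xc j.+1 -> p' = p \/ p' = q.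
Proof.
move=> pF qF e npq; have ex : q.1 + q.2 * dt j = xc j.+1.
  apply/eqP/negPn/negP => /eqP ne; apply: npq.
  by apply: (wfs_single_collision sol jJ ne).
split=> // p' p'F ep'.
have [a [b [nab abE]]] := wfs_collision sol jJ.
have mem c : fronts eps f (w (tc j)) (v (tc j)) c -> c.1 + c.2 * dt j = xc j.+1 -> c = a \/ c = b.
  move=> cF ec; have : fronts_at (fronts eps f (w (tc j)) (v (tc j))) (tc j.+1 - tc j) (xc j.+1) c by split.
  by rewrite abE.
have := mem p pF (etrans e ex); have := mem q qF ex; have := mem p' p'F ep'.
by move=> [->|->] [qE|qE] [pE|pE]; subst; auto; case: npq.
Qed.

(** Waves of one front are ordered by their speeds; waves of different fronts would
    have to meet before the next node in order to overtake. *)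
Lemma arr_mono i r : live j i -> live j r -> (i <= r)%N -> arr j i <= arr j r.
Proof.
move=> li lr ir; have := traced_mono T li lr ir; rewrite le_eqVlt => /predU1P[e|lt].
  have iF : i \in fr j (pos j i) by rewrite inE li eqxx.
  have rF : r \in fr j (pos j i) by rewrite inE lr e eqxx.
  have [l [s [hl hr]]] := fr_hull T iF.
  rewrite /arr e lerD2l ler_pM2r ?dt_gt0//.
  by apply: (hull_set_mono hl _ iF rF ir) => q /hr[].
rewrite leNgt; apply/negP => cross; rewrite /arr in cross.
have d0 := dt_gt0.
have ds : 0 < spd j i - spd j r.
  rewrite -(pmulr_lgt0 _ d0) mulrBl; lra.
(* the time at which the two waves would cross *)
pose t : R := (pos j r - pos j i) / (spd j i - spd j r).
have t01 : 0 < t < dt j.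
  apply/andP; split; first by apply: divr_gt0 => //; rewrite subr_gt0.
  by rewrite /t ltr_pdivrMr// mulrBr; lra.
have := no_meeting t01 (in_fronts T li) (in_fronts T lr).
have -> : (pos j i, spd j i).1 + (pos j i, spd j i).2 * t = (pos j r, spd j r).1 + (pos j r, spd j r).2 * t.
  by rewrite /= /t; field; rewrite gt_eqF.
by move=> /(_ erefl) [e _]; move: lt; rewrite e ltxx.
Qed.

Definition same_front i r := (pos j i == pos j r) && (spd j i == spd j r).

(** Two fronts of w already make up the collision.  If vbe had changed along the
    path of one of them, that front would have met a jump of v, either before the
    node or as a third front at the collision. *)
Lemma arr_two i r : live j i -> live j r -> arr j i = arr j r -> ~~ same_front i r ->
  [/\ arr j i = xc j.+1,
    forall q, live j q -> arr j q = xc j.+1 -> same_front i q || same_front r q,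
    vbe (pos j i + tc j) = vbe (arr j i + tc j.+1) &
    vbe (pos j r + tc j) = vbe (arr j i + tc j.+1)].
Proof.
move=> li lr e nt.
have npq : (pos j i, spd j i) <> (pos j r, spd j r).
  by move=> [e1 e2]; move: nt; rewrite /same_front e1 e2 !eqxx.
have [ex hp] := meeting (in_fronts T li) (in_fronts T lr) e npq.
have ex' : arr j i = xc j.+1 by rewrite e.
have same q : live j q -> arr j q = xc j.+1 -> vbe (pos j q + tc j) = vbe (xc j.+1 + tc j.+1).
  move=> lq eq; apply/eqP/negPn/negP => ne.
  have s1 := spd_gtN1 T slope_gtN1 lq; have d0 := dt_gt0.
  have lt : pos j q + tc j < xc j.+1 + tc j.+1.
    have : 0 < (1 + spd j q) * dt j by rewrite mulr_gt0//; lra.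
    rewrite -eq /arr /dt; lra.
  have [y /andP[y1 y2] yj] := exists_jump step_v (ltW lt) ne.
  have lv : left_lim (v (tc j)) (y - tc j) = left_lim vbe y.
    have yy : y - 1 < y by rewrite ltrBlDr ltrDl.
    have [z /andP[_ zy] hz] := gap_left sv yy.
    rewrite (step_left step_v zy hz); apply: (@left_lim_const _ _ (z - tc j)); first by rewrite ltrD2r.
    move=> u /andP[u1 u2]; rewrite (traced_v T) -(step_left step_v zy hz).
    have zu : z < u + tc j by lra.
    have uy : u + tc j < y by lra.
    rewrite (step_left step_v zy hz); apply/esym/step_v.1; first exact: ltW.
    move=> a sa za; rewrite ltNge; apply/negP => au.
    by have := hz a sa (le_lt_trans au uy); rewrite leNgt za.
  have yF : fronts eps f (w (tc j)) (v (tc j)) (y - tc j, -1).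
    by left; split=> //=; rewrite lv (traced_v T) subrK.
  (* the time at which the jump y of v reaches the wave q *)
  pose t : R := (y - tc j - pos j q) / (1 + spd j q).
  have s2 : 0 < 1 + spd j q by lra.
  have t0 : 0 < t by rewrite /t divr_gt0//; lra.
  have et : y - tc j + -1 * t = pos j q + spd j q * t by rewrite /t; field; rewrite gt_eqF.
  have tle : t <= dt j.
    by rewrite /t ler_pdivrMr// mulrC; move: y2; rewrite -eq /arr /dt; lra.
  move: tle; rewrite le_eqVlt => /predU1P[td|tlt].
    have := hp _ yF; rewrite /= -td et td => /(_ eq) [] [_ h].
      by have := spd_gtN1 T slope_gtN1 li; rewrite -h ltxx.
    by have := spd_gtN1 T slope_gtN1 lr; rewrite -h ltxx.
  have tt : 0 < t < dt j by rewrite t0.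
  have := no_meeting tt yF (in_fronts T lq) et => -[_ h].
  by move: s1; rewrite -h ltxx.
split=> //.
- move=> q lq eq; rewrite /same_front.
  by have [[-> ->]|[-> ->]] := hp _ (in_fronts T lq) eq; rewrite !eqxx ?orbT.
- by rewrite ex'; exact: same.
- by rewrite ex'; apply: same => //; rewrite -e.
Qed.

Definition meet := [set q | live j q && (arr j q == xc j.+1)].

Lemma left_lim_next x : left_lim (w (tc j.+1)) x = eps * \sum_(i | live j i && (arr j i < x)) sgn i.
Proof.
have -> : w (tc j.+1) = fun z => \sum_(i | live j i && (arr j i <= z)) eps * sgn i.
  by apply/funext => z; rewrite w_next mulr_sumr.
by rewrite left_lim_sum mulr_sumr.
Qed.

Lemma meet_split k : (forall q, live j q -> (q < k)%N = (q \in meet) && (q < k)%N || (arr j q < xc j.+1)) ->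
  \sum_(r | live j r && (r < k)%N) sgn r
  = \sum_(r | live j r && (arr j r < xc j.+1)) sgn r + before meet sgn k.
Proof.
move=> hk; rewrite (bigID (fun r => arr j r < xc j.+1)) /=; congr (_ + _); apply: eq_bigl => r.
  case lr : (live j r) => //=; rewrite hk// inE lr /=.
  by case: eqP => [->|]; case: (_ < _) => //=; rewrite ?andbT ?orbT// ?ltxx andbF.
rewrite inE; case lr : (live j r) => //=; case: eqP => [->|ne] /=; first by rewrite ltxx andbT.
by rewrite hk// inE lr /=; case: eqP => //= _; case: (_ < _).
Qed.

Lemma survivesE i : i \in meet ->
  survives eps wbe (w (tc j.+1)) i.+1 (xc j.+1) = stays meet sgn i.
Proof.
move=> iK; have := iK; rewrite inE => /andP[li /eqP ai].
have hk : forall q, live j q -> (q < i)%N = (q \in meet) && (q < i)%N || (arr j q < xc j.+1).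
  move=> q lq; rewrite inE lq /=; have [qi|iq] := ltnP q i; last first.
    by rewrite andbF /= ltNge -ai arr_mono.
  by rewrite andbT -le_eqVlt -ai arr_mono// ltnW.
have ch := traced_chain T li; rewrite (meet_split hk) in ch.
have wX : w (tc j.+1) (xc j.+1) = eps * (\sum_(r | live j r && (arr j r < xc j.+1)) sgn r + before meet sgn n).
  rewrite w_next (bigID (fun r => arr j r < xc j.+1)) /=; congr (_ * (_ + _)); apply: eq_bigl => r.
    by case: (live j r) => //=; case: ltgtP.
  by rewrite inE ltn_ord andbT; case: (live j r) => //=; case: ltgtP.
rewrite /survives /stays -/(sgn i) -/(hgt i) left_lim_next wX.
set A := \sum_(r | _) _ in ch wX *; set b := before meet sgn i in ch *; set B := before meet sgn n.
have -> : sgn i * hgt i = eps + eps * (sgn i * A) + eps * (sgn i * b).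
  have -> : hgt i = sgn i * eps + eps * (A + b) by rewrite -ch; ring.
  by rewrite mulrDr mulrA sgn_sqr; ring.
have -> : (sgn i * (eps * A) <= eps + eps * (sgn i * A) + eps * (sgn i * b) - eps) = (0 <= sgn i * b).
  by rewrite -[RHS](pmulr_rge0 _ eps_gt0); apply/idP/idP; lra.
have -> : (eps + eps * (sgn i * A) + eps * (sgn i * b) <= sgn i * (eps * (A + B))) = (sgn i * b + 1 <= sgn i * B).
  by rewrite -[RHS](ler_pM2l eps_gt0); apply/idP/idP; lra.
by rewrite gerDl oppr_le0 (ltW eps_gt0).
Qed.

Lemma live_next i : live j.+1 i = live j i && ((i \notin meet) || stays meet sgn i).
Proof.
case li : (live j i); last first.
  by rewrite live_finite npos_dead ?dt_gt0 ?li// ltxx.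
rewrite live_finite npos_next// inE li /=; case: eqP => /= [ai|_]; last by rewrite ltry.
have iK : i \in meet by rewrite inE li ai eqxx.
by rewrite survivesE//; case: (stays _ _ _); rewrite /= ?ltxx// ltry.
Qed.

Lemma live_prev i : live j.+1 i -> live j i.
Proof. by rewrite live_next => /andP[]. Qed.

Lemma npos_arr i : live j.+1 i -> npos j.+1 i = (arr j i)%:E.
Proof.
move=> l1; have l0 := live_prev l1; move: l1; rewrite live_next l0 /= => h.
rewrite npos_next//; case: eqP => //= ai.
have iK : i \in meet by rewrite inE l0 ai eqxx.
by move: h; rewrite iK /= survivesE// => ->.
Qed.

Lemma pos_arr i : live j.+1 i -> pos j.+1 i = arr j i.
Proof. by move=> l1; rewrite pos_fine npos_arr. Qed.

Lemma sgn_opp i r : sgn i != sgn r -> sgn r = - sgn i.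
Proof.
by have [->|->] := sgnP i; have [->|->] := sgnP r; rewrite ?eqxx ?opprK.
Qed.

(** The waves arriving at the collision come from at most two fronts, each of a
    single sign, and c separates their indices. *)
Lemma meet_signs : exists a (c : nat), a * a = 1 /\
  forall q, q \in meet -> sgn q = if (q < c)%N then a else - a.
Proof.
have [/forall_inP h|/forall_inPn[i iK]] := boolP [forall i in meet, forall r in meet, sgn i == sgn r].
  have [K0|[i iK]] := finset.set_0Vmem meet.
    by exists 1, 0%N; rewrite mulr1; split=> // q; rewrite K0 inE.
  exists (sgn i), n; rewrite sgn_sqr; split=> // q qK; rewrite ltn_ord.
  by move/forall_inP: (h q qK) => /(_ i iK) /eqP.
move=> /forall_inPn[r rK ne].
wlog pir : i r iK rK ne / pos j i < pos j r.
  move=> H; have [pi|pr|e] := ltgtP (pos j i) (pos j r).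
  - exact: (H i r).
  - by apply: (H r i rK iK _ pr); rewrite eq_sym.
  - move: iK rK; rewrite !inE => /andP[li _] /andP[lr _].
    by rewrite (traced_sgn T li lr e) eqxx in ne.
have := iK; have := rK; rewrite !inE => /andP[lr /eqP ar] /andP[li /eqP ai].
have nf : ~~ same_front i r by rewrite /same_front lt_eqF.
have [_ two _ _] := arr_two li lr (etrans ai (esym ar)) nf.
(* the sign changes at the first wave m coming from the front of r *)
pose D := [set q in meet | pos j q == pos j r].
have rD : r \in D by rewrite inE rK eqxx.
case: (arg_minnP (fun r : 'I_n => r : nat) rD) => m mD mmin.
have {mD} : m \in D by []; rewrite inE => /andP[mK /eqP pm].
exists (sgn i), m; rewrite sgn_sqr; split=> // q qK.
have := qK; rewrite inE => /andP[lq /eqP aq].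
have := mK; rewrite inE => /andP[lm _].
have [qm|mq] := ltnP q m.
  apply: (traced_sgn T) => //; apply/esym/eqP.
  have := two q lq aq; rewrite /same_front => /orP[/andP[]//|/andP[/eqP pq _]].
  have : q \in D by rewrite inE qK pq eqxx.
  by move/mmin; rewrite leqNgt qm.
rewrite -(sgn_opp ne); apply: (traced_sgn T) => //; apply/esym/eqP.
have := two q lq aq; rewrite /same_front => /orP[/andP[/eqP pq _]|/andP[]//].
have := traced_mono T lm lq mq; by rewrite pm -pq leNgt pir.
Qed.

(** A wave that does not take part in the collision has all or none of the meeting
    waves on its left, and the removed ones have signs of sum zero. *)
Lemma meet_balance k : (n <= k)%N \/ (exists i, live j.+1 i /\ k = i) ->
  \sum_(r in meet | stays meet sgn r && (r < k)%N) sgn r = before meet sgn k.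
Proof.
have [a [c [a1 sgE]]] := meet_signs => hk.
have [nk|[i [l1 ->]]] := hk; first by apply: (stays_before a1 sgE); left.
have l0 := live_prev l1.
have [iK|iK] := boolP (i \in meet).
  apply: (stays_before a1 sgE); right; exists i; split=> //.
  by move: l1; rewrite live_next l0 iK.
have [lt|gt|/esym e] := ltgtP (xc j.+1) (arr j i); last by move: iK; rewrite inE l0 e eqxx.
  have all q : q \in meet -> (q < i)%N = (q < n)%N.
    rewrite inE ltn_ord => /andP[lq /eqP aq]; rewrite ltnNge; apply/negP => iq.
    by have := arr_mono l0 lq iq; rewrite aq leNgt lt.
  rewrite /before [RHS](eq_bigl (fun q => (q \in meet) && (q < n)%N)); last first.
    by move=> q; case qK : (q \in meet) => //=; exact: all.
  rewrite -[RHS](stays_before a1 sgE); last by left.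
  by apply: eq_bigl => q; case qK : (q \in meet) => //=; rewrite all.
have none q : q \in meet -> (q < i)%N = false.
  rewrite inE => /andP[lq /eqP aq]; apply/negP => qi.
  by have := arr_mono lq l0 (ltnW qi); rewrite aq leNgt gt.
rewrite /before !big_pred0// => q; case qK : (q \in meet) => //=; by rewrite none// andbF.
Qed.

Lemma sum_next (P : pred 'I_n) : 
  \sum_(r in meet | stays meet sgn r && P r) sgn r = \sum_(r in meet | P r) sgn r ->
  \sum_(r | live j.+1 r && P r) sgn r = \sum_(r | live j r && P r) sgn r.
Proof.
move=> e; rewrite [LHS](bigID (mem meet)) [RHS](bigID (mem meet)) /=; congr (_ + _).
  transitivity (\sum_(r in meet | stays meet sgn r && P r) sgn r).
    apply: eq_bigl => r; rewrite live_next; case rK : (r \in meet); rewrite ?andbF// andbT /=.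
    by move: rK; rewrite inE => /andP[-> _].
  rewrite e; apply: eq_bigl => r; case rK : (r \in meet); rewrite ?andbF// andbT /=.
  by move: rK; rewrite inE => /andP[-> _].
by apply: eq_bigl => r; rewrite live_next; case: (r \in meet); rewrite ?andbF// /= !andbT.
Qed.

Lemma traced_next : traced j.+1.
Proof.
split.
- by move=> i l1; rewrite pos_fine npos_arr.
- move=> i r li lr ir; rewrite !pos_arr//; apply: arr_mono => //; exact: live_prev.
- move=> i r li1 lr1; rewrite (pos_arr li1) (pos_arr lr1) => e.
  have li := live_prev li1; have lr := live_prev lr1.
  have [/andP[/eqP pe _]|nf] := boolP (same_front i r); first exact: (traced_sgn T).
  have [ai _ _ _] := arr_two li lr e nf.
  have iK : i \in meet by rewrite inE li ai eqxx.
  have rK : r \in meet by rewrite inE lr -e ai eqxx.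
  have [a [c [a1 sgE]]] := meet_signs.
  apply/eqP/negPn/negP => ne; have := stays_opposite a1 sgE iK rK ne.
  by move: li1 lr1; rewrite !live_next li lr iK rK /= => -> ->.
- move=> i l1; rewrite (traced_chain T (live_prev l1)); congr (_ * _); apply/esym.
  by apply: sum_next; apply: meet_balance; right; exists i.
- move=> x; rewrite w_next; congr (_ * _).
  transitivity (\sum_(r | live j.+1 r && (arr j r <= x)) sgn r); last first.
    by apply: eq_bigl => r; case l1 : (live j.+1 r) => //=; rewrite pos_arr.
  apply/esym/sum_next; have [X|X] := boolP (xc j.+1 <= x).
    transitivity (before meet sgn n).
      rewrite -meet_balance; last by left.
      apply: eq_bigl => r; case rK : (r \in meet) => //=; rewrite ltn_ord.
      by move: rK; rewrite inE => /andP[_ /eqP ->]; rewrite X.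
    apply: eq_bigl => r; case rK : (r \in meet) => //=; rewrite ltn_ord.
    by move: rK; rewrite inE => /andP[_ /eqP ->]; rewrite X.
  rewrite !big_pred0// => r; case rK : (r \in meet) => //=;
    by move: rK; rewrite inE => /andP[_ /eqP ->]; rewrite (negPf X) ?andbF.
- exact: v_next.
Qed.

End NextNode.

(** * The sum over all collisions *)

Hypothesis start : traced 0.

Lemma traced_le j : (j <= J)%N -> traced j.
Proof. by elim: j => [_|j IH jJ]; [exact: start|exact: (traced_next jJ (IH (ltnW jJ)))]. Qed.

Hypothesis f_C3 : class_C 3 f.
Hypothesis f_bounded : forall l, (size l <= 3)%N -> has_ubound (abs_range (partial l f)).
Hypothesis fin_v : (tot_var setT vbe < +oo)%E.

Let Y j i := pos j i + tc j.

Let YE j i r : (Y j i == Y j r) = (pos j i == pos j r).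
Proof. exact: (inj_eq (addIr _)). Qed.

Let arrE j i : arrival Y (fun k q => spd k q) dt j i = arr j i + tc j.+1.
Proof. by rewrite /arrival /arr /Y /dt; ring. Qed.

Let arrI j i r : arrival Y (fun k q => spd k q) dt j i = arrival Y (fun k q => spd k q) dt j r -> arr j i = arr j r.
Proof. by rewrite !arrE => /addIr. Qed.

Let frontE j i : front (fun k q => live k q) Y j i = fr j (pos j i).
Proof. by apply/finset.setP => r; rewrite !inE YE. Qed.

Let base_diff i r : sgn i = sgn r -> base i - base r = hgt i - hgt r.
Proof. by move=> e; rewrite /base e; case: ifP => _ //; rewrite opprB addrA subrK. Qed.

Let in_fr j i : live j i -> i \in fr j (pos j i).
Proof. by move=> li; rewrite inE li eqxx. Qed.

Let fr_slopes j i : (j <= J)%N -> live j i -> exists l s, 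
  [/\ is_hull #|fr j (pos j i)| l s,
   forall r, r \in fr j (pos j i) -> spd j r = s (rank (fr j (pos j i)) r) &
   forall r, r \in fr j (pos j i) -> cell_slope f eps (vbe (Y j i)) (base r) = l (rank (fr j (pos j i)) r)].
Proof.
move=> jJ li; have T := traced_le jJ.
have [l [s [hl h]]] := fr_hull T (in_fr li); exists l, s; split=> // r /h[]//.
by rewrite (traced_v T).
Qed.

Let meet3 j i r q : (j < J)%N -> live j i -> live j r -> live j q ->
  arr j i = arr j r -> arr j q = arr j r -> sgn i != sgn r ->
  [/\ i \in meet j, q \in meet j & r \in meet j].
Proof.
move=> jJ li lr lq e e' ne; have T := traced_le (ltnW jJ).
have nf : ~~ same_front j i r.
  by apply: contra ne => /andP[/eqP p _]; apply/eqP; exact: (traced_sgn T).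
have [ai _ _ _] := arr_two jJ T li lr e nf.
by rewrite !inE li lr lq e' -e ai eqxx.
Qed.

Lemma change_le : \sum_(0 <= j < J) (eps * \sum_(i | live j.+1 i) `|spd j.+1 i - spd j i|)
  <= (3 * supnorm (pdw (pdw f)) + 2 * supnorm (pdw (pdw (pdv f))) * TV vbe) * (eps * n%:R) ^+ 2
     + supnorm (pdw (pdv f)) * (eps * n%:R) * TV vbe.
Proof.
have sup0 l (hl : (size l <= 3)%N) := supnorm_ge0 (f_bounded hl).
apply: (@total_change _ n J eps (fun k q => live k q) Y (fun k q => spd k q) sgn hgt
  (fun u i => cell_slope f eps u (base i)) dt vbe (cum_var vbe)) => //.
- exact: (sup0 [:: true; true]).
- exact: (sup0 [:: true; true; false]).
- exact: (sup0 [:: true; false]).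
- exact: (cum_var_ge0 step_v).
- exact: (cum_var_le_TV step_v fin_v).
- by move=> y z yz; rewrite distrC distrC; exact: (cum_var_dist step_v fin_v).
- by move=> u i r e; rewrite -(base_diff e); exact: cell_slope_ww.
- by move=> u z i r e; rewrite -(base_diff e); exact: cell_slope_wwv.
- by move=> u z i; exact: cell_slope_wv.
- by move=> j jJ; exact: dt_gt0.
- by move=> j i jJ; exact: (live_prev jJ (traced_le (ltnW jJ))).
- by move=> j i jJ l1; rewrite arrE /Y (pos_arr jJ (traced_le (ltnW jJ)) l1).
- by move=> j i jJ li; exact: (spd_gtN1 (traced_le (ltnW jJ)) slope_gtN1 li).
- by move=> j i r jJ li lr ir; rewrite lerD2r; exact: (traced_mono (traced_le jJ)).
- by move=> j i r jJ li lr ir; rewrite !arrE lerD2r; exact: (arr_mono jJ (traced_le (ltnW jJ))).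
- move=> j i r jJ li lr /eqP; rewrite YE => /eqP; exact: (traced_sgn (traced_le jJ)).
- move=> j i r jJ li lr /eqP; rewrite YE => /eqP e ir; have T := traced_le jJ.
  have rF : r \in fr j (pos j i) by rewrite inE lr e eqxx.
  rewrite (fr_state T (in_fr li)) (fr_state T rF) -(traced_sgn T li lr e).
  rewrite opprD addrACA subrr add0r -mulrBr mulrA mulrA sgn_sqr mul1r; congr (_ * _).
  have -> : #|[set q | live j q & (i < q <= r)%N]| = (rank (fr j (pos j i)) r.+1 - rank (fr j (pos j i)) i.+1)%N.
    rewrite /rank -cardsDS; last first.
      by apply/fintype.subsetP => q; rewrite !inE => /andP[-> qi]; exact: leq_trans qi _.
    congr (#|pred_of_set _|); apply/finset.setP => q; rewrite !inE !ltnS.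
    case lq : (live j q) => //=; have [qi|iq] := leqP q i; first by case: (_ == _).
    have [qr|rq] /= := leqP q r; last by rewrite !andbF.
    rewrite andbF andbT /= eq_le (traced_mono T li lq (ltnW iq)) andbT.
    by rewrite {1}e (traced_mono T lq lr qr).
  rewrite !rankS (in_fr li) rF natrB; last by rewrite leq_add2l rank_mono.
  by ring.
- exact: sgn_norm.
- move=> j i r jJ li lr /eqP; rewrite YE => /eqP e ir.
  have rF : r \in fr j (pos j i) by rewrite inE lr e eqxx.
  by have [l [s [hl hs _]]] := fr_slopes jJ li; apply: (hull_set_mono hl hs (in_fr li) rF ir).
- move=> j i k jJ li; rewrite frontE.
  by have [l [s [hl hs hL]]] := fr_slopes jJ li; exact: (hull_set_prefix hl hL hs).
- move=> j i k jJ li; rewrite frontE.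
  by have [l [s [hl hs hL]]] := fr_slopes jJ li; exact: (hull_set_contact hl hL hs).
- move=> j i r jJ li lr /arrI e nt; have T := traced_le (ltnW jJ).
  have nf : ~~ same_front j i r by move: nt; rewrite /together YE.
  have [ai two vi vr] := arr_two jJ T li lr e nf; rewrite !arrE; split=> //.
  move=> q lq; rewrite arrE => /addIr aq; rewrite /together !YE.
  by apply: two => //; rewrite aq.
- move=> j i r a b jJ li lr la lb /arrI e nt /arrI e' nt'; have T := traced_le (ltnW jJ).
  have nf : ~~ same_front j i r by move: nt; rewrite /together YE.
  have nf' : ~~ same_front j a b by move: nt'; rewrite /together YE.
  have [ai _ _ _] := arr_two jJ T li lr e nf.
  have [aa _ _ _] := arr_two jJ T la lb e' nf'.
  by rewrite !arrE ai aa.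
- move=> j i jJ li h; have T := traced_le (ltnW jJ).
  rewrite live_next// li /=; case iK : (i \in meet j) => //=.
  rewrite (@stays_left _ _ (meet j) sgn (sgn i) n (sgn_sqr i))//.
    by rewrite (@rank_full _ _ n)// -addnn ltn_add2r rank_lt_card.
  move=> q qK; rewrite ltn_ord; move: iK qK; rewrite !inE => /andP[_ /eqP ai] /andP[lq /eqP aq].
  by apply: h => //; rewrite !arrE ai aq.
- move=> j i r jJ li lr /arrI e ne; have T := traced_le (ltnW jJ).
  apply/negP => /andP[li1 lr1]; move/eqP: ne; apply.
  by apply: (traced_sgn (traced_le jJ)) => //; rewrite !(pos_arr jJ T).
- move=> j i i' r jJ li li' lr /andP[ii' i'r] /arrI e /arrI e' s1 s2 l1.
  have T := traced_le (ltnW jJ).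
  have [iK i'K rK] := meet3 jJ li lr li' e e' s2.
  have [a [c [a1 sgE]]] := meet_signs jJ T.
  have i'c : (i' < c)%N.
    rewrite ltnNge; apply/negP => ci'; move: s2; rewrite s1 !sgE// !ltnNge ci'.
    by rewrite (leq_trans ci' (ltnW i'r)) eqxx.
  move: l1; rewrite !(live_next jJ T) li li' iK i'K /=.
  exact: (stays_left_closed a1 sgE iK i'K ii' i'c).
- move=> j i r r' jJ li lr lr' /andP[ir rr'] /arrI e /arrI e' s1 s2 l1.
  have T := traced_le (ltnW jJ).
  have [iK r'K rK] := meet3 jJ li lr lr' e (etrans (esym e') e) s2.
  have [a [c [a1 sgE]]] := meet_signs jJ T.
  have cr : (c <= r)%N.
    rewrite leqNgt; apply/negP => rc; move: s2; rewrite !sgE// rc.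
    by rewrite (ltn_trans ir rc) eqxx.
  move: l1; rewrite !(live_next jJ T) lr lr' rK r'K /=.
  exact: (stays_right_closed a1 sgE rK r'K rr' cr).
Qed.

End Tracing.

(** * The statement in terms of waves *)

Section Start.
Variables (R : realType) (f : R -> R -> R) (eps : R) (wbe vbe : R -> R).
Variables (J n : nat) (tc xc : nat -> R) (w v : R -> R -> R) (sw : seq R).
Hypothesis eps_gt0 : 0 < eps.
Hypothesis step_w : step_like sw wbe.
Hypothesis fin_w : (tot_var setT wbe < +oo)%E.
Hypothesis latt_w : forall x, in_lattice eps (wbe x).
Hypothesis TVn : TV wbe = n%:R * eps.
Hypothesis sol : wavefront_solution eps f wbe vbe J tc xc w v.
Implicit Types i r : 'I_n.

Let ord1 i : (0 < i.+1 <= n)%N. Proof. by rewrite /= ltn_ord. Qed.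

Lemma initial_signs i : sgn eps wbe i = 1 \/ sgn eps wbe i = -1.
Proof. exact: (wave_sign_norm eps_gt0 step_w fin_w TVn (ord1 i)). Qed.

Lemma initial_slopes (Iw Iv : interval R) : class_C 3 f ->
  (forall a b, a \in Iw -> b \in Iv -> - 1 < pdw f a b) ->
  (forall x, wbe x \in Iw) -> (forall x, vbe x \in Iv) -> slopes_gtN1 f eps wbe vbe n.
Proof.
move=> fC fI wI vI y i; have [h1 h2] := wave_state_range eps_gt0 step_w fin_w latt_w TVn (ord1 i) wI.
have [s|s] := initial_signs i; rewrite /base s.
  rewrite eqxx; apply: (cell_slope_gtN1 fC eps_gt0 fI) => //; last by rewrite subrK.
  by move: h2; rewrite -/(sgn eps wbe i) s mul1r.
have -> : (-1 == 1 :> R) = false by apply/eqP; lra.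
apply: (cell_slope_gtN1 fC eps_gt0 fI) => //.
by move: h2; rewrite -/(sgn eps wbe i) s mulN1r opprK.
Qed.

Lemma traced_start : traced f eps wbe vbe n tc xc w v 0.
Proof.
have p0 i : pos f eps wbe tc xc w v 0 i = wave_start eps wbe i.+1 by rewrite pos_fine.
have l0 i : live f eps wbe tc xc w v 0 i by rewrite live_finite /= ltry.
split.
- by move=> i _; rewrite p0.
- by move=> i r _ _ ir; rewrite !p0; apply: (wave_start_mono eps_gt0 step_w fin_w TVn) => //=; rewrite ltnS ir ltn_ord.
- by move=> i r _ _; rewrite !p0 /sgn /wave_sign => ->.
- move=> i _; rewrite /hgt -(wave_chain eps_gt0 step_w fin_w latt_w TVn (ord1 i)) big_ord_recr/= mulrDr.
  rewrite [sgn eps wbe i * eps]mulrC addrK; congr (_ * _).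
  rewrite (big_ord_widen n (fun m : nat => wave_sign eps wbe m.+1)); last exact: ltnW.
  by apply: eq_bigl => r; rewrite l0.
- move=> x; rewrite (wfs_t0 sol) (wfs_w0 sol) (datum_waves eps_gt0 step_w fin_w latt_w TVn).
  by congr (_ * _); apply: eq_bigl => r; rewrite l0 p0.
- by move=> x; rewrite (wfs_t0 sol) (wfs_v0 sol) addr0.
Qed.

End Start.

Section Nodes.
Variables (R : realType) (f : R -> R -> R) (eps : R) (wbe vbe : R -> R).
Variables (J n : nat) (tc xc : nat -> R) (w v : R -> R -> R).
Hypothesis sol : wavefront_solution eps f wbe vbe J tc xc w v.
Implicit Types i r : 'I_n.

Lemma node_times_mono (l j : nat) : (l <= j <= J)%N -> tc l <= tc j.
Proof.
elim: j => [|j IH]; first by rewrite leqn0 => /andP[/eqP ->].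
move=> /andP[]; rewrite leq_eqVlt => /predU1P[->//|lj jJ].
by apply: le_trans (ltW (wfs_incr sol jJ)); apply: IH; rewrite -ltnS lj ltnW.
Qed.

Lemma last_node_node j : (j <= J)%N -> last_node J tc (tc j) = j.
Proof.
move=> jJ; rewrite /last_node; apply/eqP; rewrite eqn_leq; apply/andP; split; last first.
  have := @leq_bigmax_cond _ (fun k : 'I_J.+1 => tc k <= tc j) (fun k : 'I_J.+1 => k : nat) (inord j).
  by rewrite inordK// lexx => /(_ isT).
apply/bigmax_leqP => k kj; rewrite leqNgt; apply/negP => jk.
have jJ' : (j < J)%N by apply: leq_trans jk _; rewrite -ltnS.
have jkJ : (j.+1 <= k <= J)%N by rewrite jk -ltnS ltn_ord.
have := node_times_mono jkJ.
by rewrite leNgt (le_lt_trans kj (wfs_incr sol jJ')).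
Qed.

Lemma position_node j s : (j <= J)%N ->
  position eps f wbe J tc xc w v (tc j) s = node_position eps f wbe tc xc w v j s.
Proof. by move=> jJ; rewrite /position last_node_node// subrr mule0 adde0. Qed.

Lemma speed_node j i : (j <= J)%N -> traced f eps wbe vbe n tc xc w v j ->
  live f eps wbe tc xc w v j i ->
  speed eps f wbe J tc xc w v (tc j) i.+1 = (spd f eps wbe tc xc w v j i)%:E.
Proof. by move=> jJ T li; rewrite /speed position_node// -(speed_spd T li). Qed.

Lemma waves_node (F : nat -> \bar R) j : (j <= J)%N -> 0 < eps -> TV wbe = n%:R * eps ->
  (\sum_(s \in waves_at eps f wbe J tc xc w v (tc j)) F s
   = \sum_(i : 'I_n | live f eps wbe tc xc w v j i) F i.+1)%E.
Proof.
move=> jJ e0 TVn.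
have -> : waves_at eps f wbe J tc xc w v (tc j) =
    [set` [seq i.+1 | i : 'I_n <- enum 'I_n & live f eps wbe tc xc w v j i]]%classic.
  apply/seteqP; split=> s.
    move=> [/(wavesE e0 TVn)/andP[s0 sn]]; rewrite position_node// => fin.
    have sn' : (s.-1 < n)%N by rewrite prednK.
    apply/mapP; exists (Ordinal sn') => /=; last by rewrite prednK.
    by rewrite mem_filter mem_enum live_finite /npos /= prednK// fin.
  move=> /mapP[i]; rewrite mem_filter live_finite => /andP[li _] ->; split.
    by apply/(wavesE e0 TVn); rewrite /= ltn_ord.
  by rewrite position_node.
rewrite -fsbig_seq/=; last first.
  by rewrite map_inj_uniq ?filter_uniq -?enumT ?enum_uniq// => i r [] e; exact: val_inj.
by rewrite big_map big_filter big_enum_cond.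
Qed.

End Nodes.

Local Open Scope classical_set_scope.
Local Open Scope ring_scope.

Lemma TV_le (R : realType) (g h : R -> R) : (tot_var setT h < +oo)%E ->
  (tot_var setT g <= tot_var setT h)%E -> (tot_var setT g < +oo)%E /\ TV g <= TV h.
Proof.
move=> hfin gh; have gfin := le_lt_trans gh hfin; split=> //.
have nonneg k : (0 <= tot_var setT k :> \bar R)%E.
  apply: (@le_trans _ _ (total_variation 0 0 k)); first exact: total_variation_ge0.
  by apply: ereal_sup_ubound; exists (0, 0) => //=; split.
by apply: fine_le => //; rewrite ge0_fin_numE.
Qed.

Lemma ln2_bound (R : realType) : 2 <= 12 * ln 2 :> R.
Proof.
have : -1 < - 2^-1 :> R by lra.
move=> /le_ln1Dx; have -> : 1 + - 2^-1 = 2^-1 :> R by lra.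
by rewrite lnV ?posrE//; lra.
Qed.

Lemma bound_le (R : realFieldType) (K1 K2 K3 a b A B c : R) :
  0 <= K1 -> 0 <= K2 -> 0 <= K3 -> 0 <= a -> 0 <= b -> a <= A -> b <= B -> 2 <= c ->
  (3 * K1 + 2 * K2 * b) * a ^+ 2 + K3 * a * b <= (3 * K1 + c * K2 * B) * A ^+ 2 + K3 * A * B.
Proof.
move=> hK1 hK2 hK3 a0 b0 aA bB c1.
have A2 : a ^+ 2 <= A ^+ 2 by rewrite lerXn2r// nnegrE (le_trans a0).
have ab : K3 * (a * b) <= K3 * (A * B) by apply: ler_wpM2l => //; exact: ler_pM.
have Kb : 2 * K2 * b <= c * K2 * B.
  by apply: ler_pM => //; rewrite ?mulr_ge0// ler_wpM2r.
apply: lerD; last by rewrite -!mulrA.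
apply: ler_pM => //; last by rewrite lerD2l.
- by rewrite addr_ge0 ?mulr_ge0.
- exact: sqr_ge0.
Qed.

Theorem theorem1 (R : realType) (f : R -> R -> R)
  (f_C3 : class_C 3 f)
  (f_bounded : forall l, (size l <= 3)%N -> has_ubound (abs_range (partial l f)))
  (f_speed : \forall p \near ((0, 0) : R * R), - 1 < pdw f p.1 p.2)
  (eps : R) (eps_gt0 : 0 < eps)
  (wbar vbar : R -> R)
  (wbar_BV : (tot_var setT wbar < +oo)%E) (vbar_BV : (tot_var setT vbar < +oo)%E)
  (Iw Iv : interval R) (Iw0 : 0 \in Iw) (Iv0 : 0 \in Iv)
  (f_speedI : forall a b, a \in Iw -> b \in Iv -> - 1 < pdw f a b)
  (wbe vbe : R -> R)
  (wbe_adm : admissible_datum eps wbe) (vbe_adm : admissible_datum eps vbe)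
  (wbe_TV : (tot_var setT wbe <= tot_var setT wbar)%E)
  (vbe_TV : (tot_var setT vbe <= tot_var setT vbar)%E)
  (wbe_I : forall x, wbe x \in Iw) (vbe_I : forall x, vbe x \in Iv)
  (J : nat) (tc xc : nat -> R) (w v : R -> R -> R)
  (wv_sol : wavefront_solution eps f wbe vbe J tc xc w v) :
  (\sum_(1 <= j < J.+1)
     \sum_(s \in waves_at eps f wbe J tc xc w v (tc j))
       (`| speed eps f wbe J tc xc w v (tc j) s
           - speed eps f wbe J tc xc w v (tc j.-1) s | * eps%:E)
   <= ((3 * supnorm (pdw (pdw f))
        + 12 * ln 2 * supnorm (pdw (pdw (pdv f))) * TV vbar) * TV wbar ^+ 2
       + supnorm (pdw (pdv f)) * TV wbar * TV vbar)%:E)%E.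
Proof.
have [fin_w TVw] := TV_le wbar_BV wbe_TV; have [fin_v TVv] := TV_le vbar_BV vbe_TV.
have [sw step_w] := admissible_step wbe_adm; have [sv step_v] := admissible_step vbe_adm.
have latt := datum_lattice wbe_adm.
have [n TVn] := TV_lattice eps_gt0 step_w fin_w latt.
have signs := initial_signs eps_gt0 step_w fin_w TVn.
have slopes := initial_slopes eps_gt0 step_w fin_w latt TVn f_C3 f_speedI wbe_I vbe_I.
have start := traced_start eps_gt0 step_w fin_w latt TVn wv_sol.
have traced_j j (jJ : (j <= J)%N) := traced_le eps_gt0 step_v signs slopes wv_sol start jJ.
have change := change_le eps_gt0 step_v signs slopes wv_sol start f_C3 f_bounded fin_v.
have sup0 l (hl : (size l <= 3)%N) := supnorm_ge0 (f_bounded l hl).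
have K1 := sup0 [:: true; true] isT.
have K2 := sup0 [:: true; true; false] isT.
have K3 := sup0 [:: true; false] isT.
rewrite /= in K1 K2 K3.
rewrite big_add1/= (_ : (\sum_(0 <= j < J) _)%E =
  (\sum_(0 <= j < J) (eps * \sum_(i < n | live f eps wbe tc xc w v j.+1 i)
     `|spd f eps wbe tc xc w v j.+1 i - spd f eps wbe tc xc w v j i|))%:E); last first.
  rewrite -sumEFin !big_nat; apply: eq_bigr => j /= jJ.
  rewrite (waves_node wv_sol _ jJ eps_gt0 TVn) mulr_sumr -sumEFin.
  apply: eq_bigr => i li.
  have lj := live_prev eps_gt0 step_v signs wv_sol jJ (traced_j j (ltnW jJ)) li.
  rewrite (speed_node wv_sol jJ (traced_j _ jJ) li).
  by rewrite (speed_node wv_sol (ltnW jJ) (traced_j _ (ltnW jJ)) lj) -EFinB abse_EFin -EFinM mulrC.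
rewrite lee_fin; apply: le_trans change _.
have TVw0 : 0 <= TV wbe by rewrite TVn mulr_ge0// ltW.
have TVv0 : 0 <= TV vbe.
  by have [x <-] := cum_var_TV step_v; exact: (cum_var_ge0 step_v).
rewrite [eps * n%:R]mulrC -TVn.
exact (bound_le K1 K2 K3 TVw0 TVv0 TVw TVv (ln2_bound R)).
Qed.
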